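(* Let $m\in\mathbb{N}\cup\{0\}$, $0<\alpha<n$ and $0<\delta<\min\{1,(n-\alpha)/m\}$. Let $1<p<n/(m\delta+\alpha)$, $1/q=1/p-(m\delta+\alpha)/n$ and $b\in\Lambda(\delta)$. Assume that $T_\alpha$ has a kernel $K_\alpha\in S_\alpha\cap H_{\alpha,\Phi}$ for a Young function $\Phi$ such that its complementary function $\widetilde\Phi\in\mathcal{B}_{m\delta+\alpha,\beta}$ for some $1\le\beta<p$. Then, if $w$ is a weight verifying $w^\beta\in A_{\frac p\beta,\frac q\beta}$, there exists a positive constant $C$ such that $$\left(\int_{\mathbb{R}^n}|T^m_{\alpha,b}f(x)|^qw(x)^q\,dx\right)^{1/q}\le C\,\|b\|_{\Lambda(\delta)}^m\left(\int_{\mathbb{R}^n}|f(x)|^pw(x)^p\,dx\right)^{1/p}$$ for every $f\in L^p_w(\mathbb{R}^n)$.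
   Context: Operators: $T_\alpha f(x)=\int_{\mathbb{R}^n}K_\alpha(x-y)f(y)\,dy$, where $K_\alpha$ is not identically zero. For a symbol $b\in L^1_{\rm loc}(\mathbb{R}^n)$ the commutator of order $m$ is formally defined by $T^m_{\alpha,b}f(x)=\int_{\mathbb{R}^n}(b(x)-b(y))^mK_\alpha(x-y)f(y)\,dy$; thus $T^0_{\alpha,b}=T_\alpha$. Young functions: a Young function is an increasing convex $\Phi:[0,\infty)\to[0,\infty)$ with $\Phi(0)=0$ and $\Phi(t)\to\infty$ as $t\to\infty$. Its complementary function is $\widetilde\Phi(t)=\sup_{s>0}\{st-\Phi(s)\}$. The Luxemburg average over a ball $B$ is $\|f\|_{\Phi,B}=\inf\{\lambda>0:\frac1{|B|}\int_B\Phi(|f(x)|/\lambda)\,dx\le1\}$. Condition $S_\alpha$: there is $C>0$ with $\int_{s<|x|\le 2s}|K_\alpha(x)|\,dx\le Cs^\alpha$ for every $s>0$. Condition $H_{\alpha,\Phi}$: there exist $c\ge1$ and $C>0$ such that for every $y\in\mathbb{R}^n$ and $R>c|y|$, $\sum_{j=1}^\infty(2^jR)^{n-\alpha}\|(K_\alpha(\cdot-y)-K_\alpha(\cdot))\chi_{|\cdot|\sim2^jR}\|_{\Phi,B(0,2^{j+1}R)}\le C$, where $|\cdot|\sim s$ denotes the set $\{x\in\mathbb{R}^n:s<|x|\le2s\}$. Class $\mathcal{B}_{\sigma,\beta}$: for $0<\sigma<n$ and $1\le\beta<n/\sigma$, a Young function $\Psi$ belongs to $\mathcal{B}_{\sigma,\beta}$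 if $t^{-\sigma/n}\Psi^{-1}(t)$ is the inverse of a Young function and $\Psi^{1+\rho\sigma/n}\in B_\rho$ for every $\rho>n\beta/(n-\sigma\beta)$, i.e. there is a positive constant $c$ such that $\int_c^\infty\frac{\Psi(t)^{1+\rho\sigma/n}}{t^\rho}\frac{dt}t<\infty$ for each such $\rho$. Symbols: for $0<\delta<1$, $\Lambda(\delta)$ is the set of functions $b$ for which there is $C>0$ with $|b(x)-b(y)|\le C|x-y|^\delta$ for all $x,y\in\mathbb{R}^n$; $\|b\|_{\Lambda(\delta)}$ is the smallest such $C$. Weights: a weight is a non-negative locally integrable function $w$. $f\in L^p_w(\mathbb{R}^n)$ means $fw\in L^p(\mathbb{R}^n)$. For $1\le p,q<\infty$, $w\in A_{p,q}$ means $\sup_B\left(\frac1{|B|}\int_Bw^q\right)^{1/q}\left(\frac1{|B|}\int_Bw^{-p'}\right)^{1/p'}<\infty$, the supremum being over all balls $B\subset\mathbb{R}^n$ (with $1/p+1/p'=1$). Convention: $\beta/0=\infty$ if $\beta>0$. *)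

(* Defs.v *)
From HB Require Import structures.
From mathcomp Require Import all_boot all_order all_algebra.
From mathcomp Require Import all_classical all_reals all_analysis.

Set Implicit Arguments.
Unset Strict Implicit.
Unset Printing Implicit Defensive.

Import Order.TTheory GRing.Theory Num.Theory.
Import numFieldNormedType.Exports.

Local Open Scope classical_set_scope.
Local Open Scope ring_scope.

(* The Borel sigma-algebra of R^n = 'rV[R]_n, generated by the coordinates. *)
Definition rV_display : measure_display.
Proof. exact: default_measure_display. Qed.

Section measurable_rV.
Variables (R : realType) (n : nat).

Let coors : 'I_n -> 'rV[R]_n -> measurableTypeR R := fun i x => x ord0 i.

Let rV_set0 : g_sigma_preimage coors set0.
Proof. exact: sigma_algebra0. Qed.

Let rV_setC A : g_sigma_preimage coors A -> g_sigma_preimage coors (~` A).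
Proof. exact: sigma_algebraC. Qed.

Let rV_bigcup (F : _^nat) : (forall i, g_sigma_preimage coors (F i)) ->
  g_sigma_preimage coors (\bigcup_i (F i)).
Proof. exact: sigma_algebra_bigcup. Qed.

HB.instance Definition _ := @isMeasurable.Build rV_display
  'rV[R]_n (g_sigma_preimage coors) rV_set0 rV_setC rV_bigcup.

End measurable_rV.

Lemma measurable_coord (R : realType) (n : nat) (i : 'I_n) :
  measurable_fun setT (fun x : 'rV[R]_n => x ord0 i : measurableTypeR R).
Proof.
move=> _ Y mY; rewrite setTI; apply: sub_sigma_algebra => /=.
rewrite -bigcup_seq/=; exists i => /=; first by rewrite mem_index_enum.
by exists Y => //; rewrite setTI.
Qed.

Lemma measurable_fun_rVP (R : realType) (n : nat) d (T : measurableType d)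
    (f : T -> 'rV[R]_n) :
  measurable_fun setT f <->
  forall i, measurable_fun setT (fun t => f t ord0 i : measurableTypeR R).
Proof.
split=> [mf i|mf].
  exact: (measurableT_comp (@measurable_coord R n i) mf).
move=> _ Y mY; rewrite setTI.
pose F := [set A : set 'rV[R]_n | measurable (f @^-1` A)].
suff sF : @measurable _ 'rV[R]_n `<=` F by exact: sF.
apply: smallest_sub.
  split.
  - by rewrite /F/= preimage_set0.
  - by move=> A; rewrite /F/= setTD preimage_setC => /measurableC.
  - by move=> A mA; rewrite /F/= preimage_bigcup; exact: bigcupT_measurable.
rewrite -bigcup_seq => A [i _ [B mB <-]]; rewrite /F/= setTI.
by have := mf i measurableT B mB; rewrite setTI.
Qed.

Section lebesgue_rV.
Variable R : realType.

Definition rV_cons (n : nat) (p : measurableTypeR R * 'rV[R]_n) : 'rV[R]_n.+1 :=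
  row_mx (p.1%:M : 'M[R]_1) p.2.

Lemma measurable_rV_cons n : measurable_fun setT (@rV_cons n).
Proof.
apply/measurable_fun_rVP => i.
have [j ->|j ->] := split_ordP (i : 'I_(1 + n)).
  rewrite (_ : (fun _ => _) = fst); first exact: measurable_fst.
  by apply/funext => p; rewrite /rV_cons (@row_mxEl _ 1 1 n) (ord1 j) mxE eqxx mulr1n.
rewrite (_ : (fun _ => _) = (fun x : 'rV[R]_n => x ord0 j) \o snd).
  by apply: measurableT_comp; [exact: measurable_coord|exact: measurable_snd].
by apply/funext => p; rewrite /rV_cons (@row_mxEr _ 1 1 n).
Qed.

Section step.
Variables (n : nat) (m : {sigma_finite_measure set 'rV[R]_n -> \bar R}).

Definition lebesgue_rV_step : set 'rV[R]_n.+1 -> \bar R :=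
  pushforward (lebesgue_measure \x m)%E (@rV_cons n).

Let step0 : lebesgue_rV_step set0 = 0%E.
Proof. by rewrite /lebesgue_rV_step /pushforward preimage_set0 measure0. Qed.

Let step_ge0 A : (0 <= lebesgue_rV_step A)%E.
Proof. exact: (measure_ge0 (lebesgue_measure \x m)%E). Qed.

Let step_additive : semi_sigma_additive lebesgue_rV_step.
Proof.
move=> F mF tF mUF; rewrite /lebesgue_rV_step /pushforward preimage_bigcup.
have mc A : measurable A -> measurable (@rV_cons n @^-1` A).
  by move=> mA; rewrite -[X in measurable X]setTI; exact: measurable_rV_cons.
apply: measure_semi_sigma_additive.
- by move=> k; exact: mc.
- apply/trivIsetP => /= i j _ _ ij; rewrite -preimage_setI.
  by move/trivIsetP : tF => /(_ _ _ _ _ ij) ->//; rewrite preimage_set0.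
- by rewrite -preimage_bigcup; exact: mc.
Qed.

HB.instance Definition _ := isMeasure.Build _ _ _
  lebesgue_rV_step step0 step_ge0 step_additive.

Let step_sigma_finite : sigma_finite setT lebesgue_rV_step.
Proof.
have [F TF Foo] : sigma_finite setT (@lebesgue_measure R \x m)%E.
  have /sigma_finiteP[F [TF ndF Foo]] := sigma_finiteT (@lebesgue_measure R).
  have /sigma_finiteP[G [TG ndG Goo]] := sigma_finiteT m.
  exists (fun k => F k `*` G k).
    rewrite -setXTT TF TG predeqE => -[x y]; split.
      move=> [/= [i _ Fix] [j _ Gjy]]; exists (maxn i j) => //; split.
      - by move: x Fix; exact/subsetPset/ndF/leq_maxl.
      - by move: y Gjy; exact/subsetPset/ndG/leq_maxr.
    by move=> [k _ []/= ? ?]; split; exists k.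
  move=> k; have [mF Fk] := Foo k; have [mG Gk] := Goo k.
  split; first exact: measurableX.
  by rewrite product_measure1E// lte_mul_pinfty// ge0_fin_numE.
pose u (x : 'rV[R]_n.+1) : measurableTypeR R * 'rV[R]_n :=
  (x ord0 ord0, \row_i x ord0 (lift ord0 i)).
have mu : measurable_fun setT u.
  apply: measurable_fun_pair; first exact: measurable_coord.
  apply/measurable_fun_rVP => i.
  rewrite (_ : (fun _ => _) = fun x : 'rV[R]_n.+1 => x ord0 (lift ord0 i)).
    exact: measurable_coord.
  by apply/funext => x; rewrite mxE.
have uK : cancel (@rV_cons n) u.
  move=> [t y]; rewrite /u /rV_cons; congr pair.
    rewrite (_ : ord0 = lshift n ord0 :> 'I_(1 + n)); last exact/val_inj.
    by rewrite (@row_mxEl _ 1 1 n) mxE eqxx mulr1n.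
  apply/rowP => i; rewrite mxE /=.
  rewrite (_ : lift ord0 i = rshift 1 i :> 'I_(1 + n)); last exact/val_inj.
  by rewrite (@row_mxEr _ 1 1 n).
exists (fun k => u @^-1` F k); first by rewrite -preimage_bigcup -TF preimage_setT.
move=> k; have [mF Fk] := Foo k; split.
  by rewrite -[X in measurable X]setTI; exact: mu.
rewrite /lebesgue_rV_step /pushforward -comp_preimage.
by rewrite (_ : u \o _ = id)//; apply/funext => p /=; rewrite uK.
Qed.

HB.instance Definition _ := Measure_isSigmaFinite.Build _ _ _
  lebesgue_rV_step step_sigma_finite.

End step.

(* n-dimensional Lebesgue measure (on Borel sets): the n-fold product of the
   one-dimensional one. *)
Fixpoint lebesgue_rV (n : nat) : {sigma_finite_measure set 'rV[R]_n -> \bar R} :=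
  match n with
  | 0%N => @dirac _ 'rV[R]_0 0 R
  | k.+1 => lebesgue_rV_step (lebesgue_rV k)
  end.

End lebesgue_rV.

Section notions.
Variable R : realType.
Local Notation "''mu_' n" := (lebesgue_rV R n) (at level 0, n at level 0).

(* The library norm on 'rV[R]_n is the sup norm, hence this one. *)
Definition enorm (n : nat) (x : 'rV[R]_n) : R :=
  Num.sqrt (\sum_i x ord0 i ^+ 2).

Definition eball (n : nat) (x : 'rV[R]_n) (r : R) : set 'rV[R]_n :=
  [set y | enorm (x - y) < r].

Definition annulus (n : nat) (s : R) : set 'rV[R]_n :=
  [set x | s < enorm x <= 2 * s].

(* Lebesgue measurability: equality a.e. with a Borel function.  On such
   functions the library integral against the Borel measure (a supremum over
   Borel simple functions) is the usual Lebesgue integral. *)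
Definition lebesgue_measurable (n : nat) (f : 'rV[R]_n -> R) : Prop :=
  exists2 g : 'rV[R]_n -> R, measurable_fun setT g &
    {ae 'mu_n, forall x, f x = g x}.

Definition mean (n : nat) (B : set 'rV[R]_n) (f : 'rV[R]_n -> \bar R) : \bar R :=
  (('mu_n B)^-1 * \int['mu_n]_(x in B) f x)%E.

(* [T^m_{alpha,b} f (x)], as an extended real: with the library conventions
   (oo - oo = -oo) it is finite exactly when the integral converges
   absolutely. *)
Definition commutator (n m : nat) (b K f : 'rV[R]_n -> R) (x : 'rV[R]_n)
    : \bar R :=
  (\int['mu_n]_y ((b x - b y) ^+ m * K (x - y) * f y)%:E)%E.

(* Only the values on [0, +oo[ are relevant. *)
Definition young (Phi : R -> R) : Prop :=
  [/\ Phi 0 = 0,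
      {in `[0, +oo[ &, {homo Phi : s t / s <= t}},
      @convex_function R R^o `[0, +oo[ Phi &
      Phi t @[t --> +oo] --> +oo].

(* Extended-real valued: the supremum may be infinite. *)
Definition young_complement (Phi : R -> R) (t : R) : \bar R :=
  ereal_sup [set (s * t - Phi s)%:E | s in [set s : R | 0 < s]].

(* Generalized right-continuous inverse, for t >= 0; it is the inverse function
   of Phi whenever Phi is strictly increasing on [0, +oo[. *)
Definition young_inv (Phi : R -> R) (t : R) : R :=
  inf [set s : R | 0 <= s /\ t < Phi s].

(* The infimum is +oo when no lambda is admissible. *)
Definition luxemburg (n : nat) (Phi : R -> R) (B : set 'rV[R]_n)
    (f : 'rV[R]_n -> R) : \bar R :=
  ereal_inf [set l%:E | l in [set l : R | 0 < l /\
    (mean B (fun x => (Phi (`|f x| / l))%:E) <= 1)%E]].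

Definition cond_S (n : nat) (alpha : R) (K : 'rV[R]_n -> R) : Prop :=
  exists C : R, 0 < C /\ forall s : R, 0 < s ->
    (\int['mu_n]_(x in annulus s) `|K x|%:E <= (C * s `^ alpha)%:E)%E.

Definition cond_H (n : nat) (alpha : R) (Phi : R -> R) (K : 'rV[R]_n -> R)
    : Prop :=
  exists c C : R, [/\ 1 <= c, 0 < C &
    forall (y : 'rV[R]_n) (r : R), c * enorm y < r ->
      (\sum_(1 <= j <oo) (((2 ^+ j * r) `^ (n%:R - alpha))%:E *
         luxemburg Phi (eball 0 (2 ^+ j.+1 * r)%R)
           (fun x => (K (x - y) - K x) * \1_(annulus (2 ^+ j * r)) x)%R)
       <= C%:E)%E].

Definition class_B (rho : R) (Theta : R -> R) : Prop :=
  exists c : R, 0 < c /\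
    (\int[lebesgue_measure]_(t in `[c, +oo[) (Theta t / t `^ rho / t)%:E
     < +oo)%E.

Definition class_Bsb (n : nat) (sigma beta : R) (Psi : R -> R) : Prop :=
  [/\ young Psi,
      (exists2 Theta : R -> R, young Theta & forall t : R, 0 < t ->
         t `^ (- (sigma / n%:R)) * young_inv Psi t = young_inv Theta t) &
      forall rho : R, n%:R * beta / (n%:R - sigma * beta) < rho ->
        class_B rho (fun t => Psi t `^ (1 + rho * sigma / n%:R))].

Definition lip_consts (n : nat) (delta : R) (b : 'rV[R]_n -> R) : set R :=
  [set C | 0 < C /\ forall x y, `|b x - b y| <= C * enorm (x - y) `^ delta].

Definition Lip (n : nat) (delta : R) (b : 'rV[R]_n -> R) : Prop :=
  exists C, lip_consts delta b C.

Definition lip_norm (n : nat) (delta : R) (b : 'rV[R]_n -> R) : R :=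
  inf (lip_consts delta b).

Definition weight (n : nat) (w : 'rV[R]_n -> R) : Prop :=
  [/\ forall x, 0 <= w x,
      lebesgue_measurable w &
      forall A : set 'rV[R]_n, compact A ->
        (\int['mu_n]_(x in A) (w x)%:E < +oo)%E].

Definition Lpw (n : nat) (p : R) (w f : 'rV[R]_n -> R) : Prop :=
  lebesgue_measurable (fun x => f x * w x) /\
  (\int['mu_n]_x (`|f x * w x| `^ p)%:E < +oo)%E.

(* Muckenhoupt-Wheeden class A_{p,q} for 1 < p, with p' = p / (p - 1).
   [w ^ (- p')] is written as an extended-real inverse, so that it is +oo where
   w vanishes; the real power [0 `^ (- p')] would be 0. *)
Definition Apq (n : nat) (p q : R) (w : 'rV[R]_n -> R) : Prop :=
  let p' := p / (p - 1) in
  (ereal_sup [set mean (eball B.1 B.2) (fun x => (w x `^ q)%:E) `^ q^-1 *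
                  mean (eball B.1 B.2) (fun x => ((w x `^ p')%:E)^-1) `^ p'^-1
             | B in [set B : 'rV[R]_n * R | (0 < B.2)%R]] < +oo)%E.

End notions.

(* Main.v *)
Require Import Defs.
From mathcomp Require Import all_boot all_order all_algebra.
From mathcomp Require Import all_classical all_reals all_analysis.
From mathcomp Require Import measurable_realfun.
From mathcomp Require Import ring lra zify.

(** Put [sigma = m * delta + alpha], so that [1/q = 1/p - sigma/n], and
[b' = 1/beta - 1/p].  By the Lipschitz condition the commutator is at most the
[m]-th power of the norm of the symbol times the integral of
[|x - y| ^ (m * delta) * |K (x - y)| * |f y|].  This positive operator is dominated
by dyadic averages, and the averages are estimated on each grid separately.

The kernel.  On a ring [s < |z| < 2 * s] write [K z] as the sum of
[K z - K (z - v)] and [K (z - v)], and average over small [v].  The condition on the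
oscillation of [K] controls the first term in a Luxemburg norm, which Young's
inequality pairs with [h]; the condition on the size of [K] controls the second.
The class of [Psi] enters only through the growth [Psi t <= C * (1 + t ^ r)], valid
for every [r] between [beta] and [p] ([class_B_growth]).  The result
([kernel_ring_estimate]) is that on the ring the integral of [|K| * h] is at most
[s ^ alpha] times the [L^r] average of [h] over the ball of radius [2 * s].  Every
ball lies in a cube of comparable size of one of finitely many shifted dyadic
grids ([shifted_grid_cover]).  Hence, on each of these grids, it suffices to bound
the sum over the cubes containing [x], of side [l], of [l ^ sigma] times the [L^r]
average of [f] over the cube ([annular_majorant]).

The weight.  The hypothesis on [w ^ beta] says that the mean of [w ^ q] to the
power [1/q] times the mean of [w ^ (- 1/b')] to the power [b'] is bounded.  Both
densities then lose a fixed proportion of their mass on half of a cube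
([muckenhoupt_half_decay]); this yields a reverse Hölder inequality
([reverse_hoelder_cube]), by which [beta] may be replaced by a slightly larger [r].
This is the [r] used for the kernel ([dyadic_weighted]).

The dyadic operator ([dyadic_strong_type]).  Let [g = |f| ^ r], let [u] and [v] be
the two densities and [t = p / r].  The maximal cubes on which the average of [g]
exceeds the powers of twice the ratio of the grid are sparse, and the sum over all
the cubes containing [x] is bounded by the sum over these stopping cubes.  Let
[L i] be the series of the indicators of the superlevel sets of level [i + j] with
coefficients [kappa ^ (- j)].  It grows geometrically as [i] decreases, so that
the [q]-th power of a sum of terms [A i] is at most a constant times the sum of the
[A i ^ q * L i]; but by decay its integral against [u] over a stopping cube of level
[i] is comparable to the mass of [u] there.  This leaves the sum over the stopping
cubes [P] of [(g(P) / v(P)) ^ t * v(P)].  In each of them the part of [g] below a small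
multiple of [(g(P) / v(P)) * L i * v] can be absorbed, and what remains is the
integral over [P] of [L i ^ (1 - t) * g ^ t * v ^ (1 - t)].  Its sum over [i]
converges, since the [L i] are geometric once more, to at most a multiple of the
[p]-th power of the norm of [f].  No maximal function is needed.

The integrands need not be Borel functions.  The integral of a nonnegative
function is a lower integral, which is monotone and does not see null sets, but is
additive for measurable functions only; therefore [K], [f] and [w] are replaced by
Borel functions equal to them almost everywhere before anything is added.  A
weight that satisfies the hypothesis vanishes either almost everywhere or almost
nowhere ([weight_dichotomy]). *)

Set Implicit Arguments.
Unset Strict Implicit.
Unset Printing Implicit Defensive.

Import Order.TTheory GRing.Theory Num.Theory.
Import numFieldNormedType.Exports.

Local Open Scope classical_set_scope.
Local Open Scope ring_scope.

(** * Integrals of possibly non-measurable functions *)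

Section lower_integral.
Local Open Scope ereal_scope.
Context d (T : measurableType d) (R : realType).
Variable mu : {measure set T -> \bar R}.
Implicit Types (D : set T) (f g : T -> \bar R).

Import HBNNSimple.

(** The integral of a nonnegative function is a supremum over simple functions
below it, so that monotonicity and insensitivity to null sets do not need any
measurability. *)
Lemma ae_lower_integral_le D f g : measurable D ->
  (forall x, D x -> 0 <= f x) -> (forall x, D x -> 0 <= g x) ->
  {ae mu, forall x, D x -> f x <= g x} ->
  \int[mu]_(x in D) f x <= \int[mu]_(x in D) g x.
Proof.
move=> mD f0 g0 [N [mN N0 fgN]].
rewrite (ge0_integralE _ f0) (ge0_integralE _ g0).
apply: ge_ereal_sup => _ [h /= hf <-].
apply: le_ereal_sup_tmp.
have mNC : measurable (~` N) by exact: measurableC.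
pose h' := proj_nnsfun h mNC.
have h'E x : h' x = (h \_ (~` N)) x by rewrite mrestrict.
exists (sintegral mu h').
  exists h' => // x; rewrite h'E !patchE.
  case: (boolP (x \in ~` N)) => xN /=; last first.
    case: ifPn => // xD; apply: g0; exact/set_mem.
  have := hf x; rewrite patchE; case: ifPn => // /set_mem Dx hx.
  apply: (le_trans hx); apply: contrapT => fg; move/set_mem: xN; apply.
  by apply: fgN => /= /(_ Dx).
rewrite -2!integralT_nnsfun; apply: ae_ge0_le_integral => //.
- by move=> x _ /=; rewrite lee_fin.
- exact/measurable_EFinP.
- by move=> x _; rewrite lee_fin.
- exact/measurable_EFinP.
exists N; split => // x; apply: contra_notP => Nx _.
by rewrite lee_fin h'E patchE mem_set.
Qed.

Lemma lower_integral_le D f g : measurable D ->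
  (forall x, D x -> 0 <= f x) -> (forall x, D x -> f x <= g x) ->
  \int[mu]_(x in D) f x <= \int[mu]_(x in D) g x.
Proof.
move=> mD f0 fg; apply: ae_lower_integral_le => //.
  by move=> x Dx; exact: le_trans (f0 _ Dx) (fg _ Dx).
exact: aeW.
Qed.

Lemma ae_lower_integral_eq D f g : measurable D ->
  (forall x, D x -> 0 <= f x) -> (forall x, D x -> 0 <= g x) ->
  {ae mu, forall x, D x -> f x = g x} ->
  \int[mu]_(x in D) f x = \int[mu]_(x in D) g x.
Proof.
move=> mD f0 g0 fg; apply/eqP; rewrite eq_le; apply/andP; split.
  by apply: ae_lower_integral_le => //; apply: filterS fg => x /[swap] Dx ->.
by apply: ae_lower_integral_le => //; apply: filterS fg => x /[swap] Dx ->.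
Qed.

(** The positive and the negative parts are estimated separately, since the
lower integral is not additive; this costs the factor 2. *)
Lemma abse_integral_le2 D f : measurable D ->
  `|\int[mu]_(x in D) f x| <= 2%:E * \int[mu]_(x in D) `|f x|.
Proof.
move=> mD; rewrite integralE.
have p0 : 0 <= \int[mu]_(x in D) f^\+ x by exact: integral_ge0.
have n0 : 0 <= \int[mu]_(x in D) f^\- x by exact: integral_ge0.
apply: (@le_trans _ _ (\int[mu]_(x in D) f^\+ x + \int[mu]_(x in D) f^\- x)).
  case: (integral _ _ _) p0 => [a| |]; case: (integral _ _ _) n0 => [b| |] //=.
  rewrite !lee_fin => b0 a0; apply: (le_trans (ler_normB _ _)).
  by rewrite !ger0_norm.
rewrite mule_natl mule2n; apply: leeD; apply: lower_integral_le => // x _.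
  by rewrite -[leRHS]/((abse \o f) x) fune_abse leeDl.
by rewrite -[leRHS]/((abse \o f) x) fune_abse leeDr.
Qed.

End lower_integral.

(** * Sums over countable index types *)

Section esum_countable.
Local Open Scope ereal_scope.
Context (R : realType).

(** Transfers the theory of series of nonnegative extended reals to sums over
any countable type. *)
Lemma esum_pickle (I : countType) (S : set I) (a : I -> \bar R) :
  (forall i, S i -> 0 <= a i) ->
  \esum_(i in S) a i =
  \sum_(k <oo) (if pickle_inv k is Some i then
                  if i \in S then a i else 0 else 0).
Proof.
move=> a0; pose b k := if @pickle_inv I k is Some i then
                  if i \in S then a i else 0 else 0.
have b0 k : 0 <= b k.
  by rewrite /b; case: (@pickle_inv I k) => // i; case: ifPn => // /set_mem; exact: a0.
rewrite nneseries_esumT//.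
rewrite (esum_mkcond S) [RHS](esumID (range (@pickle I)))//; last first.
  by move=> i _; exact: b0.
rewrite [X in _ + X]esum1 ?adde0; last first.
  move=> k [_ nk]; rewrite /b; case: (@pickle_inv I k) (@pickle_invK I k) => //=.
  by move=> i ik; exfalso; apply: nk; exists i.
rewrite setTI (reindex_esum [set: I] (range (@pickle I)) (@pickle I)).
  by apply: eq_esum => i _; rewrite /b pickleK_inv.
split; [by move=> i _; exists i| |by []].
by move=> i j _ _; exact: (pcan_inj pickleK_inv).
Qed.

Lemma esumZl (I : countType) (S : set I) (a : I -> \bar R) (c : R) :
  (0 <= c)%R -> (forall i, S i -> 0 <= a i) ->
  \esum_(i in S) (c%:E * a i) = c%:E * \esum_(i in S) a i.
Proof.
move=> c0 a0; rewrite !esum_pickle//; last first.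
  by move=> i Si; rewrite mule_ge0// a0.
rewrite -nneseriesZl//; last first.
  by move=> k _; case: (@pickle_inv I k) => // i; case: ifPn => // /set_mem/a0.
apply: eq_eseriesr => k _; case: (@pickle_inv I k) => [i|]; last by rewrite mule0.
by case: ifPn => //; rewrite mule0.
Qed.

Lemma le_esum_single (I : choiceType) (S : set I) (a : I -> \bar R) i :
  S i -> 0 <= a i -> a i <= \esum_(j in S) a j.
Proof.
move=> Si a0; apply: esum_ge; exists [set i]; first by split => // j ->.
by rewrite fsbig_set1.
Qed.

Lemma exchange_esum (I J : choiceType) (S : set I) (Q : set J)
    (a : I -> J -> \bar R) : (forall i j, 0 <= a i j) ->
  \esum_(i in S) \esum_(j in Q) a i j = \esum_(j in Q) \esum_(i in S) a i j.
Proof.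
move=> a0; rewrite !esum_esum//.
rewrite (reindex_esum (Q `*`` (fun=> S)) (S `*`` (fun=> Q)) (fun k => (k.2, k.1)))//.
split; first by move=> [i j] [].
- by move=> [i j] [i' j'] _ _ /= [-> ->].
- by move=> [j i] [/= Qj Si]; exists (i, j).
Qed.

End esum_countable.

Section integral_esum.
Local Open Scope ereal_scope.
Context d (T : measurableType d) (R : realType).
Variable mu : {measure set T -> \bar R}.

Lemma measurable_fun_esum (I : countType) (S : set I) D (f : I -> T -> \bar R) :
  (forall i x, S i -> 0 <= f i x) ->
  (forall i, S i -> measurable_fun D (f i)) ->
  measurable_fun D (fun x => \esum_(i in S) f i x).
Proof.
move=> f0 mf.
have E x := esum_pickle (fun i (Si : S i) => f0 i x Si).
rewrite (funext E).
apply: ge0_emeasurable_sum => [k x Dx _|k _].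
  by case: (@pickle_inv I k) => // i; case: ifPn => // /set_mem/f0.
case: (@pickle_inv I k) => [i|]; last exact: measurable_cst.
case: (boolP (i \in S)) => [/set_mem/mf//|_]; exact: measurable_cst.
Qed.

Lemma integral_esum (I : countType) (S : set I) D (f : I -> T -> \bar R) :
  measurable D -> (forall i x, S i -> 0 <= f i x) ->
  (forall i, S i -> measurable_fun D (f i)) ->
  \int[mu]_(x in D) (\esum_(i in S) f i x) =
  \esum_(i in S) \int[mu]_(x in D) f i x.
Proof.
move=> mD f0 mf; rewrite esum_pickle; last first.
  by move=> i Si; apply: integral_ge0 => x _; exact: f0.
have E x := esum_pickle (fun i (Si : S i) => f0 i x Si).
rewrite (funext E).
rewrite integral_nneseries//.
- apply: eq_eseriesr => k _; case: (@pickle_inv I k) => [i|]; last by rewrite integral0.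
  by case: ifPn => //; rewrite integral0.
- move=> k; case: (@pickle_inv I k) => [i|]; last exact: measurable_cst.
  case: (boolP (i \in S)) => [/set_mem/mf//|_]; exact: measurable_cst.
- by move=> k x Dx; case: (@pickle_inv I k) => // i; case: ifPn => // /set_mem/f0.
Qed.

Lemma ge0_integral_indic (A D : set T) (f : T -> \bar R) :
  measurable A ->
  \int[mu]_(x in D) ((\1_A x)%:E * f x) = \int[mu]_(x in D `&` A) f x.
Proof.
move=> mA; rewrite [RHS]integral_mkcondr; apply: eq_integral => x _.
by rewrite patchE indicE; case: ifPn => _; rewrite ?mul1e ?mul0e.
Qed.

Lemma integral_bigcup_esum (I : countType) (S : set I) (F : I -> set T)
    (f : T -> \bar R) : (forall i, S i -> measurable (F i)) ->
  trivIset S F -> measurable_fun setT f -> (forall x, 0 <= f x) ->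
  \int[mu]_(x in \bigcup_(i in S) F i) f x =
  \esum_(i in S) \int[mu]_(x in F i) f x.
Proof.
move=> mF tF mf f0.
have mU : measurable (\bigcup_(i in S) F i).
  rewrite bigcup_mkcond; apply: countable_bigcupT_measurable => //.
  by move=> i; case: ifPn => // /set_mem; exact: mF.
rewrite integral_mkcond.
transitivity (\int[mu]_x \esum_(i in S) ((\1_(F i) x)%:E * f x)).
  apply: eq_integral => x _; rewrite patchE; case: ifPn => [/set_mem[i Si Fix]|].
    apply/esym; rewrite (esumID [set i]); last first.
      by move=> j _; rewrite mule_ge0// lee_fin.
    rewrite (_ : S `&` [set i] = [set i]); last by apply/seteqP; split=> [j []//|j ->].
    rewrite esum_set1 ?mule_ge0 ?lee_fin//.
    rewrite indicE mem_set// mul1e esum1 ?adde0// => j [Sj /= ij].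
    rewrite indicE memNset ?mul0e// => Fjx; apply: ij.
    by apply: (tF j i Sj Si); exists x.
  rewrite notin_setE => nx; rewrite esum1// => i Si.
  by rewrite indicE memNset ?mul0e// => Fix; apply: nx; exists i.
rewrite integral_esum//.
- by apply: eq_esum => i Si; rewrite ge0_integral_indic ?setTI//; exact: mF.
- by move=> i x Si; rewrite mule_ge0// lee_fin.
- move=> i Si; apply: emeasurable_funM => //; apply/measurable_EFinP.
  exact: measurable_indic (mF _ Si).
Qed.

Lemma null_of_integral_eq0 (E : set T) (h : T -> R) : measurable E ->
  measurable_fun E h -> (forall x, E x -> (0 < h x)%R) ->
  \int[mu]_(x in E) (h x)%:E = 0 -> mu E = 0.
Proof.
move=> mE mh h0; have mhE : measurable_fun E (fun x => (h x)%:E).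
  exact/measurable_EFinP.
have -> : \int[mu]_(x in E) (h x)%:E = integral mu E (abse \o (fun x => (h x)%:E)).
  by apply: eq_integral => x /set_mem Ex /=; rewrite gtr0_norm// h0.
move/(ae_eq_integral_abs mu mE mhE) => [N [mN N0 EN]].
apply: (subset_measure0 mE mN _ N0) => x Ex; apply: EN => /= /(_ Ex) [] /eqP.
by rewrite gt_eqF// h0.
Qed.

Lemma integral_scale (D : set T) (h : T -> R) (c : R) : measurable D ->
  measurable_fun D h -> (forall x, (0 <= h x)%R) -> (0 <= c)%R ->
  \int[mu]_(x in D) (c * h x)%:E = c%:E * \int[mu]_(x in D) (h x)%:E.
Proof.
move=> mD mh h0 c0; under eq_integral do rewrite EFinM.
rewrite ge0_integralZl//; first exact/measurable_EFinP.
by move=> x _; rewrite lee_fin.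
Qed.

End integral_esum.

(** * Geometric sums over the integers *)

Section geometric.
Context (R : realType).
Local Open Scope ereal_scope.

Lemma geometric_nneseries_le (a : nat -> R) (x c : R) : (0 <= x < 1)%R ->
  (0 <= c)%R -> (forall n, 0 <= a n <= c * x ^+ n)%R ->
  \sum_(n <oo) (a n)%:E <= (c / (1 - x))%:E.
Proof.
move=> /andP[x0 x1] c0 ac; apply: lime_le.
  by apply: is_cvg_nneseries => n _ _; rewrite lee_fin; case/andP: (ac n).
apply: nearW => n; rewrite sumEFin lee_fin.
have aS : (\sum_(0 <= i < n) a i <= \sum_(0 <= i < n) c * x ^+ i)%R.
  by apply: ler_sum => i _; case/andP: (ac i).
apply: (le_trans aS); rewrite -mulr_sumr; apply: ler_wpM2l => //.
have x1' : (0 < 1 - x)%R by rewrite subr_gt0.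
rewrite -(ler_pM2r x1') mulVf ?gt_eqF// big_mkord mulrC -opprB mulNr -subrX1.
by rewrite opprB lerBlDr lerDl exprn_ge0.
Qed.

(** Stated by ratios, so that powers with integer exponents are not needed. *)
Lemma geometric_esum_int_le (F : int -> R) (x : R) (i0 : int) :
  (0 <= x < 1)%R -> (forall i, 0 <= F i)%R ->
  (forall i, (i <= i0)%R -> F (i - 1) <= x * F i)%R ->
  \esum_(i in [set i : int | (i <= i0)%R]) (F i)%:E <= (F i0 / (1 - x))%:E.
Proof.
move=> x01 F0 Fx.
rewrite (reindex_esum [set: nat] _ (fun n : nat => i0 - n%:Z)%R); last first.
  split.
  - by move=> n _ /=; rewrite lerBlDr lerDl.
  - by move=> n m _ _ /addrI/oppr_inj[].
  - move=> i /= ii0; exists `|i0 - i|%N => //.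
    by rewrite gez0_abs ?subr_ge0// subKr.
rewrite -nneseries_esumT//; last by move=> n; rewrite lee_fin.
apply: geometric_nneseries_le => // n; rewrite F0/=.
elim: n => [|n IH]; first by rewrite subr0 expr0 mulr1.
rewrite -addn1 PoszD opprD addrA; apply: le_trans (Fx _ _) _.
  by rewrite lerBlDr lerDl.
rewrite exprD expr1 mulrA [leRHS]mulrC; apply: ler_wpM2l => //.
by case/andP: x01.
Qed.

End geometric.

Lemma exprz_unbounded (R : realType) (a x : R) : 1 < a ->
  exists K : int, forall k, K <= k -> x <= a ^ k.
Proof.
move=> a1; have a0 : 0 < a - 1 by rewrite subr_gt0.
pose n := (Num.truncn (`|x| / (a - 1))).+1; exists n%:Z => k nk.
apply: (@le_trans _ _ (a ^+ n)); last by rewrite -[a ^+ n]/(a ^ n%:Z) ler_eXz2l.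
apply: (@le_trans _ _ (1 + n%:R * (a - 1))); last first.
  elim: n {nk} => [|n IH]; first by rewrite mul0r addr0 expr0.
  rewrite exprS; apply: (@le_trans _ _ (a * (1 + n%:R * (a - 1)))); last first.
    by rewrite ler_wpM2l// ltW// (lt_trans ltr01).
  rewrite -subr_ge0 (_ : _ - _ = n%:R * (a - 1) ^+ 2); last by rewrite -natr1; ring.
  by rewrite mulr_ge0// sqr_ge0.
apply: (le_trans (ler_norm x)); rewrite -[leLHS]add0r lerD// -ler_pdivrMr//.
by rewrite ltW// truncnS_gt.
Qed.

(** * Dyadic grids and stopping cubes *)

(** The cubes of generation [k] are the fibres of [dg_idx k]; the measure of a
cube depends on its generation only, as for the cubes of side [2 ^ k]. *)
Record dyadic_grid d (T : measurableType d) (R : realType)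
    (mu : {measure set T -> \bar R}) := DyadicGrid {
  dg_index : countType ;
  dg_idx : int -> T -> dg_index ;
  dg_ratio : R ;
  dg_ratio_gt1 : 1 < dg_ratio ;
  dg_measurable : forall k j, measurable [set x | dg_idx k x = j] ;
  dg_nested : forall k x y,
    dg_idx k x = dg_idx k y -> dg_idx (k + 1) x = dg_idx (k + 1) y ;
  dg_measure : forall k x,
    mu [set y | dg_idx k y = dg_idx k x] = (dg_ratio ^ k)%:E ;
  dg_generate : @measurable _ T `<=`
    <<s [set A | exists k j, A = [set x | dg_idx k x = j]] >> }.

Section stopping.
Context d (T : measurableType d) (R : realType).
Variables (mu : {measure set T -> \bar R}) (G : dyadic_grid mu).
Local Notation J := (dg_index G).
Local Notation idx := (dg_idx G).
Local Notation D := (dg_ratio G).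

Definition cube (P : int * J) : set T := [set x | idx P.1 x = P.2].
Definition cube_at (k : int) (x : T) : int * J := (k, idx k x).

Definition mass (f : T -> R) (P : int * J) : R :=
  fine (\int[mu]_(x in cube P) (f x)%:E).

Definition avg (f : T -> R) (P : int * J) : R := mass f P / D ^ P.1.

(** The decay of the averages as the cubes grow makes the maximal cubes exist. *)
Definition stoppable (f : T -> R) :=
  [/\ measurable_fun setT f, forall x, 0 <= f x,
      forall P, (\int[mu]_(x in cube P) (f x)%:E < +oo)%E &
      forall x e, 0 < e ->
        exists K, forall k, K <= k -> avg f (cube_at k x) <= e].

(** The levels are the powers of twice the ratio between the measures of a cube
and of its children: this is what makes the stopping cubes sparse. *)
Definition level (i : int) : R := (2 * D) ^ i.

Definition superlevel f i : set T :=
  [set x | exists k, level i < avg f (cube_at k x)].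

Definition stopping_cubes f i : set (int * J) :=
  [set P | [/\ cube P !=set0, level i < avg f P &
     forall k x, cube P x -> P.1 < k -> avg f (cube_at k x) <= level i]].

Let D_gt1 : 1 < D. Proof. exact: dg_ratio_gt1. Qed.
Let D_gt0 : 0 < D. Proof. exact: lt_trans D_gt1. Qed.

Lemma measurable_cube P : measurable (cube P).
Proof. exact: dg_measurable. Qed.
Hint Resolve measurable_cube : core.

Lemma level_gt0 i : 0 < level i.
Proof. by rewrite exprz_gt0// mulr_gt0. Qed.

Lemma level_le i j : i <= j -> level i <= level j.
Proof.
by move=> ij; rewrite /level ler_eXz2l//; move: D_gt1; lra.
Qed.

Lemma level_succ i : level (i + 1) = 2 * D * level i.
Proof. by rewrite /level expfzDr ?expr1z ?(mulrC (_ ^ i))// gt_eqF// mulr_gt0. Qed.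

Lemma volume_gt0 (k : int) : 0 < D ^ k.
Proof. exact: exprz_gt0. Qed.

Lemma measure_cube P : cube P !=set0 -> mu (cube P) = (D ^ P.1)%:E.
Proof. by case: P => k j [x]; rewrite /cube/= => <-; exact: dg_measure. Qed.

Lemma measure_cube_lty P : (mu (cube P) < +oo)%E.
Proof.
case: (eqVneq (cube P) set0) => [->|/set0P/measure_cube->]; last by rewrite ltry.
by rewrite measure0.
Qed.

Lemma cube_cube_at P x : cube P x -> P = cube_at P.1 x.
Proof. by case: P => k j; rewrite /cube/= => <-. Qed.

Lemma idx_nested (k k' : int) x y : k <= k' -> idx k x = idx k y ->
  idx k' x = idx k' y.
Proof.
move=> kk' kxy; rewrite -(subrK k k') addrC.
rewrite -(gez0_abs (_ : 0 <= k' - k)) ?subr_ge0//.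
elim: `|_|%N => [|n IH]; first by rewrite addr0.
by rewrite -addn1 PoszD addrA; exact: dg_nested.
Qed.

Lemma cube_nested P P' x : cube P x -> cube P' x -> P.1 <= P'.1 ->
  cube P `<=` cube P'.
Proof.
move=> Px P'x PP' y Py; rewrite /cube/= -P'x.
by apply: (idx_nested PP'); rewrite Py -Px.
Qed.

Section mass.
Variables (f : T -> R).
Hypotheses (mf : measurable_fun setT f) (f0 : forall x, 0 <= f x).
Hypothesis lf : forall P, (\int[mu]_(x in cube P) (f x)%:E < +oo)%E.

Lemma measurable_EFin_of A : measurable_fun A (fun x => (f x)%:E).
Proof. by apply/measurable_EFinP; exact: measurable_funS mf. Qed.

Lemma massE P : (\int[mu]_(x in cube P) (f x)%:E = (mass f P)%:E)%E.
Proof.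
rewrite /mass fineK// ge0_fin_numE//.
by apply: integral_ge0 => x _; rewrite lee_fin.
Qed.

Lemma mass_ge0 P : 0 <= mass f P.
Proof. by rewrite -lee_fin -massE; apply: integral_ge0 => x _; rewrite lee_fin. Qed.

Lemma le_mass P P' : cube P `<=` cube P' -> mass f P <= mass f P'.
Proof.
move=> PP'; rewrite -lee_fin -!massE; apply: ge0_subset_integral => //.
- exact: measurable_EFin_of.
- by move=> x _; rewrite lee_fin.
Qed.

Lemma avg_ge0 P : 0 <= avg f P.
Proof. by rewrite divr_ge0 ?mass_ge0// ltW// volume_gt0. Qed.

Lemma mass_gt0 P : (forall x, 0 < f x) -> cube P !=set0 -> 0 < mass f P.
Proof.
move=> fp P0; rewrite lt_neqAle mass_ge0 andbT eq_sym; apply/eqP => m0.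
have := measure_cube P0; suff -> : mu (cube P) = 0%E.
  by move=> [] /eqP; rewrite eq_sym gt_eqF// volume_gt0.
have m0E : (mass f P)%:E = 0%E :> \bar R by rewrite m0.
apply: (null_of_integral_eq0 (measurable_cube P) (h := f)) => //.
  exact: measurable_funS mf.
by rewrite massE.
Qed.

End mass.

Section stopping_cubes.
Variable g : T -> R.
Hypothesis sg : stoppable g.

Let mg : measurable_fun setT g. Proof. by case: sg. Qed.
Let g0 x : 0 <= g x. Proof. by case: sg. Qed.
Let lg P : (\int[mu]_(x in cube P) (g x)%:E < +oo)%E. Proof. by case: sg. Qed.
Let mgE A : measurable_fun A (fun x => (g x)%:E).
Proof. exact: measurable_EFin_of. Qed.

(** Among the cubes around [x] with average above the level, the largest one
exists because the averages tend to 0 along the growing cubes. *)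
Lemma stopping_cover i : superlevel g i = \bigcup_(P in stopping_cubes g i) cube P.
Proof.
apply/seteqP; split => [x [k ik]|x [P [_ iP _] Px]]; last first.
  by exists P.1; rewrite -cube_cube_at.
have [_ _ _ /(_ x _ (level_gt0 i))[K HK]] := sg.
pose p n := `[< level i < avg g (cube_at (K - n%:Z) x) >].
have kK : k <= K.
  by rewrite leNgt; apply/negP => /ltW /HK; rewrite leNgt ik.
have exn : exists n, p n.
  exists `|K - k|%N; apply/asboolP; rewrite gez0_abs ?subr_ge0//.
  by rewrite opprB addrC subrK.
have [n /asboolP pn minn] := ex_minnP exn.
exists (cube_at (K - n%:Z) x) => //; split => //; first by exists x.
move=> k' y /= ixy nk'.
have -> : cube_at k' y = cube_at k' x.
  by congr pair; apply: idx_nested ixy; exact: ltW.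
rewrite leNgt; apply/negP => H.
have k'K : k' <= K by rewrite leNgt; apply/negP => /ltW /HK; rewrite leNgt H.
have := minn `|K - k'|%N; rewrite leqNgt => Hm; suff : p `|K - k'|%N.
  move/Hm/negP; apply; rewrite -ltz_nat gez0_abs ?subr_ge0//.
  by rewrite ltrBlDr -ltrBlDl.
apply/asboolP; rewrite gez0_abs ?subr_ge0//.
by rewrite opprB addrC subrK.
Qed.

Lemma superlevel_stopping i P x : stopping_cubes g i P -> cube P x ->
  superlevel g i x.
Proof. by move=> iP Px; rewrite stopping_cover; exists P. Qed.

Lemma measurable_superlevel i : measurable (superlevel g i).
Proof.
rewrite stopping_cover bigcup_mkcond; apply: countable_bigcupT_measurable => //.
by move=> P; case: ifPn.
Qed.
Hint Resolve measurable_superlevel : core.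

Lemma superlevel_le i j : i <= j -> superlevel g j `<=` superlevel g i.
Proof. by move=> ij x [k kx]; exists k; exact: le_lt_trans (level_le ij) kx. Qed.

(** A stopping cube of a higher level cannot be strictly larger than one of a
lower level, by maximality of the latter. *)
Lemma stopping_sub i j P P' x : i <= j -> stopping_cubes g i P ->
  stopping_cubes g j P' -> cube P x -> cube P' x -> cube P' `<=` cube P.
Proof.
move=> ij [_ iP maxP] [_ jP' _] Px P'x; apply: (cube_nested P'x Px).
rewrite leNgt; apply/negP => /(maxP _ _ Px); rewrite -(cube_cube_at P'x) leNgt.
by rewrite (le_lt_trans (level_le ij) jP').
Qed.

Lemma stopping_trivIset i : trivIset (stopping_cubes g i) cube.
Proof.
move=> P P' [_ iP maxP] [_ iP' maxP'] [x [Px P'x]].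
rewrite (cube_cube_at Px) (cube_cube_at P'x); congr cube_at.
apply/eqP; rewrite eq_le; apply/andP; split; rewrite leNgt; apply/negP.
  by move=> /(maxP' _ _ P'x); rewrite -(cube_cube_at Px) leNgt iP.
by move=> /(maxP _ _ Px); rewrite -(cube_cube_at P'x) leNgt iP'.
Qed.

(** By maximality the parent of a stopping cube has average at most the level,
and its measure is only [D] times larger. *)
Lemma stopping_mass_le i P : stopping_cubes g i P ->
  mass g P <= D * level i * D ^ P.1.
Proof.
move=> [[x Px] _ maxP]; have := maxP (P.1 + 1) x Px.
rewrite ltrDl ltr01 => /(_ isT).
rewrite /avg ler_pdivrMr ?volume_gt0//= => H.
apply: (@le_trans _ _ (mass g (cube_at (P.1 + 1) x))).
  by apply: le_mass => //; apply: (cube_nested Px) => //=; rewrite lerDl.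
apply: (le_trans H); rewrite expfzDr ?gt_eqF// expr1z.
by lra.
Qed.

Lemma integral_stopping (h : T -> \bar R) A i : measurable A ->
  measurable_fun setT h -> (forall x, 0 <= h x)%E ->
  (\int[mu]_(x in A `&` superlevel g i) h x =
   \esum_(P in stopping_cubes g i) \int[mu]_(x in A `&` cube P) h x)%E.
Proof.
move=> mA mh h0; rewrite stopping_cover setI_bigcupr integral_bigcup_esum//.
- by move=> P _; exact: measurableI.
- move=> P P' iP iP' [x [[_ Px] [_ P'x]]].
  by apply: (stopping_trivIset iP iP'); exists x.
Qed.

(** Sparseness: the stopping cubes of the next level inside [P] have averages
above [2 * D * level i], whereas the mass of [P] is at most [D * level i] times
its measure; hence they fill at most half of [P]. *)
Lemma stopping_sparse i P : stopping_cubes g i P ->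
  (mu (cube P `&` superlevel g (i + 1)) <= (2^-1)%:E * mu (cube P))%E.
Proof.
move=> iP; have mI : measurable (cube P `&` superlevel g (i + 1)).
  exact: measurableI.
have E A : measurable A -> mu A = (\int[mu]_(x in A) 1)%E.
  by move=> mA; rewrite integral_cst// mul1e.
rewrite (E _ mI) integral_stopping//.
apply: (@le_trans _ _ (\esum_(P' in stopping_cubes g (i + 1))
    ((level (i + 1))^-1%:E *
       \int[mu]_(x in cube P `&` cube P') (g x)%:E))%E).
  apply: le_esum => P' jP'.
  have [->|/set0P[x [Px P'x]]] := eqVneq (cube P `&` cube P') set0.
    by rewrite !integral_set0 mule0.
  have P'P : cube P' `<=` cube P.
    by apply: (stopping_sub _ iP jP' Px P'x); rewrite lerDl.
  rewrite setIC; move/setIidPl : (P'P) => ->.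
  rewrite -E// massE// measure_cube; last by exists x.
  rewrite -EFinM lee_fin ler_pdivlMl ?level_gt0//.
  by case: jP' => _ + _; rewrite /avg ltr_pdivlMr ?volume_gt0// => /ltW.
rewrite esumZl; last 2 first.
  by rewrite invr_ge0 ltW// level_gt0.
  by move=> P' _; apply: integral_ge0 => x _; rewrite lee_fin.
rewrite -integral_stopping//.
apply: (@le_trans _ _ ((level (i + 1))^-1%:E * (mass g P)%:E)%E).
  apply: lee_wpmul2l; first by rewrite lee_fin invr_ge0 ltW// level_gt0.
  rewrite -massE//; apply: ge0_subset_integral => //.
  by move=> x _; rewrite lee_fin.
rewrite measure_cube; last by case: iP.
rewrite -!EFinM lee_fin ler_pdivrMl ?level_gt0//.
apply: (le_trans (stopping_mass_le iP)).
by rewrite level_succ; lra.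
Qed.

End stopping_cubes.
End stopping.

(** * Decay along the stopping levels *)

Section decay.
Context d (T : measurableType d) (R : realType).
Variables (mu : {measure set T -> \bar R}) (G : dyadic_grid mu).
Local Notation J := (dg_index G).
Local Notation D := (dg_ratio G).
Local Notation cube := (@cube d T R mu G).
Local Notation S := (@stopping_cubes d T R mu G).
Local Notation Omega := (@superlevel d T R mu G).

Definition density (u : T -> R) :=
  [/\ measurable_fun setT u, forall x, 0 < u x &
      forall P, (\int[mu]_(x in cube P) (u x)%:E < +oo)%E].

(** A quantitative form of the A_infinity condition. *)
Definition half_decay (kappa : R) (u : T -> R) := forall P E, measurable E ->
  E `<=` cube P -> (mu E <= (2^-1)%:E * mu (cube P))%E ->
  (\int[mu]_(x in E) (u x)%:E <=
     (kappa ^+ 2)%:E * \int[mu]_(x in cube P) (u x)%:E)%E.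

(** Exponentially large in the number of levels above [i] reached at [x], but
still of comparable integral on the stopping cubes of level [i] for a weight
with decay.  It plays the role that a maximal function has in the usual
arguments. *)
Definition layers (g : T -> R) (kappa : R) (i : int) (x : T) : \bar R :=
  (\sum_(j <oo) (kappa^-1 ^+ j * \1_(Omega g (i + j%:Z)) x)%:E)%E.

Variables (g : T -> R) (kappa : R).
Hypotheses (sg : stoppable G g) (k01 : 0 < kappa < 1).

Let k0 : 0 < kappa. Proof. by case/andP: k01. Qed.
Let k1 : kappa < 1. Proof. by case/andP: k01. Qed.

Let mO i : measurable (Omega g i).
Proof. exact: measurable_superlevel. Qed.
Let mC (P : int * J) : measurable (cube P). Proof. exact: measurable_cube. Qed.

Let term_ge0 i j x : 0 <= kappa^-1 ^+ j * \1_(Omega g (i + j%:Z)) x :> R.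
Proof. by rewrite mulr_ge0// exprn_ge0// invr_ge0 ltW. Qed.

Lemma layers_ge0 i x : (0 <= layers g kappa i x)%E.
Proof. by apply: nneseries_ge0 => j _ _; rewrite lee_fin. Qed.

Lemma measurable_layers i A : measurable_fun A (layers g kappa i).
Proof.
apply: ge0_emeasurable_sum => [j x _ _|j _]; first by rewrite lee_fin.
by apply/measurable_EFinP; apply: measurable_funM.
Qed.

Lemma layers_recl i x : layers g kappa i x =
  ((\1_(Omega g i) x)%:E + (kappa^-1)%:E * layers g kappa (i + 1) x)%E.
Proof.
rewrite /layers nneseries_recl//; last by move=> *; rewrite lee_fin.
rewrite expr0 mul1r addr0 -nneseriesZl; last by move=> *; rewrite lee_fin.
congr (_ + _)%E; rewrite -(nneseries_addn 1%N); last by move=> *; rewrite lee_fin.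
apply: eq_eseriesr => j _; rewrite -EFinM mulrA -exprS addn1.
by rewrite intS addrA.
Qed.

Lemma layers_ge1 i x : Omega g i x -> (1 <= layers g kappa i x)%E.
Proof.
move=> ix; rewrite layers_recl indicE mem_set//= leeDl// mule_ge0//.
  by rewrite lee_fin invr_ge0 ltW.
exact: layers_ge0.
Qed.

(** The levels above one that is not reached are not reached either, so that
the series has finitely many nonzero terms. *)
Lemma layers_fin x i0 i : ~ Omega g i0 x -> layers g kappa i x \is a fin_num.
Proof.
move=> i0x.
have big n : layers g kappa (i0 + n%:Z) x = 0%E.
  apply: eseries0 => j _ _; rewrite indicE memNset ?mulr0// => H; apply: i0x.
  by apply: superlevel_le H => //; rewrite -addrA lerDl.
have down n : layers g kappa (i0 - n%:Z) x \is a fin_num.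
  elim: n => [|n IH]; first by rewrite subr0; have := big 0%N; rewrite addr0 => ->.
  rewrite layers_recl fin_numD/= fin_numM// -addn1 PoszD opprD addrA.
  by rewrite subrK.
have [ii0|i0i] := leP i i0.
  by have := down `|i0 - i|%N; rewrite gez0_abs ?subr_ge0// subKr.
have := big `|i - i0|%N; rewrite gez0_abs ?subr_ge0 ?(ltW i0i)//.
by rewrite (addrC i0) subrK => ->.
Qed.

Section density.
Variable u : T -> R.
Hypotheses (du : density u) (hu : half_decay kappa u).

Let mu_ : measurable_fun setT u. Proof. by case: du. Qed.
Let u0 x : 0 < u x. Proof. by case: du. Qed.
Let uE x : (0 <= (u x)%:E)%E. Proof. by rewrite lee_fin ltW. Qed.
Let lu P : (\int[mu]_(x in cube P) (u x)%:E < +oo)%E. Proof. by case: du. Qed.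
Let muE A : measurable_fun A (fun x => (u x)%:E).
Proof. exact: measurable_EFin_of. Qed.
Let umass P : (\int[mu]_(x in cube P) (u x)%:E = (mass u P)%:E)%E.
Proof. by apply: massE => // x; exact: ltW. Qed.

(** Sparseness and the decay of [u], iterated over [j] levels. *)
Lemma stopping_decay i P (j : nat) : S g i P ->
  (\int[mu]_(x in cube P `&` Omega g (i + j%:Z)) (u x)%:E <=
    ((kappa ^+ 2) ^+ j * mass u P)%:E)%E.
Proof.
move=> iP; elim: j => [|j IH].
  rewrite expr0 mul1r -umass; apply: ge0_subset_integral => //.
  exact: measurableI.
set E := cube P `&` _.
have mE : measurable E by exact: measurableI.
have EO : E = E `&` Omega g (i + j%:Z).
  apply/seteqP; split => [x Ex|x []//]; split => //.
  by case: Ex => _; apply: superlevel_le; rewrite lerD2l lez_nat.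
rewrite EO (integral_stopping sg)//.
apply: (@le_trans _ _ (\esum_(P' in S g (i + j%:Z))
  ((kappa ^+ 2)%:E * \int[mu]_(x in cube P `&` cube P') (u x)%:E))%E).
  apply: le_esum => P' jP'.
  have [PP'|/set0P[x [Px P'x]]] := eqVneq (cube P `&` cube P') set0.
    rewrite PP' (_ : E `&` cube P' = set0) ?integral_set0 ?mule0//.
    by rewrite -subset0 -PP' => x [[Px _] P'x].
  have P'P : cube P' `<=` cube P.
    by apply: (stopping_sub _ iP jP' Px P'x); rewrite lerDl.
  rewrite (setIC (cube P)); move/setIidPl : (P'P) => ->.
  apply: hu; [exact: measurableI|by move=> y []|].
  apply: le_trans (stopping_sparse sg jP').
  apply: le_measure; rewrite ?inE; [exact: measurableI|exact: measurableI|].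
  move=> y [[_ Oy] P'y]; split => //.
  by rewrite -addrA (addrC _ 1) -intS.
rewrite esumZl; last 2 first.
- by rewrite exprn_ge0// ltW.
- by move=> P' _; exact: integral_ge0.
rewrite -(integral_stopping sg)//.
rewrite (exprS (kappa ^+ 2)) -mulrA [leRHS]EFinM; apply: lee_wpmul2l => //.
by rewrite lee_fin exprn_ge0// ltW.
Qed.

(** The weights [kappa ^- j] are beaten by the decay [kappa ^+ (2 * j)] of the
measures of the superlevel sets. *)
Lemma integral_layers i P : S g i P ->
  (\int[mu]_(x in cube P) (layers g kappa i x * (u x)%:E) <=
   (mass u P / (1 - kappa))%:E)%E.
Proof.
move=> iP.
have -> : (\int[mu]_(x in cube P) (layers g kappa i x * (u x)%:E) =
  \sum_(j <oo) ((kappa^-1 ^+ j)%:E *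
     \int[mu]_(x in cube P `&` Omega g (i + j%:Z)) (u x)%:E))%E.
  transitivity (\int[mu]_(x in cube P) \sum_(j <oo) ((kappa^-1 ^+ j)%:E *
     ((\1_(Omega g (i + j%:Z)) x)%:E * (u x)%:E)))%E.
    apply: eq_integral => x _; rewrite muleC /layers -nneseriesZl; last first.
      by move=> j _; rewrite lee_fin.
    by apply: eq_eseriesr => j _; rewrite EFinM muleC muleA.
  have mt j : measurable_fun (cube P) (fun x =>
      (\1_(Omega g (i + j%:Z)) x)%:E * (u x)%:E)%E.
    apply: emeasurable_funM => //; apply/measurable_EFinP.
    exact: measurable_indic.
  rewrite integral_nneseries//; last 2 first.
  - by move=> j; apply: emeasurable_funM => //; exact: measurable_cst.
  - move=> j x _; rewrite mule_ge0 ?lee_fin ?exprn_ge0 ?invr_ge0 ?(ltW k0)//.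
    by rewrite mulr_ge0// ltW.
  apply: eq_eseriesr => j _; rewrite ge0_integralZl//; last 2 first.
  - by move=> x _; rewrite mule_ge0// lee_fin.
  - by rewrite lee_fin exprn_ge0// invr_ge0 ltW.
  by rewrite ge0_integral_indic.
pose m j := mass u P * kappa ^+ j.
have mu0 : 0 <= mass u P by apply: mass_ge0 => // x; exact: ltW.
apply: (@le_trans _ _ (\sum_(j <oo) (m j)%:E)%E); last first.
  apply: geometric_nneseries_le => //; first by rewrite k1 ltW.
  by move=> n; rewrite lexx mulr_ge0// exprn_ge0// ltW.
apply: lee_nneseries => j _.
  by rewrite mule_ge0 ?integral_ge0// lee_fin exprn_ge0// invr_ge0 ltW.
apply: (@le_trans _ _ ((kappa^-1 ^+ j)%:E *
  ((kappa ^+ 2) ^+ j * mass u P)%:E)%E).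
  apply: lee_wpmul2l; last exact: stopping_decay.
  by rewrite lee_fin exprn_ge0// invr_ge0 ltW.
rewrite -EFinM lee_fin /m mulrA -exprMn expr2 mulrA mulVf ?gt_eqF// mul1r.
by rewrite mulrC.
Qed.

Lemma null_all_levels : mu (\bigcap_i Omega g i) = 0%E.
Proof.
have mN : measurable (\bigcap_i Omega g i).
  rewrite -[X in measurable X]setCK setC_bigcap; apply: measurableC.
  by apply: countable_bigcupT_measurable => // i; exact: measurableC.
have : (\int[mu]_(x in \bigcap_i Omega g i) (u x)%:E = 0)%E.
  rewrite (_ : \bigcap_i Omega g i = \bigcap_i Omega g i `&` Omega g 0); last first.
    by apply/seteqP; split => [x H|x []//]; split => //; exact: H.
  rewrite (integral_stopping sg)//.
  apply: esum1 => P iP; apply/eqP; rewrite eq_le integral_ge0// andbT.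
  set c := integral _ _ _.
  have cfin n : (c <= ((kappa ^+ 2) ^+ n * mass u P)%:E)%E.
    apply: le_trans (stopping_decay n iP); apply: ge0_subset_integral => //.
    - exact: measurableI.
    - exact: measurableI.
    - by move=> x [Hx Px]; split => //; exact: Hx.
  have c0 : (0 <= c)%E by exact: integral_ge0.
  have cE : c = (fine c)%:E.
    by rewrite fineK// ge0_fin_numE// (le_lt_trans (cfin 0%N))// ltry.
  rewrite cE lee_fin.
  have cv : (kappa ^+ 2) ^+ n * mass u P @[n --> \oo] --> (0 : R).
    rewrite -[X in _ --> X](mul0r (mass u P)); apply: cvgMl.
    apply: cvg_expr; rewrite ger0_norm ?exprn_ge0 ?(ltW k0)//.
    by rewrite expr_lt1// ltW.
  rewrite -(cvg_lim _ cv)//; apply: limr_ge; first by apply/cvg_ex; exists 0.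
  by apply: nearW => n; rewrite -lee_fin -cE.
apply: null_of_integral_eq0 => //.
exact: measurable_funS mu_.
Qed.

End density.

(** Going down one level multiplies the layers by at least [kappa^-1], and they
are at least 1 at the highest level reached. *)
Lemma esum_layers_le (t : R) x : 0 < t -> ~ (\bigcap_i Omega g i) x ->
  (\esum_(i in [set i | Omega g i x]) (fine (layers g kappa i x) `^ (- t))%:E
   <= (1 - kappa `^ t)^-1%:E)%E.
Proof.
move=> t0 /existsNP[i1 /not_implyP[_ i1x]].
have Lfin i := layers_fin i i1x.
have kt : 0 <= kappa `^ t < 1.
  have one_t : 1 `^ t = 1 :> R by rewrite powR1.
  by rewrite powR_ge0/= -[ltRHS]one_t gt0_ltr_powR// ?nnegrE// ltW.
have kt0 : 0 <= (1 - kappa `^ t)^-1.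
  by have /andP[_ kt1] := kt; rewrite invr_ge0 subr_ge0 ltW.
have [[i2 i2x]|none] := pselect (exists i, Omega g i x); last first.
  rewrite esum1; first by rewrite lee_fin.
  by move=> i ix; exfalso; apply: none; exists i.
have i21 : i2 < i1.
  by rewrite ltNge; apply/negP => i12; apply: i1x; exact: superlevel_le i12 _ i2x.
pose p n := `[< Omega g (i1 - n%:Z) x >].
have exn : exists n, p n.
  exists `|i1 - i2|%N; apply/asboolP; rewrite gez0_abs ?subr_ge0 ?(ltW i21)//.
  by rewrite subKr.
have [n /asboolP nx minn] := ex_minnP exn.
set i0 := i1 - n%:Z.
have leE : [set i | Omega g i x] = [set i : int | i <= i0].
  apply/seteqP; split => [i /= ix|i /= ii0]; last exact: superlevel_le ii0 _ nx.
  have ii1 : i < i1.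
    by rewrite ltNge; apply/negP => ii1; apply: i1x; exact: superlevel_le ii1 _ ix.
  have := minn `|i1 - i|%N; rewrite /p gez0_abs ?subr_ge0 ?(ltW ii1)// subKr.
  move=> /(_ (asboolT ix)); rewrite -lez_nat gez0_abs ?subr_ge0 ?(ltW ii1)//.
  by rewrite lerBrDl -lerBrDr.
rewrite leE.
have Lge1 i : Omega g i x -> 1 <= fine (layers g kappa i x).
  by move=> ix; rewrite -lee_fin fineK//; exact: layers_ge1.
apply: le_trans (geometric_esum_int_le kt _ _) _.
- by move=> i; exact: powR_ge0.
- move=> i ii0; have ix : Omega g i x by exact: superlevel_le ii0 _ nx.
  have L0 : 0 < fine (layers g kappa i x) by apply: lt_le_trans (Lge1 _ ix).
  have -> : kappa `^ t * fine (layers g kappa i x) `^ (- t) =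
            (kappa^-1 * fine (layers g kappa i x)) `^ (- t).
    rewrite powRM ?invr_ge0 ?ltW//; congr (_ * _).
    by rewrite -powR_inv1 ?ltW// -powRrM mulrNN mul1r.
  rewrite !powRN lef_pV2 ?posrE ?powR_gt0 ?mulr_gt0 ?invr_gt0//; last first.
    by apply: lt_le_trans (Lge1 _ _) => //; apply: superlevel_le ix; rewrite lerBlDr lerDl.
  have i1x' : Omega g (i - 1) x by apply: superlevel_le ix; rewrite lerBlDr lerDl.
  rewrite ge0_ler_powR// ?nnegrE ?(ltW t0)//.
  - by rewrite mulr_ge0 ?invr_ge0 ?ltW.
  - exact: le_trans (Lge1 _ i1x').
  rewrite -lee_fin EFinM !fineK// (layers_recl (i - 1)) subrK leeDr//.
rewrite lee_fin ler_piMl//.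
rewrite powRN invf_le1 ?powR_gt0 ?(lt_le_trans _ (Lge1 _ nx))//.
have one_t : 1 `^ t = 1 :> R by rewrite powR1.
rewrite -[leLHS]one_t ge0_ler_powR// ?nnegrE ?(ltW t0)//; last exact: Lge1.
exact: le_trans (Lge1 _ nx).
Qed.

End decay.

(** * The dyadic fractional operator *)

Section real_lemmas.
Context (R : realType).
Implicit Types x y z t : R.

(** Either [x] is at most [y * z], or the surplus power [t - 1] of [x / (y * z)]
is at least 1. *)
Lemma le_split_powR x y z t : 0 <= x -> 0 < y -> 0 < z -> 1 < t ->
  x <= y * z + y `^ (1 - t) * (x `^ t * z `^ (1 - t)).
Proof.
move=> x0 y0 z0 t1; have [xyz|xyz] := leP x (y * z).
  by apply: (le_trans xyz); rewrite lerDl !mulr_ge0// powR_ge0.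
have yz0 : 0 < y * z by rewrite mulr_gt0.
apply: (@le_trans _ _ (y `^ (1 - t) * (x `^ t * z `^ (1 - t)))); last first.
  by rewrite lerDr ltW.
have x0' : 0 < x by exact: lt_trans xyz.
rewrite mulrCA -powRM ?(ltW y0) ?(ltW z0)// -opprB powRN.
rewrite ler_pdivlMr ?powR_gt0// -(@mulr_powRB1 _ x)//; last exact: lt_trans t1.
rewrite ler_wpM2l// ge0_ler_powR ?nnegrE ?(ltW yz0) ?(ltW xyz)//.
by rewrite subr_ge0 ltW.
Qed.

Lemma exists_exprz_bracket a x : 1 < a -> 0 < x ->
  exists i : int, a ^ i < x <= a ^ (i + 1).
Proof.
move=> a1 x0; have a0 : 0 < a by exact: lt_trans a1.
have lna : 0 < ln a by rewrite ln_gt0.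
have aE (i : int) : a ^ i = expR (i%:~R * ln a).
  by rewrite -powR_intmul ?ltW// /powR gt_eqF.
pose y := ln x / ln a.
have xE : x = expR (y * ln a) by rewrite /y divfK ?gt_eqF// lnK// posrE.
exists (Num.ceil y - 1); rewrite subrK !aE xE ltr_expR ler_expR.
rewrite ltr_pM2r// ler_pM2r//; apply: real_ceil_itv; exact: num_real.
Qed.

End real_lemmas.

Lemma measurable_fun_powR d (T : measurableType d) (R : realType) (A : set T)
    (f : T -> R) (r : R) :
  measurable_fun A f -> measurable_fun A (fun x => f x `^ r).
Proof. by move=> mf; exact: (@measurableT_comp _ _ _ _ _ _ (@powR R ^~ r)). Qed.

Section dyadic_fractional.
Context d (T : measurableType d) (R : realType).
Variables (mu : {measure set T -> \bar R}) (G : dyadic_grid mu).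
Local Notation J := (dg_index G).
Local Notation D := (dg_ratio G).
Local Notation cube := (@cube d T R mu G).
Local Notation S := (@stopping_cubes d T R mu G).
Local Notation Omega := (@superlevel d T R mu G).
Local Notation level := (@level d T R mu G).

Let D_gt1 : 1 < D. Proof. exact: dg_ratio_gt1. Qed.
Let D_gt0 : 0 < D. Proof. exact: lt_trans D_gt1. Qed.
Let mC (P : int * J) : measurable (cube P). Proof. exact: measurable_cube. Qed.

(** The integrand of the weighted norm of [g], when [v] is the dual weight:
[g ^ t * v ^ (1 - t) = (g / v) ^ t * v]. *)
Definition dual_power (v : T -> R) (t : R) (g : T -> R) (x : T) : R :=
  g x `^ t * v x `^ (1 - t).

Lemma dual_power_ge0 v t g x : 0 <= dual_power v t g x.
Proof. by rewrite mulr_ge0// powR_ge0. Qed.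

Section cell.
Variables (v g : T -> R) (t : R).
Hypotheses (dv : density G v) (mg : measurable_fun setT g).
Hypotheses (g0 : forall x, 0 <= g x) (t1 : 1 < t).
Hypothesis lg : forall P, (\int[mu]_(x in cube P) (g x)%:E < +oo)%E.

Let mv : measurable_fun setT v. Proof. by case: dv. Qed.
Let v0 x : 0 < v x. Proof. by case: dv. Qed.
Let lv P : (\int[mu]_(x in cube P) (v x)%:E < +oo)%E. Proof. by case: dv. Qed.

Lemma measurable_dual_power A : measurable_fun A (dual_power v t g).
Proof.
apply: measurable_funM.
  by apply: measurable_fun_powR; exact: measurable_funS mg.
by apply: measurable_fun_powR; exact: measurable_funS mv.
Qed.

(** Jensen's inequality for the average of [g / v], with a weight [e]: the
part of [g] below the fraction [e] of the average is absorbed in the left-hand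
side.  Letting [e] vary with the point localizes the estimate. *)
Lemma average_power_le P (e : T -> R) : cube P !=set0 ->
  measurable_fun setT e -> (forall x, 0 <= e x) ->
  {ae mu, forall x, cube P x -> 0 < e x} ->
  (\int[mu]_(x in cube P) (e x * v x)%:E <= (mass v P / 2)%:E)%E ->
  (((mass g P / mass v P) `^ t * mass v P)%:E <=
    2%:E * \int[mu]_(x in cube P) (e x `^ (1 - t) * dual_power v t g x)%:E)%E.
Proof.
move=> P0 me e0 e_gt0 ev.
have nu0 : 0 < mass v P by apply: mass_gt0 => // x; exact: ltW.
have mg0 : 0 <= mass g P by apply: mass_ge0.
set I := (\int[mu]_(x in cube P) (e x `^ (1 - t) * dual_power v t g x)%:E)%E.
have eH0 x : 0 <= e x `^ (1 - t) * dual_power v t g x.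
  by rewrite mulr_ge0 ?powR_ge0// dual_power_ge0.
have I0 : (0 <= I)%E by apply: integral_ge0 => x _; rewrite lee_fin.
set lam := mass g P / mass v P.
have := mg0; rewrite le_eqVlt => /predU1P[mg00|mg_gt0].
  rewrite /lam -mg00 mul0r powR0 ?mul0r ?mule_ge0//.
  by rewrite gt_eqF// (lt_trans _ t1).
have lam0 : 0 < lam by rewrite divr_gt0.
have mev : measurable_fun (cube P) (fun x => e x * v x).
  apply: measurable_funM; [exact: measurable_funS me|exact: measurable_funS mv].
have meH : measurable_fun (cube P) (fun x => e x `^ (1 - t) * dual_power v t g x).
  apply: measurable_funM; last exact: measurable_dual_power.
  by apply: measurable_fun_powR; exact: measurable_funS me.
have step : ((mass g P)%:E <= lam%:E * \int[mu]_(x in cube P) (e x * v x)%:E +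
    (lam `^ (1 - t))%:E * I)%E.
  have ev0 x : 0 <= e x * v x by rewrite mulr_ge0// ltW.
  have ZE (c : R) (h : T -> R) : 0 <= c -> measurable_fun (cube P) h -> (forall x, 0 <= h x) ->
      (c%:E * \int[mu]_(x in cube P) (h x)%:E =
       \int[mu]_(x in cube P) (c%:E * (h x)%:E))%E.
    move=> c0 mh h0; rewrite ge0_integralZl//; first exact/measurable_EFinP.
    by move=> x _; rewrite lee_fin.
  rewrite -massE// /I ZE ?(ltW lam0)// ZE ?powR_ge0//.
  rewrite -ge0_integralD//; last 4 first.
  - by move=> x _; rewrite -EFinM lee_fin mulr_ge0 ?(ltW lam0).
  - by apply: measurable_funeM; exact/measurable_EFinP.
  - by move=> x _; rewrite -EFinM lee_fin mulr_ge0// powR_ge0.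
  - by apply: measurable_funeM; exact/measurable_EFinP.
  apply: ae_lower_integral_le => //.
  - by move=> x _; rewrite lee_fin.
  - move=> x _; rewrite -!EFinM -EFinD lee_fin addr_ge0//.
      by apply: mulr_ge0; [exact: ltW|exact: ev0].
    by apply: mulr_ge0; [exact: powR_ge0|exact: eH0].
  apply: filterS e_gt0 => x e_gt0 Px; rewrite -!EFinM -EFinD lee_fin.
  rewrite mulrA [X in _ <= _ + X]mulrA -powRM ?(ltW lam0)//.
  by apply: le_split_powR => //; rewrite mulr_gt0// e_gt0.
move: I0 step; case: I => [I||] I0 step //; last first.
  by rewrite gt0_muley ?leey// lte_fin.
rewrite -EFinM lee_fin.
have {}step : mass g P <= lam * (mass v P / 2) + lam `^ (1 - t) * I.
  rewrite -lee_fin; apply: (le_trans step).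
  rewrite EFinD EFinM leeD2r// EFinM lee_wpmul2l// lee_fin ltW//.
have lamE : mass g P = lam * mass v P by rewrite /lam divfK ?gt_eqF.
have lamt : lam `^ t = lam `^ (t - 1) * lam.
  by rewrite mulrC mulr_powRB1// ?(ltW lam0)// (lt_trans _ t1).
have {}step : lam * mass v P <= 2 * (lam `^ (1 - t) * I).
  by move: step; rewrite lamE; lra.
have lamK : lam `^ (t - 1) * lam `^ (1 - t) = 1.
  by rewrite -powRD ?(gt_eqF lam0) ?implybT// addrA subrK subrr powRr0.
have -> : 2 * I = lam `^ (t - 1) * (2 * (lam `^ (1 - t) * I)).
  transitivity (lam `^ (t - 1) * lam `^ (1 - t) * (2 * I)); last by ring.
  by rewrite lamK mul1r.
by rewrite lamt -mulrA ler_wpM2l// powR_ge0.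
Qed.

End cell.
End dyadic_fractional.

Section dyadic_strong.
Context d (T : measurableType d) (R : realType).
Variables (mu : {measure set T -> \bar R}) (G : dyadic_grid mu).
Local Notation J := (dg_index G).
Local Notation D := (dg_ratio G).
Local Notation cube := (@cube d T R mu G).
Local Notation cube_at := (@cube_at d T R mu G).
Local Notation S := (@stopping_cubes d T R mu G).
Local Notation Omega := (@superlevel d T R mu G).
Local Notation level := (@level d T R mu G).

Let D_gt1 : 1 < D. Proof. exact: dg_ratio_gt1. Qed.
Let D_gt0 : 0 < D. Proof. exact: lt_trans D_gt1. Qed.
Let mC (P : int * J) : measurable (cube P). Proof. exact: measurable_cube. Qed.

Variables (u v : T -> R) (kappa p q r : R) (CA : R).
Hypotheses (r0 : 0 < r) (rp : r < p) (pq : p < q) (k01 : 0 < kappa < 1).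
Hypotheses (du : density G u) (dv : density G v).
Hypotheses (hu : half_decay G kappa u) (hv : half_decay G kappa v).

Let p0 : 0 < p. Proof. exact: lt_trans rp. Qed.
Let q0 : 0 < q. Proof. exact: lt_trans pq. Qed.
Let t := p / r.
Let t1 : 1 < t. Proof. by rewrite /t ltr_pdivlMr// mul1r. Qed.
Let t0 : 0 < t. Proof. exact: lt_trans t1. Qed.
Let qp : 1 < q / p. Proof. by rewrite ltr_pdivlMr// mul1r. Qed.
Let k0 : 0 < kappa. Proof. by case/andP: k01. Qed.
Let k1 : kappa < 1. Proof. by case/andP: k01. Qed.

Local Notation gain := (p^-1 - q^-1).
Let gain0 : 0 < gain.
Proof. by rewrite subr_gt0 ltf_pV2// posrE. Qed.

(** For cubes of side [l] in dimension [n] this is [l ^ sigma], where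
[1/q = 1/p - sigma/n]. *)
Definition frac (k : int) : R := (D ^ k) `^ gain.

(** The two-weight condition that makes the fractional averages bounded. *)
Definition balanced := forall P : int * J, cube P !=set0 ->
  frac P.1 `^ q * avg v P `^ (q / r) * mass u P <= CA * mass v P `^ (q / p).

Hypothesis bal : balanced.
Hypothesis CA0 : 0 < CA.

Let mv : measurable_fun setT v. Proof. by case: dv. Qed.
Let v0 x : 0 < v x. Proof. by case: dv. Qed.
Let lv (P : int * J) : (\int[mu]_(x in cube P) (v x)%:E < +oo)%E. Proof. by case: dv. Qed.
Let mu_ : measurable_fun setT u. Proof. by case: du. Qed.
Let u0 x : 0 < u x. Proof. by case: du. Qed.
Let lu (P : int * J) : (\int[mu]_(x in cube P) (u x)%:E < +oo)%E. Proof. by case: du. Qed.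
Let mass_u0 (P : int * J) : 0 <= mass u P. Proof. by apply: mass_ge0 => // x; exact: ltW. Qed.
Let mass_v0 (P : int * J) : 0 <= mass v P. Proof. by apply: mass_ge0 => // x; exact: ltW. Qed.
Let mass_u_gt0 (P : int * J) : cube P !=set0 -> 0 < mass u P.
Proof. by move=> ?; apply: mass_gt0 => // x; exact: ltW. Qed.
Let mass_v_gt0 (P : int * J) : cube P !=set0 -> 0 < mass v P.
Proof. by move=> ?; apply: mass_gt0 => // x; exact: ltW. Qed.

Lemma frac_gt0 k : 0 < frac k. Proof. by rewrite powR_gt0// exprz_gt0. Qed.

Let ratio := D `^ (- gain).
Let ratio01 : 0 < ratio < 1.
Proof.
rewrite /ratio powR_gt0//= powRN invf_lt1 ?powR_gt0//.
have {1}<- : 1 `^ gain = 1 :> R by rewrite powR1.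
by rewrite gt0_ltr_powR ?nnegrE// ltW.
Qed.

Let frac_pred k : frac (k - 1) = ratio * frac k.
Proof.
rewrite /frac /ratio expfzDr ?gt_eqF// exprN1 powRM ?ltW ?exprz_gt0 ?invr_gt0//.
by rewrite mulrC -[D^-1]powR_inv1 ?ltW// -powRrM mulN1r.
Qed.

Lemma frac_unbounded x : exists K, forall k, K <= k -> x <= frac k.
Proof.
pose y := Num.max x 1; have y0 : 0 < y by rewrite lt_max ltr01 orbT.
have [K HK] := exprz_unbounded (y `^ gain^-1) D_gt1.
exists K => k Kk; apply: (@le_trans _ _ y); first by rewrite le_max lexx.
have yE : y = (y `^ gain^-1) `^ gain.
  by rewrite -powRrM mulVf ?gt_eqF// powRr1 ?ltW.
rewrite yE /frac ge0_ler_powR ?(ltW gain0)// ?nnegrE ?powR_ge0//.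
  by rewrite ltW// exprz_gt0.
exact: HK.
Qed.

Section fixed_function.
Variable g : T -> R.
Hypotheses (mg : measurable_fun setT g) (g0 : forall x, 0 <= g x).
Let H := dual_power v t g.
Let M := (\int[mu]_x (H x)%:E)%E.
Hypothesis Mfin : (M < +oo)%E.

Let H0 x : 0 <= H x. Proof. exact: dual_power_ge0. Qed.
Let mH A : measurable_fun A H. Proof. exact: (@measurable_dual_power _ _ _ _ _ v g t dv mg). Qed.
Let M0 : (0 <= M)%E. Proof. by apply: integral_ge0 => x _; rewrite lee_fin. Qed.
Let HP (P : int * J) : (\int[mu]_(x in cube P) (H x)%:E <= M)%E.
Proof.
apply: ge0_subset_integral => //; first exact/measurable_EFinP.
by move=> x _; rewrite lee_fin.
Qed.

(** Young's inequality pointwise: [g <= v + g ^ t * v ^ (1 - t)]. *)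
Lemma dual_power_local (P : int * J) :
  (\int[mu]_(x in cube P) (g x)%:E < +oo)%E.
Proof.
apply: (@le_lt_trans _ _
  (\int[mu]_(x in cube P) (v x)%:E + \int[mu]_(x in cube P) (H x)%:E)%E).
  rewrite -ge0_integralD//; last 4 first.
  - by move=> x _; rewrite lee_fin ltW.
  - exact: measurable_EFin_of.
  - by move=> x _; rewrite lee_fin.
  - exact/measurable_EFinP.
  apply: lower_integral_le => // x _; first by rewrite lee_fin.
  rewrite -EFinD lee_fin.
  by have := @le_split_powR _ _ 1 _ _ (g0 x) ltr01 (v0 x) t1; rewrite powR1 !mul1r.
by apply: lte_add_pinfty => //; exact: le_lt_trans Mfin.
Qed.

Let lg := dual_power_local.

Let lam (P : int * J) := mass g P / mass v P.
Let lam0 (P : int * J) : 0 <= lam P.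
Proof. by rewrite divr_ge0// mass_ge0. Qed.

Let lam_le (P : int * J) : cube P !=set0 ->
  lam P `^ t * mass v P <= 2 * 2^-1 `^ (1 - t) * fine M.
Proof.
move=> P0; rewrite -lee_fin.
have cE : (\int[mu]_(x in cube P) (2^-1 * v x)%:E <= (mass v P / 2)%:E)%E.
  rewrite integral_scale//; [|exact: measurable_funS mv|by move=> x; exact: ltW].
  rewrite massE//; last by move=> x; exact: ltW.
  by rewrite -EFinM mulrC.
have ae0 : {ae mu, forall x, cube P x -> 0 < cst (2^-1 : R) x}.
  by apply: aeW => x _ /=; rewrite invr_gt0.
have e0 (x : T) : 0 <= cst (2^-1 : R) x by rewrite invr_ge0.
apply: le_trans (average_power_le dv mg g0 t1 lg P0 (measurable_cst _) e0 ae0 cE) _.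
rewrite /cst.
rewrite integral_scale ?powR_ge0//.
rewrite !EFinM -muleA; apply: lee_wpmul2l => //; apply: lee_wpmul2l.
  by rewrite lee_fin powR_ge0.
by rewrite fineK ?ge0_fin_numE.
Qed.

Let cell_le (P : int * J) : cube P !=set0 ->
  frac P.1 `^ q * avg g P `^ (q / r) * mass u P <=
  CA * (lam P `^ t * mass v P) `^ (q / p).
Proof.
move=> P0; have vP := mass_v_gt0 P0.
have -> : avg g P = lam P * avg v P.
  by rewrite /avg /lam mulrA divfK// gt_eqF.
have av0 : 0 <= avg v P by rewrite avg_ge0// => x; exact: ltW.
rewrite powRM// [(lam P `^ t * _) `^ _]powRM ?powR_ge0// -powRrM.
have -> : t * (q / p) = q / r by rewrite /t; field; rewrite !gt_eqF.
rewrite mulrCA -(mulrA (lam P `^ _)) [leRHS]mulrCA.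
by apply: ler_wpM2l; [exact: powR_ge0|exact: bal].
Qed.

(** Were the averages of [g] at [x] not to tend to 0, [cell_le] would bound the
growing fractional factors. *)
Let sg : stoppable G g.
Proof.
split => // x e e0.
pose B := CA * (2 * 2^-1 `^ (1 - t) * fine M) `^ (q / p).
pose P_ k := cube_at k x; have Pn k : cube (P_ k) !=set0 by exists x.
have BP k : frac k `^ q * avg g (P_ k) `^ (q / r) * mass u (P_ k) <= B.
  apply: (le_trans (cell_le (Pn k))); apply: ler_wpM2l; first exact: ltW.
  rewrite ge0_ler_powR ?nnegrE//; first by rewrite divr_ge0 ?ltW.
  - by rewrite mulr_ge0// powR_ge0.
  - by rewrite mulr_ge0 ?fine_ge0// mulr_ge0// powR_ge0.
  - exact: lam_le.
have B0 : 0 <= B.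
  by apply: le_trans (BP 0); rewrite !mulr_ge0// powR_ge0.
pose b := mass u (P_ 0); have b0 : 0 < b by exact: mass_u_gt0.
pose z := B / (b * e `^ (q / r)).
have z0 : 0 <= z by rewrite divr_ge0// mulr_ge0 ?powR_ge0// ltW.
have [K HK] := frac_unbounded ((z + 1) `^ q^-1).
exists (Num.max K 0) => k; rewrite ge_max => /andP[Kk k0'].
have fz : z < frac k `^ q.
  rewrite (@lt_le_trans _ _ (z + 1))// ?ltrDl//.
  have -> : z + 1 = ((z + 1) `^ q^-1) `^ q.
    by rewrite -powRrM mulVf ?gt_eqF// powRr1// addr_ge0.
  rewrite ge0_ler_powR ?(ltW q0) ?nnegrE ?powR_ge0//.
  exact: HK.
rewrite leNgt; apply/negP => eg.
have : z * (b * e `^ (q / r)) < B.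
  apply: (@lt_le_trans _ _ (frac k `^ q * (b * e `^ (q / r)))).
    by rewrite ltr_pM2r// mulr_gt0// powR_gt0.
  apply: le_trans (BP k); rewrite -mulrA; apply: ler_wpM2l; first exact: powR_ge0.
  rewrite mulrC; apply: ler_pM; [exact: powR_ge0|exact: ltW| |].
    rewrite ge0_ler_powR ?nnegrE ?(ltW e0) ?(ltW eg)//; first by rewrite divr_ge0 ?ltW.
    by rewrite avg_ge0.
  apply: le_mass => //; first by move=> y; exact: ltW.
  by apply: (@cube_nested _ _ _ _ _ _ _ x).
by rewrite /z divfK ?ltxx// gt_eqF// mulr_gt0// powR_gt0.
Qed.

Let stop_at (i : int) (x : T) : int * J :=
  xget (cube_at 0 x) [set P | S g i P /\ cube P x].

Let stop_atP i x : Omega g i x -> S g i (stop_at i x) /\ cube (stop_at i x) x.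
Proof.
rewrite (stopping_cover sg) => -[P iP Px].
by apply: (@xgetPex _ (cube_at 0 x) [set P | S g i P /\ cube P x]); exists P.
Qed.

Let coef (i : int) (P : int * J) := level i `^ r^-1 * frac P.1.
Let coef0 i (P : int * J) : 0 <= coef i P.
Proof. by rewrite mulr_ge0 ?powR_ge0. Qed.

Let C1 := (2 * D) `^ r^-1 / (1 - ratio).

(** At each point the sum over all generations is dominated by the terms of the
stopping cubes: between two levels the averages are comparable, and the
fractional factors form a geometric series. *)
Let fractional_sum_le x :
  (\esum_(k in [set: int]) (frac k * avg g (cube_at k x) `^ r^-1)%:E <=
   C1%:E * \esum_(i in [set i | Omega g i x]) (coef i (stop_at i x))%:E)%E.
Proof.
have D2 : 1 < 2 * D by move: D_gt1; lra.
have D20 : 0 < 2 * D by exact: lt_trans D2.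
have rn0 : 0 < r^-1 by rewrite invr_gt0.
have /andP[ra0 ra1] := ratio01.
have C10 : 0 <= C1 by rewrite divr_ge0 ?powR_ge0// subr_ge0 ltW.
pose F i k : \bar R := if level i < avg g (cube_at k x) then
  (frac k * level (i + 1) `^ r^-1)%:E else 0%E.
have F0 i k : (0 <= F i k)%E.
  by rewrite /F; case: ifP => // _; rewrite lee_fin mulr_ge0 ?powR_ge0.
apply: (@le_trans _ _ (\esum_(k in [set: int]) \esum_(i in [set: int]) F i k)%E).
  apply: le_esum => k _; have := avg_ge0 g0 lg (cube_at k x).
  rewrite le_eqVlt => /predU1P[<-|m0].
    by rewrite powR0 ?gt_eqF// mulr0; apply: esum_ge0.
  have [i /andP[im mi]] := exists_exprz_bracket D2 m0.
  apply: le_trans (@le_esum_single _ _ _ (F^~ k) i _ _) => //.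
  rewrite /F im lee_fin; apply: ler_wpM2l; first exact: ltW (frac_gt0 k).
  by rewrite ge0_ler_powR ?nnegrE ?(ltW rn0) ?(ltW m0)// ltW// level_gt0.
rewrite exchange_esum//.
rewrite -esumZl//; last by move=> i _; rewrite lee_fin.
rewrite [leRHS]esum_mkcond; apply: le_esum => i _.
case: ifPn => [/set_mem/= ix|/negP nix]; last first.
  rewrite esum1// => k _; rewrite /F; case: ifPn => // ik; exfalso.
  by apply: nix; apply/mem_set; exists k.
have [iP Px] := stop_atP ix; set P := stop_at i x in iP Px *.
apply: (@le_trans _ _ (\esum_(k in [set k : int | (k <= P.1)%R])
    (level (i + 1) `^ r^-1 * frac k)%:E)%E).
  rewrite [leRHS]esum_mkcond; apply: le_esum => k _; rewrite /F.
  case: ifPn => ik; last by case: ifPn => // _; rewrite lee_fin mulr_ge0 ?powR_ge0.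
  rewrite mem_set; first by rewrite mulrC.
  case: iP => _ _ maxP /=; rewrite leNgt; apply/negP => Pk.
  by have := maxP _ _ Px Pk; rewrite leNgt ik.
apply: le_trans (geometric_esum_int_le (x := ratio) _ _ _) _.
- by rewrite ra1 ltW.
- by move=> k; rewrite mulr_ge0 ?powR_ge0.
- by move=> k _; rewrite frac_pred mulrCA.
rewrite -EFinM lee_fin level_succ powRM ?(ltW D20) ?(ltW (level_gt0 _ _))//.
by rewrite /C1 /coef le_eqVlt; apply/orP; left; apply/eqP; ring.
Qed.

Let Lr (i : int) (x : T) : R := fine (layers G g kappa i x).
Let good (x : T) := ~ (\bigcap_i Omega g i) x.

Let ae_good : {ae mu, forall x, good x}.
Proof.
exists (\bigcap_i Omega g i); split.
- rewrite -[X in measurable X]setCK setC_bigcap; apply: measurableC.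
  apply: countable_bigcupT_measurable => // i; apply: measurableC.
  exact: measurable_superlevel.
- exact: (null_all_levels sg k01 du hu).
- by move=> x /= /contrapT.
Qed.

Let LrE i x : good x -> layers G g kappa i x = (Lr i x)%:E.
Proof.
move=> /existsNP[i1 /not_implyP[_ i1x]]; rewrite /Lr fineK//.
exact: (layers_fin k01 i i1x).
Qed.

Let Lr_ge1 i x : good x -> Omega g i x -> 1 <= Lr i x.
Proof. by move=> gx ix; rewrite -lee_fin -LrE//; exact: layers_ge1. Qed.

Let Lr0 i x : 0 <= Lr i x.
Proof. by apply: fine_ge0; exact: layers_ge0. Qed.

Let C2 := ((1 - kappa `^ q^-1)^-1) `^ q.

(** Hölder's inequality in the form of a supremum: the layers decrease
geometrically with the level, hence the largest term of the weighted sum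
controls the plain sum. *)
Let esum_power_le (B : int -> R) x : good x -> (forall i, 0 <= B i) ->
  ((\esum_(i in [set i | Omega g i x]) (B i)%:E) `^ q <=
   C2%:E * \esum_(i in [set i | Omega g i x]) (B i `^ q * Lr i x)%:E)%E.
Proof.
move=> gx B0; set I := [set i | _].
have qn0 : 0 < q^-1 by rewrite invr_gt0.
have kq1 : kappa `^ q^-1 < 1.
  have one : 1 `^ q^-1 = 1 :> R by rewrite powR1.
  by rewrite -[ltRHS]one gt0_ltr_powR// ?nnegrE// ltW.
have C20 : 0 < C2 by rewrite powR_gt0// invr_gt0 subr_gt0.
set b := (\esum_(i in I) (B i `^ q * Lr i x)%:E)%E.
have b0 : (0 <= b)%E.
  by apply: esum_ge0 => i _; rewrite lee_fin mulr_ge0 ?powR_ge0.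
have bi i : I i -> ((B i `^ q * Lr i x)%:E <= b)%E.
  move=> Ii; apply: (@le_esum_single _ _ I (fun i => (B i `^ q * Lr i x)%:E) i Ii).
  by rewrite lee_fin mulr_ge0 ?powR_ge0.
case: b b0 bi => [b||] b0 bi //; last by rewrite gt0_muley ?leey// lte_fin.
rewrite lee_fin in b0.
have key : (\esum_(i in I) (B i)%:E <= (b `^ q^-1 * (1 - kappa `^ q^-1)^-1)%:E)%E.
  apply: (@le_trans _ _ (\esum_(i in I) ((b `^ q^-1)%:E * (Lr i x `^ (- q^-1))%:E))%E).
    apply: le_esum => i Ii; rewrite -EFinM lee_fin.
    have L1 := Lr_ge1 gx Ii; have L0 : 0 < Lr i x by exact: lt_le_trans L1.
    rewrite powRN ler_pdivlMr ?powR_gt0//.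
    have {1}-> : B i = (B i `^ q) `^ q^-1.
      by rewrite -powRrM divff ?gt_eqF// powRr1.
    rewrite -powRM ?powR_ge0// ge0_ler_powR ?(ltW qn0) ?nnegrE//.
      by rewrite mulr_ge0 ?powR_ge0.
    by rewrite -lee_fin; exact: bi.
  rewrite esumZl ?powR_ge0//; last by move=> i _; rewrite lee_fin powR_ge0.
  rewrite EFinM; apply: lee_wpmul2l; first by rewrite lee_fin powR_ge0.
  exact: (esum_layers_le k01 qn0 gx).
apply: (@le_trans _ _ (((b `^ q^-1 * (1 - kappa `^ q^-1)^-1)%:E) `^ q)%E).
  apply: gt0_ler_poweR => //; rewrite ?(ltW q0)// ?in_itv/= ?leey ?andbT//.
    by apply: esum_ge0 => i _; rewrite lee_fin.
  by rewrite lee_fin mulr_ge0 ?powR_ge0// invr_ge0 subr_ge0 ltW.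
rewrite poweR_EFin powRM ?powR_ge0//; last by rewrite invr_ge0 subr_ge0 ltW.
by rewrite -powRrM mulVf ?gt_eqF// powRr1// -EFinM mulrC.
Qed.

Let c := (1 - kappa) / 2.
Let c0 : 0 < c. Proof. by rewrite divr_gt0// subr_gt0. Qed.

(** The constant [c] makes the integral of [c * layers * v] over the cube at most
half of the mass of [v]. *)
Let carleson_le i (P : int * J) : S g i P ->
  ((lam P `^ t * mass v P)%:E <=
   2%:E * \int[mu]_(x in cube P) ((c * Lr i x) `^ (1 - t) * H x)%:E)%E.
Proof.
move=> iP; have P0 : cube P !=set0 by case: iP.
apply: average_power_le => //.
- apply: measurable_funM => //.
  by apply: measurableT_comp => //; exact: measurable_layers.
- by move=> x; rewrite mulr_ge0// ltW.
- apply: filterS ae_good => x gx Px; rewrite mulr_gt0//.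
  apply: lt_le_trans (Lr_ge1 gx _) => //.
  exact: (superlevel_stopping sg iP).
apply: (@le_trans _ _ (\int[mu]_(x in cube P)
    (c%:E * (layers G g kappa i x * (v x)%:E)))%E).
  apply: lower_integral_le => // x _.
    by rewrite lee_fin; apply: mulr_ge0; [apply: mulr_ge0 => //|]; exact: ltW.
  rewrite -mulrA EFinM; apply: lee_wpmul2l; first by rewrite lee_fin ltW.
  rewrite EFinM; apply: lee_wpmul2r; first by rewrite lee_fin ltW.
  rewrite /Lr; have := layers_ge0 G g k01 i x.
  by case: (layers _ _ _ _ _) => [a||]//=; rewrite leey.
rewrite ge0_integralZl//; last 3 first.
- by apply: emeasurable_funM; [exact: measurable_layers|exact: measurable_EFin_of].
- by move=> x _; rewrite mule_ge0 ?layers_ge0// lee_fin ltW.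
- by rewrite lee_fin ltW.
apply: (@le_trans _ _ (c%:E * (mass v P / (1 - kappa))%:E)%E).
  apply: lee_wpmul2l; first by rewrite lee_fin ltW.
  exact: integral_layers.
rewrite -EFinM lee_fin /c le_eqVlt; apply/orP; left; apply/eqP; field.
by rewrite subr_eq0 gt_eqF.
Qed.

Let K2 := (1 - kappa `^ (t - 1))^-1.
Let t10 : 0 < t - 1. Proof. by rewrite subr_gt0. Qed.
Let K20 : 0 <= K2.
Proof.
have one : 1 `^ (t - 1) = 1 :> R by rewrite powR1.
by rewrite invr_ge0 subr_ge0 -[leRHS]one ge0_ler_powR ?nnegrE ?(ltW t10)// ltW.
Qed.

(** Carleson embedding: summed over the levels, the local factors
[layers ^ (1 - t)] form a geometric series at each point. *)
Let carleson_sum_le :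
  (\esum_(i in [set: int]) \esum_(P in S g i) (lam P `^ t * mass v P)%:E <=
   (2 * (c `^ (1 - t) * K2))%:E * M)%E.
Proof.
pose h i x := ((c * Lr i x) `^ (1 - t) * H x)%:E.
have h0 i x : (0 <= h i x)%E by rewrite lee_fin mulr_ge0 ?powR_ge0.
have mh i A : measurable_fun A (h i).
  apply/measurable_EFinP; apply: measurable_funM => //.
  apply: measurable_fun_powR; apply: measurable_funM => //.
  by apply: measurableT_comp => //; exact: measurable_layers.
apply: (@le_trans _ _ (2%:E * \esum_(i in [set: int])
    \int[mu]_(x in Omega g i) h i x)%E).
  rewrite -esumZl//; last by move=> i _; apply: integral_ge0 => x _; exact: h0.
  apply: le_esum => i _.
  rewrite -(setTI (Omega g i)) (integral_stopping sg)// -esumZl//; last first.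
    by move=> P _; apply: integral_ge0 => x _; exact: h0.
  by apply: le_esum => P iP; rewrite setTI; exact: carleson_le.
rewrite EFinM -muleA; apply: lee_wpmul2l; first by rewrite lee_fin.
rewrite /M; rewrite -ge0_integralZl//; last 3 first.
- exact/measurable_EFinP.
- by move=> x _; rewrite lee_fin.
- by rewrite lee_fin mulr_ge0 ?powR_ge0.
under eq_esum do rewrite integral_mkcond.
rewrite -integral_esum//; last 2 first.
- by move=> i x _; apply: erestrict_ge0 => y _; exact: h0.
- move=> i _; apply/(measurable_restrictT _ _).1 => //.
  exact: measurable_superlevel.
apply: ae_lower_integral_le => //.
- by move=> x _; apply: esum_ge0 => i _; apply: erestrict_ge0 => y _; exact: h0.
- by move=> x _; rewrite -EFinM lee_fin !mulr_ge0 ?powR_ge0.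
apply: filterS ae_good => x gx _.
apply: (@le_trans _ _ ((c `^ (1 - t) * H x)%:E *
  \esum_(i in [set i | Omega g i x]) (Lr i x `^ (- (t - 1)))%:E)%E).
  rewrite -esumZl ?mulr_ge0 ?powR_ge0//; last first.
    by move=> i _; rewrite lee_fin powR_ge0.
  rewrite [leRHS]esum_mkcond; apply: le_esum => i _.
  rewrite patchE; case: ifPn => [/set_mem ix|nx].
    rewrite mem_set// /h -EFinM lee_fin powRM ?(ltW c0)// opprB.
    by rewrite le_eqVlt; apply/orP; left; apply/eqP; ring.
  case: ifPn => // _; rewrite -EFinM lee_fin.
  by rewrite !mulr_ge0 ?powR_ge0.
apply: (@le_trans _ _ ((c `^ (1 - t) * H x)%:E * K2%:E)%E).
  apply: lee_wpmul2l; first by rewrite lee_fin mulr_ge0 ?powR_ge0.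
  exact: (esum_layers_le k01 t10 gx).
by rewrite -!EFinM lee_fin mulrAC.
Qed.

Let C10 : 0 <= C1.
Proof.
by rewrite divr_ge0 ?powR_ge0// subr_ge0 ltW//; case/andP: ratio01.
Qed.

Let Phi (x : T) := (\esum_(i in [set: int]) \esum_(P in S g i)
  ((\1_(cube P) x)%:E * ((coef i P `^ q)%:E *
     (layers G g kappa i x * (u x)%:E))))%E.

Let term0 i (P : int * J) x : (0 <= (\1_(cube P) x)%:E * ((coef i P `^ q)%:E *
     (layers G g kappa i x * (u x)%:E)))%E.
Proof.
rewrite mule_ge0 ?lee_fin// mule_ge0 ?lee_fin ?powR_ge0//.
by rewrite mule_ge0 ?layers_ge0// lee_fin ltW.
Qed.

Let mlu i A : measurable_fun A (fun x => layers G g kappa i x * (u x)%:E)%E.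
Proof.
by apply: emeasurable_funM; [exact: measurable_layers|exact: measurable_EFin_of].
Qed.

Let lu0 i x : (0 <= layers G g kappa i x * (u x)%:E)%E.
Proof. by rewrite mule_ge0 ?layers_ge0// lee_fin ltW. Qed.

Let pointwise_le x : good x ->
  ((\esum_(k in [set: int]) (frac k * avg g (cube_at k x) `^ r^-1)%:E) `^ q *
    (u x)%:E <= (C1 `^ q * C2)%:E * Phi x)%E.
Proof.
move=> gx; set s := (\esum_(i in [set i | Omega g i x])
  (coef i (stop_at i x))%:E)%E.
have s0 : (0 <= s)%E by apply: esum_ge0 => i _; rewrite lee_fin.
have C20 : 0 <= C2 by exact: powR_ge0.
apply: (@le_trans _ _ ((C1%:E * s) `^ q * (u x)%:E)%E).
  apply: lee_wpmul2r; first by rewrite lee_fin ltW.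
  apply: gt0_ler_poweR; rewrite ?(ltW q0)// ?in_itv/= ?leey ?andbT.
  - by apply: esum_ge0 => k _; rewrite lee_fin mulr_ge0 ?powR_ge0.
  - by rewrite mule_ge0// lee_fin.
rewrite poweRM ?lee_fin// poweR_EFin EFinM -!muleA.
apply: lee_wpmul2l; first by rewrite lee_fin powR_ge0.
apply: (@le_trans _ _ (C2%:E * (\esum_(i in [set i | Omega g i x])
    (coef i (stop_at i x) `^ q * Lr i x)%:E) * (u x)%:E)%E).
  apply: lee_wpmul2r; first by rewrite lee_fin ltW.
  exact: esum_power_le.
rewrite -muleA; apply: lee_wpmul2l; first by rewrite lee_fin.
rewrite muleC -esumZl ?(ltW (u0 x))//; last first.
  by move=> i _; rewrite lee_fin mulr_ge0 ?powR_ge0.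
rewrite [leLHS]esum_mkcond; apply: le_esum => i _.
case: ifPn => [/set_mem/= ix|_]; last by apply: esum_ge0.
have [iP Px] := stop_atP ix.
apply: le_trans (@le_esum_single _ _ _ (fun P => ((\1_(cube P) x)%:E *
  ((coef i P `^ q)%:E * (layers G g kappa i x * (u x)%:E)))%E) _ iP _) => //.
rewrite indicE mem_set// mul1e LrE// -!EFinM lee_fin.
by rewrite le_eqVlt; apply/orP; left; apply/eqP; ring.
Qed.

Let mPhi_term i (P : int * J) : measurable_fun setT (fun x =>
  (\1_(cube P) x)%:E * ((coef i P `^ q)%:E *
     (layers G g kappa i x * (u x)%:E)))%E.
Proof.
apply: emeasurable_funM; last exact/measurable_funeM/mlu.
apply/measurable_EFinP; exact: measurable_indic.
Qed.

Let mPhi : measurable_fun setT Phi.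
Proof.
apply: measurable_fun_esum => [i x _|i _]; first exact: esum_ge0.
by apply: measurable_fun_esum.
Qed.

Let Mx := 2 * 2^-1 `^ (1 - t) * fine M.
Let Mx0 : 0 <= Mx.
Proof. by rewrite mulr_ge0 ?fine_ge0// mulr_ge0 ?powR_ge0. Qed.

Let Y (P : int * J) := lam P `^ t * mass v P.
Let Y0 P : 0 <= Y P. Proof. by rewrite mulr_ge0 ?powR_ge0. Qed.

(** One power of the Carleson quantity [Y P] is kept for the embedding; the
remaining power, which is positive since [p < q], is bounded by the norm of
[g]. *)
Let coef_le i P : S g i P ->
  coef i P `^ q * mass u P <= CA * Mx `^ (q / p - 1) * Y P.
Proof.
move=> iP; have P0 : cube P !=set0 by case: iP.
apply: (@le_trans _ _ (frac P.1 `^ q * avg g P `^ (q / r) * mass u P)).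
  apply: ler_wpM2r => //.
  rewrite /coef powRM ?powR_ge0// mulrC; apply: ler_wpM2l; first exact: powR_ge0.
  rewrite -powRrM (mulrC r^-1); apply: ge0_ler_powR.
  - by rewrite divr_ge0 ?ltW.
  - by rewrite nnegrE ltW// level_gt0.
  - by rewrite nnegrE avg_ge0.
  - by case: iP => _ /ltW.
apply: (le_trans (cell_le P0)); rewrite -mulrA; apply: ler_wpM2l; first exact: ltW.
rewrite -/(Y P) -mulr_powRB1//; last by rewrite (lt_trans _ qp).
rewrite mulrC; apply: ler_wpM2r => //; apply: ge0_ler_powR; rewrite ?nnegrE//.
  by rewrite subr_ge0 ltW.
exact: lam_le.
Qed.

(** The layers may be integrated against [u] cell by cell, because their integral
over a stopping cube is comparable to the mass of [u] there. *)
Let integral_Phi : (\int[mu]_x Phi x <=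
  ((1 - kappa)^-1 * (CA * Mx `^ (q / p - 1)) * (2 * (c `^ (1 - t) * K2)))%:E * M)%E.
Proof.
have k10 : 0 <= (1 - kappa)^-1 by rewrite invr_ge0 subr_ge0 ltW.
have cM0 : 0 <= CA * Mx `^ (q / p - 1) by rewrite mulr_ge0 ?powR_ge0// ltW.
have -> : (\int[mu]_x Phi x = \esum_(i in [set: int]) \esum_(P in S g i)
    ((coef i P `^ q)%:E * \int[mu]_(x in cube P)
       (layers G g kappa i x * (u x)%:E)))%E.
  rewrite /Phi integral_esum//; last 2 first.
  - by move=> i x _; apply: esum_ge0.
  - by move=> i _; apply: measurable_fun_esum.
  apply: eq_esum => i _; rewrite integral_esum//.
  apply: eq_esum => P _; rewrite ge0_integral_indic// setTI.
  by rewrite ge0_integralZl// lee_fin powR_ge0.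
apply: (@le_trans _ _ (\esum_(i in [set: int]) \esum_(P in S g i)
   (((1 - kappa)^-1 * (CA * Mx `^ (q / p - 1)))%:E * (Y P)%:E))%E).
  apply: le_esum => i _; apply: le_esum => P iP.
  apply: (@le_trans _ _ ((coef i P `^ q)%:E * (mass u P / (1 - kappa))%:E)%E).
    apply: lee_wpmul2l; first by rewrite lee_fin powR_ge0.
    exact: integral_layers.
  rewrite -!EFinM lee_fin mulrA mulrC -mulrA; apply: ler_wpM2l => //.
  exact: coef_le.
have A0 : 0 <= (1 - kappa)^-1 * (CA * Mx `^ (q / p - 1)) by rewrite mulr_ge0.
have YE i : (\esum_(P in S g i)
     (((1 - kappa)^-1 * (CA * Mx `^ (q / p - 1)))%:E * (Y P)%:E) =
   ((1 - kappa)^-1 * (CA * Mx `^ (q / p - 1)))%:E * \esum_(P in S g i) (Y P)%:E)%E.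
  by rewrite esumZl// => P _; rewrite lee_fin.
under eq_esum do rewrite YE.
rewrite esumZl//; last by move=> i _; apply: esum_ge0 => P _; rewrite lee_fin.
rewrite [X in (_ <= X * _)%E]EFinM -muleA.
apply: lee_wpmul2l; [by rewrite lee_fin|exact: carleson_sum_le].
Qed.

Lemma fractional_integral_le :
  (\int[mu]_x ((\esum_(k in [set: int])
      (frac k * avg g (cube_at k x) `^ r^-1)%:E) `^ q * (u x)%:E) <=
   (C1 `^ q * C2 * ((1 - kappa)^-1 * CA * (2 * 2^-1 `^ (1 - t)) `^ (q / p - 1) *
     (2 * (c `^ (1 - t) * K2))) * fine M `^ (q / p))%:E)%E.
Proof.
have Phi0 x : (0 <= Phi x)%E by apply: esum_ge0 => i _; exact: esum_ge0.
have C20 : 0 <= C2 by exact: powR_ge0.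
apply: (@le_trans _ _ (\int[mu]_x ((C1 `^ q * C2)%:E * Phi x))%E).
  apply: ae_lower_integral_le => //.
  - by move=> x _; rewrite mule_ge0 ?poweR_ge0// lee_fin ltW.
  - by move=> x _; rewrite mule_ge0// lee_fin mulr_ge0 ?powR_ge0.
  by apply: filterS ae_good => x gx _; exact: pointwise_le.
rewrite ge0_integralZl//; last by rewrite lee_fin mulr_ge0 ?powR_ge0.
rewrite -(mulrA (_ * C2)) [leRHS]EFinM; apply: lee_wpmul2l.
  by rewrite lee_fin mulr_ge0 ?powR_ge0.
apply: (le_trans integral_Phi).
have -> : M = (fine M)%:E by rewrite fineK// ge0_fin_numE.
rewrite -EFinM lee_fin /Mx /=.
rewrite (powRM _ (_ : 0 <= 2 * 2^-1 `^ (1 - t))) ?fine_ge0 ?mulr_ge0 ?powR_ge0//.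
rewrite -(@mulr_powRB1 _ (fine M) (q / p)) ?fine_ge0//; last exact: lt_trans qp.
by rewrite le_eqVlt; apply/orP; left; apply/eqP; ring.
Qed.

End fixed_function.

(** The local finiteness of [g] is part of the conclusion because the averages
are real numbers, which would be 0 on cubes where [g] is not integrable. *)
Theorem dyadic_strong_type : exists2 C : R, 0 < C &
  forall g : T -> R, measurable_fun setT g -> (forall x, 0 <= g x) ->
  (\int[mu]_x (dual_power v (p / r) g x)%:E < +oo)%E ->
  (forall P : int * J, (\int[mu]_(x in cube P) (g x)%:E < +oo)%E) /\
  (\int[mu]_x ((\esum_(k in [set: int])
      (frac k * avg g (cube_at k x) `^ r^-1)%:E) `^ q * (u x)%:E) <=
   C%:E * (\int[mu]_x (dual_power v (p / r) g x)%:E) `^ (q / p))%E.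
Proof.
set C := (((2 * D) `^ r^-1 / (1 - ratio)) `^ q * ((1 - kappa `^ q^-1)^-1) `^ q *
  ((1 - kappa)^-1 * CA * (2 * 2^-1 `^ (1 - t)) `^ (q / p - 1) *
   (2 * (((1 - kappa) / 2) `^ (1 - t) * (1 - kappa `^ (t - 1))^-1)))).
exists (Num.max C 1) => [|g mg g0 gfin]; first by rewrite lt_max ltr01 orbT.
have M0 : (0 <= \int[mu]_x (dual_power v t g x)%:E)%E.
  by apply: integral_ge0 => x _; rewrite lee_fin dual_power_ge0.
split; first exact: dual_power_local mg g0 gfin.
apply: (le_trans (fractional_integral_le mg g0 gfin)).
rewrite -[X in (_ <= _ * X `^ _)%E]fineK ?ge0_fin_numE//.
rewrite poweR_EFin -EFinM lee_fin; apply: ler_wpM2r; first exact: powR_ge0.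
by rewrite le_max lexx.
Qed.

End dyadic_strong.

(** * Dyadic differentiation *)

Section differentiation.
Context d (T : measurableType d) (R : realType).
Variables (mu : {measure set T -> \bar R}) (G : dyadic_grid mu).
Local Notation J := (dg_index G).
Local Notation D := (dg_ratio G).
Local Notation cube := (@cube d T R mu G).
Local Notation cube_at := (@cube_at d T R mu G).

Let mC (P : int * J) : measurable (cube P). Proof. exact: measurable_cube. Qed.

(** The cubes generate a topology, which replaces that of the space in the usual
proof by regularity of the measure. *)
Definition dyadic_open (W : set T) :=
  forall x, W x -> exists k, cube (cube_at k x) `<=` W.

Lemma dyadic_open_measurable W : dyadic_open W -> measurable W.
Proof.
move=> oO; rewrite (_ : W = \bigcup_(P in [set P : int * J | cube P `<=` W]) cube P).
  rewrite bigcup_mkcond; apply: countable_bigcupT_measurable => // P.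
  by case: ifPn.
apply/seteqP; split => [x /oO[k kO]|x [P PO Px]]; last exact: PO.
by exists (cube_at k x).
Qed.

Lemma dyadic_open_cube P : dyadic_open (cube P).
Proof. by move=> x Px; exists P.1; rewrite -(cube_cube_at Px). Qed.

Lemma dyadic_openC_cube P : dyadic_open (~` cube P).
Proof.
move=> x nPx; exists P.1 => y xy Py; apply: nPx.
exact: etrans (esym xy) Py.
Qed.

Lemma cube_at_le (j k : int) x : j <= k -> cube (cube_at j x) `<=` cube (cube_at k x).
Proof. by move=> jk; exact: (@cube_nested _ _ _ _ _ _ _ x). Qed.

Lemma dyadic_openI W1 W2 : dyadic_open W1 -> dyadic_open W2 ->
  dyadic_open (W1 `&` W2).
Proof.
move=> o1 o2 x [/o1[k1 k1O] /o2[k2 k2O]]; exists (Num.min k1 k2) => y xy.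
split; [apply: k1O|apply: k2O]; apply: cube_at_le xy.
  by rewrite ge_min lexx.
by rewrite ge_min lexx orbT.
Qed.

Lemma dyadic_openU (W : nat -> set T) : (forall n, dyadic_open (W n)) ->
  dyadic_open (\bigcup_n W n).
Proof.
move=> oO x [n _ /(oO n)[k kO]]; exists k; apply: subset_trans kO _.
exact: bigcup_sup.
Qed.

Section regularity.
Variable P0 : int * J.

Definition dyadic_regular (E : set T) := forall e : R, 0 < e ->
  exists W1 W2, [/\ dyadic_open W1, dyadic_open W2, E `<=` W1, ~` E `<=` W2 &
    (mu (cube P0 `&` (W1 `&` W2)) <= e%:E)%E].

(** The intersection of countably many open sets need not be open; finitely
many of them suffice, since the measures of their intersections converge. *)
Let regular_bigcup (E : nat -> set T) :
  (forall n, dyadic_regular (E n)) -> dyadic_regular (\bigcup_n E n).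
Proof.
move=> rE e e0.
have rE' n : exists W : set T * set T, [/\ dyadic_open W.1, dyadic_open W.2,
    E n `<=` W.1, ~` E n `<=` W.2 &
    (mu (cube P0 `&` (W.1 `&` W.2)) <= (e / 2 / (2 ^ n.+1)%:R)%:E)%E].
  have en : 0 < e / 2 / (2 ^ n.+1)%:R by rewrite !divr_gt0// ltr0n expn_gt0.
  by have [W1 [W2 H]] := rE n _ en; exists (W1, W2).
have [W HO] := choice rE'.
pose U := \bigcup_n (W n).1.
pose V N := [set x | forall n, (n < N)%N -> (W n).2 x].
have oU : dyadic_open U by apply: dyadic_openU => n; case: (HO n).
have oV N : dyadic_open (V N).
  elim: N => [|N IH]; first by move=> x _; exists 0.
  rewrite (_ : V N.+1 = V N `&` (W N).2).
    by apply: dyadic_openI => //; case: (HO N).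
  apply/seteqP; split => [x H|x [H HN] n].
    by split => [n nN|]; apply: H => //; exact: ltnW.
  by rewrite ltnS leq_eqVlt => /predU1P[->//|]; exact: H.
pose F N := cube P0 `&` (U `&` V N).
have mF N : measurable (F N).
  by apply: measurableI => //; apply: dyadic_open_measurable; exact: dyadic_openI.
have ndF : nonincreasing_seq F.
  move=> m n mn; apply/subsetPset => x [Px [Ux H]]; do 2 split => //.
  by move=> k km; apply: H; exact: leq_trans mn.
have mcap : measurable (\bigcap_n F n) by exact: bigcapT_measurable.
have Ffin : (mu (F 0%N) < +oo)%E.
  apply: (le_lt_trans _ (measure_cube_lty P0)).
  by apply: le_measure; rewrite ?inE// => x [].
have cvF := nonincreasing_cvg_mu Ffin mF mcap ndF.
have cap_le : (mu (\bigcap_n F n) <= (e / 2)%:E)%E.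
  have mOO n : measurable (cube P0 `&` ((W n).1 `&` (W n).2)).
    have [ o1 o2 _ _ _] := HO n; apply: measurableI => //.
    by apply: dyadic_open_measurable; exact: dyadic_openI.
  apply: (@le_trans _ _ (\sum_(n <oo) mu (cube P0 `&` ((W n).1 `&` (W n).2)))%E).
    apply: measure_sigma_subadditive => // x Fx.
    have [Px [[n _ Onx] _]] := Fx 0%N Logic.I.
    exists n => //; do 2 split => //.
    by have [_ [_ H]] := Fx n.+1 Logic.I; exact: H.
  apply: (@le_trans _ _ (\sum_(n <oo) (e / 2 / (2 ^ n.+1)%:R)%:E)%E).
    by apply: lee_nneseries => // n _; have [_ _ _ _] := HO n.
  by apply: epsilon_trick0; rewrite divr_ge0// ltW.
have [N FN] : exists N, (mu (F N) <= e%:E)%E.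
  apply: contrapT => nex.
  have Fe N : (e%:E <= mu (F N))%E.
    by apply: ltW; rewrite ltNge; apply/negP => FN; apply: nex; exists N.
  have : (e%:E <= mu (\bigcap_n F n))%E.
    rewrite -(cvg_lim _ cvF)//; apply: lime_ge; first by apply/cvg_ex; eexists; exact: cvF.
    exact: nearW.
  by move=> /le_trans/(_ cap_le); rewrite lee_fin; lra.
exists U, (V N); split => //.
- by move=> x [n _ Ex]; exists n => //; have [_ _ + _ _] := HO n; exact.
- move=> x nEx n nN; have [_ _ _ H _] := HO n; apply: H => Ex.
  by apply: nEx; exists n.
Qed.

Lemma measurable_dyadic_regular E : measurable E -> dyadic_regular E.
Proof.
move=> /(@dg_generate _ _ _ _ G) mE.
apply: (smallest_sub (X := dyadic_regular) _ _ mE).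
  split.
  - move=> e e0; exists set0, setT; split => //.
      by move=> x _; exists 0.
    by rewrite set0I setI0 measure0 lee_fin ltW.
  - move=> A rA e e0; have [W1 [W2 [ o1 o2 AO1 AO2 le]]] := rA e e0.
    exists W2, W1; split => //; first by rewrite setTD.
      by rewrite setTD setCK.
    by rewrite (setIC W2).
  - exact: regular_bigcup.
move=> _ [k [j ->]] e e0; exists (cube (k, j)), (~` cube (k, j)); split => //.
- exact: dyadic_open_cube.
- exact: dyadic_openC_cube.
- by rewrite setICr setI0 measure0 lee_fin ltW.
Qed.

Lemma dyadic_outer_regular E (e : R) : measurable E -> E `<=` cube P0 -> 0 < e ->
  exists W, [/\ dyadic_open W, E `<=` W, W `<=` cube P0 &
    (mu W <= mu E + e%:E)%E].
Proof.
move=> mE EP e0; have [W1 [W2 [ o1 o2 EO1 EO2 le]]] := measurable_dyadic_regular mE e0.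
exists (cube P0 `&` W1); split => //.
- by apply: dyadic_openI => //; exact: dyadic_open_cube.
- by move=> x Ex; split; [exact: EP|exact: EO1].
have mO12 : measurable (cube P0 `&` (W1 `&` W2)).
  by apply: measurableI => //; apply: dyadic_open_measurable; exact: dyadic_openI.
apply: (@le_trans _ _ (mu (E `|` (cube P0 `&` (W1 `&` W2))))).
  apply: le_measure; rewrite ?inE.
  - by apply: measurableI => //; exact: dyadic_open_measurable.
  - exact: measurableU.
  - move=> x [Px O1x]; have [Ex|nEx] := pselect (E x); [by left|right].
    by do 2 split => //; exact: EO2.
by apply: (le_trans (measureU2 _ mE mO12)); rewrite leeD2l.
Qed.

End regularity.

Section bounded_averages.
Variables (g : T -> R) (s : R) (P0 : int * J).
Hypotheses (mg : measurable_fun setT g) (g0 : forall x, 0 <= g x).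
Hypothesis lg : forall P : int * J, (\int[mu]_(x in cube P) (g x)%:E < +oo)%E.
Hypothesis s0 : 0 <= s.

Let E := cube P0 `&` ([set x | s < g x] `&`
  [set x | forall k, avg g (cube_at k x) <= s]).

Let mE : measurable E.
Proof.
apply: measurableI => //; apply: measurableI.
  have := mg measurableT (measurable_itv `]s, +oo[); rewrite setTI.
  congr measurable; apply/seteqP.
  by split => x /=; rewrite in_itv/= andbT.
rewrite (_ : mkset _ = ~` [set x | exists k, s < avg g (cube_at k x)]).
  apply: measurableC; apply: dyadic_open_measurable => x [k kx].
  exists k => y xy; exists k.
  by rewrite (_ : cube_at k y = cube_at k x)//; congr pair.
apply/seteqP; split => [x H [k]|x H k]; first by rewrite ltNge H.
by rewrite leNgt; apply/negP => kx; apply: H; exists k.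
Qed.

Let mgE A : measurable_fun A (fun x => (g x)%:E).
Proof. exact: measurable_EFin_of. Qed.

Let open_le (W : set T) : dyadic_open W -> E `<=` W ->
  (\int[mu]_(x in E) (g x)%:E <= s%:E * mu W)%E.
Proof.
move=> oO EO; pose A (n : nat) := [set x | cube (cube_at (- n%:Z) x) `<=` W].
have mO := dyadic_open_measurable oO.
have oA n : dyadic_open (A n).
  move=> x Ax; exists (- n%:Z) => y xy z zy; apply: Ax.
  exact: etrans zy xy.
have mA n := dyadic_open_measurable (oA n).
have ndA : nondecreasing_seq (fun n => E `&` A n).
  move=> m n mn; apply/subsetPset => x [Ex Ax]; split => //.
  by apply: subset_trans Ax; apply: cube_at_le; rewrite lerN2 lez_nat.
have EA : \bigcup_n (E `&` A n) = E.
  apply/seteqP; split => [x [n _ []]//|x Ex].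
  have [k kO] := oO x (EO x Ex); exists `|k|%N => //; split => //.
  apply: subset_trans kO; apply: cube_at_le.
  by lia.
have cv : (\int[mu]_(x in E `&` A n) (g x)%:E @[n --> \oo] -->
    \int[mu]_(x in \bigcup_n (E `&` A n)) (g x)%:E)%E.
  apply: ge0_nondecreasing_set_cvg_integral => //.
  - by move=> n; exact: measurableI.
  - by move=> n x _; rewrite lee_fin.
rewrite -[X in integral _ X]EA -(cvg_lim _ cv)//; apply: lime_le.
  by apply/cvg_ex; eexists; exact: cv.
apply: nearW => n.
pose C (j : J) := cube (- n%:Z, j).
have CT : \bigcup_(j in [set: J]) C j = setT.
  by apply/seteqP; split => // x _; exists (dg_idx G (- n%:Z) x).
have tC : trivIset [set: J] C.
  by move=> i j _ _ [x [ix jx]]; exact: etrans (esym ix) jx.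
have sumE (B : set T) (h : T -> \bar R) : measurable B -> measurable_fun setT h ->
    (forall x, (0 <= h x)%E) ->
    (\int[mu]_(x in B) h x = \esum_(j in [set: J]) \int[mu]_(x in B `&` C j) h x)%E.
  move=> mB mh h0; rewrite -{1}(setIT B) -CT setI_bigcupr.
  apply: integral_bigcup_esum => //; first by move=> j _; apply: measurableI => //; exact: mC.
  by move=> i j _ _ [x [[_ ix] [_ jx]]]; apply: (tC i j) => //; exists x.
have -> : mu W = (\int[mu]_(x in W) 1)%E by rewrite integral_cst// mul1e.
have mEA : measurable (E `&` A n) by exact: measurableI.
have gE0 x : (0 <= (g x)%:E)%E by rewrite lee_fin.
rewrite (sumE _ _ mEA (@mgE setT) gE0).
rewrite (sumE W)// -esumZl//; last by move=> j _; apply: integral_ge0.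
apply: le_esum => j _.
have [->|/set0P[x [[Ex Ax] jx]]] := eqVneq (E `&` A n `&` C j) set0.
  by rewrite integral_set0 mule_ge0//; apply: integral_ge0.
have CE : C j = cube (cube_at (- n%:Z) x) by rewrite -(cube_cube_at jx).
have CO : C j `<=` W by rewrite CE.
rewrite [X in (_ <= _ * integral _ X _)%E]setIC; move/setIidPl : (CO) => ->.
rewrite integral_cst ?mul1e; last exact: mC.
apply: (@le_trans _ _ (\int[mu]_(x in C j) (g x)%:E)%E).
  have mCj : measurable (C j) by exact: mC.
  by apply: ge0_subset_integral => //; exact: measurableI.
rewrite CE massE// measure_cube; last by exists x.
rewrite -EFinM lee_fin -ler_pdivrMr ?volume_gt0//.
by case: Ex => _ [_]; exact.
Qed.

(** On an open [W] that contains [E], split into small cubes, the averages give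
[s * mu W] as a bound for the integral of [g] over [E]; by regularity [mu W] is
as close to [mu E] as desired, although [s < g] on [E]. *)
Lemma null_bounded_averages : mu E = 0%E.
Proof.
have Efin : (mu E < +oo)%E.
  apply: (le_lt_trans _ (measure_cube_lty P0)).
  by apply: le_measure; rewrite ?inE// => x [].
have muE : mu E = (fine (mu E))%:E by rewrite fineK// ge0_fin_numE.
have mgs : measurable_fun E (fun x => g x - s).
  by apply: measurable_funB => //; exact: measurable_funS mg.
have gs0 x : E x -> 0 < g x - s by case=> _ [/= + _]; rewrite subr_gt0.
apply: (null_of_integral_eq0 mE mgs) => //.
set I := (\int[mu]_(x in E) _)%E.
have I0 : (0 <= I)%E by apply: integral_ge0 => x Ex; rewrite lee_fin ltW// gs0.
have IE : (I + s%:E * mu E = \int[mu]_(x in E) (g x)%:E)%E.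
  rewrite -integral_cst// -ge0_integralD//.
  - by apply: eq_integral => x _; rewrite -EFinD subrK.
  - by move=> x Ex; rewrite lee_fin ltW// gs0.
  - exact/measurable_EFinP.
apply/eqP; rewrite eq_le I0 andbT; apply/lee_addgt0Pr => e e0.
have s10 : 0 < s + 1 by rewrite ltr_wpDl.
have e'0 : 0 < e / (s + 1) by rewrite divr_gt0.
have [W [oO EO OP Ole]] := dyadic_outer_regular mE (@subIsetl _ _ _) e'0.
have := open_le oO EO; rewrite -IE => H.
have {}H : (I + s%:E * mu E <= s%:E * (mu E + (e / (s + 1))%:E))%E.
  by apply: (le_trans H); exact: lee_wpmul2l.
move: H; rewrite muE -EFinD -!EFinM add0e.
case: I I0 {IE} => [I||]// I0; rewrite -EFinD !lee_fin mulrDr [leRHS]addrC lerD2r.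
move=> /le_trans; apply; rewrite mulrA ler_pdivrMr// mulrC.
by rewrite ler_wpM2l ?lerDl// ltW.
Qed.

Lemma ae_le_of_averages : {ae mu, forall x, cube P0 x ->
  (forall k, avg g (cube_at k x) <= s) -> g x <= s}.
Proof.
exists E; split => //; first exact: null_bounded_averages.
move=> x /= /not_implyP[P0x /not_implyP[xs /negP]].
by rewrite -ltNge.
Qed.

End bounded_averages.
End differentiation.

(** * Muckenhoupt pairs of densities *)

Section muckenhoupt.
Context d (T : measurableType d) (R : realType).
Variables (mu : {measure set T -> \bar R}) (G : dyadic_grid mu).
Local Notation J := (dg_index G).
Local Notation D := (dg_ratio G).
Local Notation cube := (@cube d T R mu G).
Local Notation cube_at := (@cube_at d T R mu G).
Local Notation S := (@stopping_cubes d T R mu G).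
Local Notation Omega := (@superlevel d T R mu G).
Local Notation level := (@level d T R mu G).

Let mC (P : int * J) : measurable (cube P). Proof. exact: measurable_cube. Qed.

(** For [u = w ^ (1/a)] and [v = w ^ (- 1/b)] this is the A_{p,q} condition of
[w] on the cubes, with [a = 1/q] and [b = 1/p']. *)
Definition muckenhoupt (A a b : R) (u v : T -> R) :=
  (forall x, u x `^ a * v x `^ b = 1) /\
  forall P : int * J, cube P !=set0 -> avg u P `^ a * avg v P `^ b <= A.

Lemma muckenhoupt_sym A a b u v : muckenhoupt A a b u v -> muckenhoupt A b a v u.
Proof. by move=> [uv H]; split => [x|P P0]; rewrite mulrC ?uv//; exact: H. Qed.

Section decay.
Variables (A a b : R) (u v : T -> R).
Hypotheses (a0 : 0 < a) (b0 : 0 < b) (A1 : 1 <= A).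
Hypotheses (du : density G u) (dv : density G v) (Auv : muckenhoupt A a b u v).

Let mu_ : measurable_fun setT u. Proof. by case: du. Qed.
Let u0 x : 0 < u x. Proof. by case: du. Qed.
Let lu (P : int * J) : (\int[mu]_(x in cube P) (u x)%:E < +oo)%E. Proof. by case: du. Qed.
Let mv : measurable_fun setT v. Proof. by case: dv. Qed.
Let v0 x : 0 < v x. Proof. by case: dv. Qed.
Let lv (P : int * J) : (\int[mu]_(x in cube P) (v x)%:E < +oo)%E. Proof. by case: dv. Qed.
Let ab0 : 0 < a + b. Proof. exact: addr_gt0. Qed.

(** Hölder's inequality for the constant function [1 = u ^ a * v ^ b]. *)
Lemma measure_power_le E m U V : measurable E -> mu E = m%:E ->
  (\int[mu]_(x in E) (u x)%:E = U%:E)%E -> (\int[mu]_(x in E) (v x)%:E = V%:E)%E ->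
  m `^ (a + b) <= U `^ a * V `^ b.
Proof.
move=> mE Em EU EV.
have m0 : 0 <= m by rewrite -lee_fin -Em.
have muE := measurable_funS measurableT (@subsetT _ E) mu_.
have mvE := measurable_funS measurableT (@subsetT _ E) mv.
have [->|mn0] := eqVneq m 0.
  by rewrite powR0 ?gt_eqF// mulr_ge0 ?powR_ge0.
have pos (h : T -> R) (H : R) : measurable_fun E h -> (forall x, 0 < h x) ->
    (\int[mu]_(x in E) (h x)%:E = H%:E)%E -> 0 < H.
  move=> mh h0 EH; rewrite lt_neqAle eq_sym; apply/andP; split.
    apply/eqP => H0; have [] : mu E <> 0%E.
      by rewrite Em => -[] /eqP; rewrite (negbTE mn0).
    by apply: null_of_integral_eq0 mE mh _ _ => [x _|]; rewrite ?h0// EH H0.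
  by rewrite -lee_fin -EH; apply: integral_ge0 => x _; rewrite lee_fin ltW.
have U0 : 0 < U by exact: pos muE u0 EU.
have V0 : 0 < V by exact: pos mvE v0 EV.
pose th := a / (a + b); pose th' := b / (a + b).
have th0 : 0 < th by rewrite divr_gt0.
have th'0 : 0 < th' by rewrite divr_gt0.
have thD : th + th' = 1 by rewrite -mulrDl divff// gt_eqF.
pose K := U `^ th * V `^ th'.
have K0 : 0 <= K by rewrite mulr_ge0 ?powR_ge0.
have point x : 1 <= K * (th / U) * u x + K * (th' / V) * v x.
  have uv1 : u x `^ th * v x `^ th' = 1.
    rewrite /th /th' !powRrM -powRM ?powR_ge0//.
    by have [-> _] := Auv; rewrite powR1.
  have := @conjugate_powR _ ((u x / U) `^ th) ((v x / V) `^ th') th^-1 th'^-1.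
  rewrite !invr_gt0 !invrK => /(_ (powR_ge0 _ _) (powR_ge0 _ _) th0 th'0 thD).
  have uU0 : 0 <= u x / U by rewrite divr_ge0// ltW.
  have vV0 : 0 <= v x / V by rewrite divr_ge0// ltW.
  rewrite -!powRrM !divff ?gt_eqF// !powRr1// => young.
  have <- : K * ((u x / U) `^ th * (v x / V) `^ th') = 1.
    rewrite -uv1 /K mulrACA -!powRM ?(ltW U0) ?(ltW V0)//.
    by rewrite ![_ * (_ / _)]mulrC !divfK ?gt_eqF.
  apply: (le_trans (ler_wpM2l K0 young)).
  by rewrite le_eqVlt; apply/orP; left; apply/eqP; field; rewrite !gt_eqF.
have mK : m <= K.
  rewrite -lee_fin -Em; have -> : mu E = (\int[mu]_(x in E) 1)%E.
    by rewrite integral_cst// mul1e.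
  have Ku : 0 <= K * (th / U) by rewrite mulr_ge0// divr_ge0 ?ltW.
  have Kv : 0 <= K * (th' / V) by rewrite mulr_ge0// divr_ge0 ?ltW.
  apply: (@le_trans _ _ (\int[mu]_(x in E) ((K * (th / U) * u x)%:E +
      (K * (th' / V) * v x)%:E))%E).
    by apply: lower_integral_le => // x _; rewrite -EFinD lee_fin.
  rewrite ge0_integralD//.
  - rewrite !integral_scale//; [|by move=> x; exact: ltW..].
    rewrite EU EV -!EFinM -EFinD lee_fin le_eqVlt; apply/orP; left; apply/eqP.
    rewrite -[RHS]mulr1 -thD; field; rewrite !gt_eqF//.
  - by move=> x _; rewrite lee_fin mulr_ge0// ltW.
  - by apply/measurable_EFinP; exact: measurable_funM.
  - by move=> x _; rewrite lee_fin mulr_ge0// ltW.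
  - by apply/measurable_EFinP; exact: measurable_funM.
apply: (@le_trans _ _ (K `^ (a + b))).
  by rewrite ge0_ler_powR ?nnegrE// ltW.
by rewrite /K powRM ?powR_ge0// -!powRrM !divfK// gt_eqF.
Qed.

(** The rest [F] of the cube has at least half of its measure.  Hölder's
inequality on [F], against the Muckenhoupt bound on the cube, shows that [F]
carries a fixed proportion of [u]. *)
Lemma muckenhoupt_half_decay : exists kappa, [/\ 0 < kappa < 1 & half_decay G kappa u].
Proof.
have A0 : 0 < A by exact: lt_le_trans A1.
pose c := (2 `^ (a + b) * A)^-1.
have two1 : 1 < 2 `^ (a + b) :> R.
  have one : 1 `^ (a + b) = 1 :> R by rewrite powR1.
  by rewrite -[ltLHS]one gt0_ltr_powR// ?nnegrE// ltr1n.
have c01 : 0 < c < 1.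
  rewrite invr_gt0 mulr_gt0 ?powR_gt0//= invf_lt1 ?mulr_gt0 ?powR_gt0//.
  by rewrite (lt_le_trans two1)// ler_peMr// ltW// (lt_trans _ two1).
have /andP[c0 c1] := c01.
pose eta := c `^ a^-1.
have eta01 : 0 < eta < 1.
  rewrite powR_gt0//=.
  have one : 1 `^ a^-1 = 1 :> R by rewrite powR1.
  by rewrite -[ltRHS]one gt0_ltr_powR ?invr_gt0// ?nnegrE// ltW.
have /andP[eta0 eta1] := eta01.
have k0 : 0 < Num.sqrt (1 - eta) by rewrite sqrtr_gt0 subr_gt0.
have k2 : Num.sqrt (1 - eta) ^+ 2 = 1 - eta by rewrite sqr_sqrtr// subr_ge0 ltW.
exists (Num.sqrt (1 - eta)); split.
  rewrite k0/= -(@expr_lt1 _ 2)// ?k2 ?ltW//.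
  by rewrite ltrBlDr ltrDl.
move=> P E mE EP muE; rewrite k2.
have uE0 (B : set T) : (0 <= \int[mu]_(x in B) (u x)%:E)%E.
  by apply: integral_ge0 => x _; rewrite lee_fin ltW.
have vE0 (B : set T) : (0 <= \int[mu]_(x in B) (v x)%:E)%E.
  by apply: integral_ge0 => x _; rewrite lee_fin ltW.
have [PE|/set0P P0] := eqVneq (cube P) set0.
  have -> : E = set0 by rewrite -subset0 -PE.
  by rewrite integral_set0 mule_ge0// lee_fin subr_ge0 ltW.
pose F := cube P `\` E; have mF : measurable F by exact: measurableD.
have FP : F `<=` cube P by move=> x [].
have EF : E `|` F = cube P by rewrite setDUK.
have disj : [disjoint E & F] by rewrite disj_set2E setDIK.
have muE_ A' := @measurable_EFin_of _ _ _ u mu_ A'.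
have mvE_ A' := @measurable_EFin_of _ _ _ v mv A'.
have uEF : (\int[mu]_(x in cube P) (u x)%:E =
    \int[mu]_(x in E) (u x)%:E + \int[mu]_(x in F) (u x)%:E)%E.
  rewrite -EF ge0_integral_setU//.
  by move=> x _; rewrite lee_fin ltW.
have fin_sub (h : T -> R) (B : set T) : measurable B -> measurable_fun setT h ->
    (forall x, 0 < h x) -> (\int[mu]_(x in cube P) (h x)%:E < +oo)%E ->
    B `<=` cube P ->
    0 <= fine (\int[mu]_(x in B) (h x)%:E)%E <= mass h P /\
    (\int[mu]_(x in B) (h x)%:E = (fine (\int[mu]_(x in B) (h x)%:E))%:E)%E.
  move=> mB mh h0 hP BP.
  have hB0 : (0 <= \int[mu]_(x in B) (h x)%:E)%E.
    by apply: integral_ge0 => x _; rewrite lee_fin ltW.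
  have hBP : (\int[mu]_(x in B) (h x)%:E <= \int[mu]_(x in cube P) (h x)%:E)%E.
    apply: ge0_subset_integral => //; first exact: measurable_EFin_of.
    by move=> x _; rewrite lee_fin ltW.
  have hB : (\int[mu]_(x in B) (h x)%:E)%E \is a fin_num.
    by rewrite ge0_fin_numE// (le_lt_trans hBP).
  split; last by rewrite fineK.
  rewrite fine_ge0//= /mass fine_le// ge0_fin_numE//.
  by apply: integral_ge0 => x _; rewrite lee_fin ltW.
have [/andP[uF0 _] uFE] := fin_sub u F mF mu_ u0 (lu P) FP.
have [_ uEE] := fin_sub u E mE mu_ u0 (lu P) EP.
have [/andP[vF0 vFP] vFE] := fin_sub v F mF mv v0 (lv P) FP.
set uF := fine (\int[mu]_(x in F) (u x)%:E)%E in uF0 uFE.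
set vF := fine (\int[mu]_(x in F) (v x)%:E)%E in vF0 vFP vFE.
set uE := fine (\int[mu]_(x in E) (u x)%:E)%E in uEE.
have uPE : (\int[mu]_(x in cube P) (u x)%:E)%E = (mass u P)%:E.
  by apply: massE => // x; exact: ltW.
have uP0 : 0 < mass u P by apply: mass_gt0 => // x; exact: ltW.
have vP0 : 0 < mass v P by apply: mass_gt0 => // x; exact: ltW.
pose V := D ^ P.1; have V0 : 0 < V by exact: volume_gt0.
have muP : mu (cube P) = V%:E by exact: measure_cube.
have muEF : (mu E + mu F = V%:E)%E.
  by rewrite -muP -EF measureU//; apply/eqP; rewrite -disj_set2E.
have EV : (mu E <= (V / 2)%:E)%E by rewrite mulrC EFinM -muP.
have muEfin : mu E \is a fin_num.
  by rewrite ge0_fin_numE// (le_lt_trans EV)// ltry.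
have muFE : mu F = (V - fine (mu E))%:E.
  by rewrite EFinB fineK// -muEF addeAC subee// add0e.
have half : V / 2 <= V - fine (mu E).
  move: EV; rewrite -(fineK muEfin) lee_fin; lra.
have step1 := measure_power_le mF muFE uFE vFE.
have step2 : (V / 2) `^ (a + b) <= uF `^ a * mass v P `^ b.
  apply: (@le_trans _ _ ((V - fine (mu E)) `^ (a + b))).
    rewrite ge0_ler_powR ?nnegrE ?(ltW ab0)// ?divr_ge0 ?(ltW V0)//.
    by apply: le_trans half; rewrite divr_ge0// ltW.
  apply: (le_trans step1); apply: ler_wpM2l; first exact: powR_ge0.
  by rewrite ge0_ler_powR ?nnegrE// ltW.
have step3 : c * (mass u P `^ a * mass v P `^ b) <= (V / 2) `^ (a + b).
  have Vi0 : 0 <= V^-1 by rewrite invr_ge0 ltW.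
  have [_ /(_ P P0)] := Auv; rewrite /avg -/V.
  rewrite (powRM _ (ltW uP0) Vi0) (powRM _ (ltW vP0) Vi0).
  rewrite mulrACA -powRD; last by rewrite invr_eq0 (gt_eqF V0) implybT.
  have -> : V^-1 `^ (a + b) = (V `^ (a + b))^-1.
    by rewrite -powR_inv1 ?ltW// -powRrM mulN1r powRN.
  rewrite ler_pdivrMr ?powR_gt0// => AV.
  rewrite powRM ?(ltW V0)// (_ : 2^-1 `^ (a + b) = (2 `^ (a + b))^-1); last first.
    by rewrite -powR_inv1// -powRrM mulN1r powRN.
  rewrite /c invfM -mulrA mulrC; apply: ler_wpM2r.
    by rewrite invr_ge0 powR_ge0.
  by rewrite ler_pdivrMl.
have step4 : c * mass u P `^ a <= uF `^ a.
  rewrite -(ler_pM2r (powR_gt0 b vP0)) -mulrA.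
  exact: le_trans step3 step2.
have step5 : eta * mass u P <= uF.
  have -> : uF = (uF `^ a) `^ a^-1 by rewrite -powRrM divff ?gt_eqF// powRr1.
  have {1}-> : mass u P = (mass u P `^ a) `^ a^-1.
    by rewrite -powRrM divff ?gt_eqF// powRr1// ltW.
  rewrite /eta -(powRM _ (ltW c0) (powR_ge0 _ _)); apply: ge0_ler_powR.
  - by rewrite invr_ge0 ltW.
  - by rewrite nnegrE mulr_ge0 ?powR_ge0// ltW.
  - by rewrite nnegrE powR_ge0.
  - exact: step4.
move: uEF; rewrite uPE uEE uFE -EFinM -EFinD => -[uEF].
by rewrite lee_fin mulrBl mul1r lerBrDr [leRHS]uEF lerD2l.
Qed.

End decay.

Section reverse_hoelder.
Variables (kappa : R) (v : T -> R).
Hypotheses (k01 : 0 < kappa < 1) (dv : density G v) (hv : half_decay G kappa v).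

Let k0 : 0 < kappa. Proof. by case/andP: k01. Qed.
Let k1 : kappa < 1. Proof. by case/andP: k01. Qed.
Let D_gt1 : 1 < D. Proof. exact: dg_ratio_gt1. Qed.
Let D_gt0 : 0 < D. Proof. exact: lt_trans D_gt1. Qed.
Let mv : measurable_fun setT v. Proof. by case: dv. Qed.
Let v0 x : 0 < v x. Proof. by case: dv. Qed.
Let lv (P : int * J) : (\int[mu]_(x in cube P) (v x)%:E < +oo)%E. Proof. by case: dv. Qed.
Let mvE A : measurable_fun A (fun x => (v x)%:E).
Proof. exact: measurable_EFin_of. Qed.

(** The exponent for which the levels grow exactly as fast as the layers. *)
Definition layer_exponent : R := - ln kappa / ln (2 * D).

Let lnD : 0 < ln (2 * D).
Proof. by rewrite ln_gt0//; move: D_gt1; lra. Qed.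

Lemma layer_exponent_gt0 : 0 < layer_exponent.
Proof. by rewrite divr_gt0// oppr_gt0 ln_lt0. Qed.

Let e0 := layer_exponent.

Let level_exponent (n : nat) : level n%:Z `^ e0 = kappa^-1 ^+ n.
Proof.
have -> : level n%:Z = (2 * D) ^+ n by [].
have D20 : 0 < 2 * D by rewrite mulr_gt0.
rewrite -powR_mulrn ?ltW// -powRrM (mulrC n%:R) powRrM.
suff -> : (2 * D) `^ e0 = kappa^-1 by rewrite powR_mulrn// invr_ge0 ltW.
rewrite /powR (gt_eqF D20) /e0 /layer_exponent divfK ?gt_eqF//.
by rewrite expRN lnK// posrE.
Qed.

Section one_cube.
Variable P0 : int * J.
Hypothesis P0n : cube P0 !=set0.

Let c := avg v P0.
Let mv0 : 0 < mass v P0. Proof. by apply: mass_gt0 => // x; exact: ltW. Qed.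
Let c0 : 0 < c. Proof. by rewrite divr_gt0// volume_gt0. Qed.

Let g (x : T) := c^-1 * (v x * \1_(cube P0) x).

Let mg : measurable_fun setT g.
Proof.
by apply: measurable_funM => //; apply: measurable_funM => //; exact: measurable_indic.
Qed.

Let vI0 x : 0 <= v x * \1_(cube P0) x.
Proof. by rewrite mulr_ge0// ltW. Qed.

Let g0 x : 0 <= g x.
Proof. by rewrite mulr_ge0// invr_ge0 ltW. Qed.

Let int_g (A : set T) : measurable A -> (\int[mu]_(x in A) (g x)%:E =
  (c^-1)%:E * \int[mu]_(x in A `&` cube P0) (v x)%:E)%E.
Proof.
move=> mA; rewrite integral_scale// ?invr_ge0 ?(ltW c0)//; last first.
  apply: measurable_funM; first exact: measurable_funS mv.
  exact: measurable_indic.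
rewrite -ge0_integral_indic//; congr (_ * _)%E.
by apply: eq_integral => x _; rewrite EFinM muleC.
Qed.

Let g_le (A : set T) : measurable A ->
  (\int[mu]_(x in A) (g x)%:E <= (D ^ P0.1)%:E)%E.
Proof.
move=> mA; rewrite int_g//.
apply: (@le_trans _ _ ((c^-1)%:E * \int[mu]_(x in cube P0) (v x)%:E)%E).
  apply: lee_wpmul2l; first by rewrite lee_fin invr_ge0 ltW.
  apply: ge0_subset_integral => //; first exact: measurableI.
  by move=> x _; rewrite lee_fin ltW.
rewrite massE//; last by move=> x; exact: ltW.
by rewrite -EFinM lee_fin /c /avg invf_div divfK// gt_eqF.
Qed.

Let lg (P : int * J) : (\int[mu]_(x in cube P) (g x)%:E < +oo)%E.
Proof. by apply: (le_lt_trans (g_le (mC P))); rewrite ltry. Qed.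

Let mass_g_le (P : int * J) : mass g P <= D ^ P0.1.
Proof. by rewrite -lee_fin -massE//; exact: g_le. Qed.

Let sg : stoppable G g.
Proof.
split => // x e e_gt0; have [K HK] := exprz_unbounded (D ^ P0.1 / e) D_gt1.
exists K => k Kk; rewrite /avg ler_pdivrMr ?volume_gt0// mulrC.
by rewrite -ler_pdivrMr//; apply: le_trans (HK k Kk); rewrite ler_pM2r ?invr_gt0.
Qed.

Let stopping_in (P : int * J) : S g 0 P -> cube P `<=` cube P0.
Proof.
move=> [_ aP _]; rewrite /level expr0z in aP.
have [x [Px P0x]] : exists x, cube P x /\ cube P0 x.
  apply: contrapT => nex.
  have PP0 : cube P `&` cube P0 = set0.
    by rewrite -subset0 => x [Px P0x]; apply: nex; exists x.
  move: aP; rewrite ltNge => /negP; apply.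
  rewrite /avg (_ : mass g P = 0) ?mul0r//.
  by apply/eqP; rewrite -eqe -massE// int_g// PP0 integral_set0 mule0.
apply: cube_nested Px P0x _; rewrite leNgt; apply/negP => PP.
move: aP; rewrite ltNge => /negP; apply.
rewrite ler_pdivrMr ?volume_gt0// mul1r; apply: (le_trans (mass_g_le P)).
by rewrite ler_eXz2l// ltW.
Qed.

(** All the cubes stopped at level 0 lie in [P0], where [g] has average 1. *)
Let layers_mass : (\int[mu]_(x in cube P0) (layers G g kappa 0 x * (v x)%:E) <=
  (mass v P0 / (1 - kappa))%:E)%E.
Proof.
have mLv : measurable_fun setT (fun x => layers G g kappa 0 x * (v x)%:E)%E.
  by apply: emeasurable_funM => //; exact: measurable_layers.
have Lv0 x : (0 <= layers G g kappa 0 x * (v x)%:E)%E.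
  by rewrite mule_ge0 ?layers_ge0// lee_fin ltW.
have L0 x : ~ Omega g 0 x -> layers G g kappa 0 x = 0%E.
  move=> n0x; apply: eseries0 => j _ _; rewrite indicE memNset ?mulr0// => jx.
  by apply: n0x; apply: superlevel_le jx; rewrite add0r.
have mO := measurable_superlevel sg 0.
rewrite (_ : integral _ _ _ = \int[mu]_(x in cube P0 `&` Omega g 0)
    (layers G g kappa 0 x * (v x)%:E))%E; last first.
  rewrite integral_mkcondr; apply: eq_integral => x _; rewrite patchE.
  by case: ifPn => //; rewrite notin_setE => /L0 ->; rewrite mul0e.
have k10 : 0 <= (1 - kappa)^-1 by rewrite invr_ge0 subr_ge0 ltW.
rewrite (integral_stopping sg)//.
apply: (@le_trans _ _ (\esum_(P in S g 0) ((1 - kappa)^-1%:E *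
    \int[mu]_(x in cube P0 `&` cube P) (v x)%:E))%E).
  apply: le_esum => P iP; rewrite setIC.
  have /setIidPl -> := stopping_in iP.
  rewrite massE//; last by move=> x; exact: ltW.
  rewrite -EFinM mulrC; exact: integral_layers.
rewrite esumZl//; last first.
  by move=> P _; apply: integral_ge0 => x _; rewrite lee_fin ltW.
rewrite -(integral_stopping sg)//; last by move=> x; rewrite lee_fin ltW.
rewrite mulrC EFinM; apply: lee_wpmul2l; first by rewrite lee_fin.
rewrite -massE//; last by move=> x; exact: ltW.
apply: ge0_subset_integral => //; first exact: measurableI.
by move=> x _; rewrite lee_fin ltW.
Qed.

(** By differentiation [g] is at most the first level not reached at [x], and the
levels grow exactly as fast as the layers. *)
Let pointwise : {ae mu, forall x, cube P0 x ->
  (((v x / c) `^ e0)%:E <= 1 + (kappa^-1)%:E * layers G g kappa 0 x)%E}.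
Proof.
have ae_level (n : nat) : {ae mu, forall x, cube P0 x ->
    (forall k, avg g (cube_at k x) <= level n%:Z) -> g x <= level n%:Z}.
  by apply: ae_le_of_averages => //; exact: ltW (level_gt0 _ _).
have ae_levels : {ae mu, forall x, forall n : nat, cube P0 x ->
    (forall k, avg g (cube_at k x) <= level n%:Z) -> g x <= level n%:Z}.
  exact: ae_foralln.
have ae_fin : {ae mu, forall x, ~ (\bigcap_i Omega g i) x}.
  exists (\bigcap_i Omega g i); split.
  - rewrite -[X in measurable X]setCK setC_bigcap; apply: measurableC.
    apply: countable_bigcupT_measurable => // i; apply: measurableC.
    exact: measurable_superlevel.
  - exact: (null_all_levels sg k01 dv hv).
  - by move=> x /= /contrapT.
move: ae_fin ae_levels; apply: filterS2 => x nx levels P0x.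
have gE : g x = v x / c by rewrite /g indicE mem_set// mulr1 mulrC.
have e_gt0 : 0 < e0 := layer_exponent_gt0.
have nO n : ~ Omega g n%:Z x -> g x <= level n%:Z.
  move=> nOx; apply: levels => // k; rewrite leNgt; apply/negP => nk.
  by apply: nOx; exists k.
have vc0 : 0 <= v x / c by rewrite divr_ge0// ltW.
have kL0 : (0 <= (kappa^-1)%:E * layers G g kappa 0 x)%E.
  by rewrite mule_ge0 ?layers_ge0// lee_fin invr_ge0 ltW.
have [n nOx minn] : exists2 n : nat, ~ Omega g n%:Z x &
    forall m, (m < n)%N -> Omega g m%:Z x.
  have exn : exists n, `[< ~ Omega g n%:Z x >].
    move/existsNP: nx => [i /not_implyP[_ nix]]; exists `|i|%N; apply/asboolP.
    by apply: contra_not nix; apply: superlevel_le; exact: lez_abs.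
  have [n /asboolP nOx minn] := ex_minnP exn; exists n => // m mn.
  by apply: contrapT => nm; have := minn m (asboolT nm); rewrite leqNgt mn.
rewrite -gE; have {nOx} := nO _ nOx; case: n minn => [_|n minn] gn.
  have g1 : g x `^ e0 <= 1.
    have one : 1 `^ e0 = 1 :> R by rewrite powR1.
    by rewrite -[leRHS]one ge0_ler_powR ?nnegrE// ltW.
  by apply: (@le_trans _ _ 1%E); rewrite ?lee_fin// leeDl.
apply: (@le_trans _ _ ((kappa^-1 ^+ n.+1)%:E)).
  rewrite lee_fin -level_exponent ge0_ler_powR ?nnegrE ?(ltW e_gt0)//.
  exact: ltW (level_gt0 _ _).
apply: (@le_trans _ _ ((kappa^-1)%:E * layers G g kappa 0 x)%E); last by rewrite leeDr.
rewrite exprS EFinM; apply: lee_wpmul2l; first by rewrite lee_fin invr_ge0 ltW.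
have -> : (kappa^-1 ^+ n)%:E =
    (kappa^-1 ^+ n * \1_(Omega g (0 + n%:Z)) x)%:E :> \bar R.
  by rewrite indicE mem_set ?mulr1// add0r; exact: minn.
rewrite /layers nneseries_esumT; last first.
  by move=> j; rewrite lee_fin mulr_ge0// exprn_ge0// invr_ge0 ltW.
apply: (@le_esum_single _ _ setT (fun j : nat =>
  (kappa^-1 ^+ j * \1_(Omega g (0 + j%:Z)) x)%:E)) => //.
by rewrite lee_fin mulr_ge0// exprn_ge0// invr_ge0 ltW.
Qed.

(** For an exponent below [layer_exponent] it suffices to compare with 1 first,
which gives the additional term. *)
Lemma reverse_hoelder_cube (e : R) : 0 < e <= e0 ->
  (\int[mu]_(x in cube P0) (v x `^ (1 + e))%:E <=
   ((2 + kappa^-1 / (1 - kappa)) * c `^ e * mass v P0)%:E)%E.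
Proof.
move=> /andP[e_gt0 ee0].
have k10 : 0 < 1 - kappa by rewrite subr_gt0.
have mL A : measurable_fun A (layers G g kappa 0) by exact: measurable_layers.
apply: (@le_trans _ _ (\int[mu]_(x in cube P0) ((c `^ e)%:E * (2%:E * (v x)%:E +
   (kappa^-1)%:E * (layers G g kappa 0 x * (v x)%:E))))%E).
  apply: ae_lower_integral_le => //.
  - by move=> x _; rewrite lee_fin powR_ge0.
  - move=> x _; rewrite mule_ge0 ?lee_fin ?powR_ge0// adde_ge0//.
      by rewrite -EFinM lee_fin mulr_ge0// ltW.
    by rewrite !mule_ge0 ?layers_ge0// lee_fin ?invr_ge0 ltW.
  move: pointwise; apply: filterS => x H P0x; have {}H := H P0x.
  have vc0 : 0 <= v x / c by rewrite divr_ge0// ltW.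
  have ve : v x `^ (1 + e) = c `^ e * ((v x / c) `^ e * v x).
    rewrite powRD; last by rewrite (gt_eqF (v0 x)) implybT.
    rewrite powRr1 ?(ltW (v0 x))// mulrA -powRM ?(ltW c0)// mulrC.
    by congr (_ `^ _ * _); rewrite mulrC divfK// gt_eqF.
  rewrite ve EFinM; apply: lee_wpmul2l; first by rewrite lee_fin powR_ge0.
  have LE : (2%:E * (v x)%:E + kappa^-1%:E * (layers G g kappa 0 x * (v x)%:E) =
      (2%:E + kappa^-1%:E * layers G g kappa 0 x) * (v x)%:E)%E.
    by rewrite muleA [RHS]muleDl// ge0_adde_def// inE// mule_ge0 ?layers_ge0//
       lee_fin invr_ge0 ltW.
  rewrite LE [leLHS]EFinM; apply: lee_wpmul2r; first by rewrite lee_fin ltW.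
  apply: (@le_trans _ _ (1 + ((v x / c) `^ e0)%:E)%E); last first.
    by rewrite -[in leRHS](_ : 1 + 1 = 2 :> R)// EFinD -addeA leeD2l.
  rewrite -EFinD lee_fin; have [vc1|vc1] := leP (v x / c) 1.
    apply: ler_wpDr; first exact: powR_ge0.
    have one : 1 `^ e = 1 :> R by rewrite powR1.
    by rewrite -[leRHS]one ge0_ler_powR ?nnegrE// ltW.
  by apply: ler_wpDl => //; apply: ler_powR => //; exact: ltW.
have mLv : measurable_fun (cube P0) (fun x => layers G g kappa 0 x * (v x)%:E)%E.
  by apply: emeasurable_funM => //.
have Lv0 x : (0 <= layers G g kappa 0 x * (v x)%:E)%E.
  by rewrite mule_ge0 ?layers_ge0// lee_fin ltW.
have kLv0 x : (0 <= kappa^-1%:E * (layers G g kappa 0 x * (v x)%:E))%E.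
  by rewrite mule_ge0// lee_fin invr_ge0 ltW.
have v2 x : (0 <= 2%:E * (v x)%:E)%E by rewrite mule_ge0// lee_fin ltW.
have m2 : measurable_fun (cube P0) (fun x => 2%:E * (v x)%:E)%E.
  exact: measurable_funeM.
have mk : measurable_fun (cube P0)
    (fun x => kappa^-1%:E * (layers G g kappa 0 x * (v x)%:E))%E.
  exact: measurable_funeM.
rewrite ge0_integralZl//; last 3 first.
- exact: emeasurable_funD.
- by move=> x _; rewrite adde_ge0.
- by rewrite lee_fin powR_ge0.
rewrite ge0_integralD// ge0_integralZl//; last by move=> x _; rewrite lee_fin ltW.
rewrite ge0_integralZl//; last by rewrite lee_fin invr_ge0 ltW.
rewrite massE//; last by move=> x; exact: ltW.
apply: (@le_trans _ _ ((c `^ e)%:E * (2%:E * (mass v P0)%:E +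
    kappa^-1%:E * (mass v P0 / (1 - kappa))%:E))%E).
  apply: lee_wpmul2l; first by rewrite lee_fin powR_ge0.
  by apply: leeD2l; apply: lee_wpmul2l => //; rewrite lee_fin invr_ge0 ltW.
rewrite -[(2%:E * _)%E]EFinM -[(_^-1%:E * _)%E]EFinM -EFinD -EFinM lee_fin.
rewrite le_eqVlt; apply/orP; left; apply/eqP; field.
by rewrite !gt_eqF.
Qed.

End one_cube.
End reverse_hoelder.
End muckenhoupt.

(** * One-weight bounds on a dyadic grid *)

Section dyadic_weighted.
Context d (T : measurableType d) (R : realType).
Variables (mu : {measure set T -> \bar R}) (G : dyadic_grid mu).
Local Notation J := (dg_index G).
Local Notation D := (dg_ratio G).
Local Notation cube := (@cube d T R mu G).
Local Notation cube_at := (@cube_at d T R mu G).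

Let mC (P : int * J) : measurable (cube P). Proof. exact: measurable_cube. Qed.

Lemma half_decay_le (k k' : R) u : (forall x, 0 < u x) -> 0 <= k <= k' ->
  half_decay G k u -> half_decay G k' u.
Proof.
move=> u0 /andP[k0 kk'] hu P E mE EP muE; apply: (le_trans (hu P E mE EP muE)).
apply: lee_wpmul2r.
  by apply: integral_ge0 => x _; rewrite lee_fin ltW.
by rewrite lee_fin lerXn2r ?nnegrE// (le_trans k0).
Qed.

Lemma muckenhoupt_balanced (p q r A : R) u v : 0 < r -> r < p -> p < q -> 0 < A ->
  density G u -> density G v -> muckenhoupt G A q^-1 (r^-1 - p^-1) u v ->
  balanced G u v p q r (A `^ q).
Proof.
move=> r0 rp pq A0 [mu_ u0 lu] [mv v0 lv] [_ Auv] P P0.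
have p0 : 0 < p by exact: lt_trans rp.
have q0 : 0 < q by exact: lt_trans pq.
set V := D ^ P.1; have V0 : 0 < V by exact: volume_gt0.
have uV : mass u P = avg u P * V by rewrite /avg divfK// gt_eqF.
have vV : mass v P = avg v P * V by rewrite /avg divfK// gt_eqF.
have uP0 : 0 < avg u P.
  by rewrite divr_gt0 ?volume_gt0// mass_gt0// => x; exact: ltW.
have vP0 : 0 < avg v P.
  by rewrite divr_gt0 ?volume_gt0// mass_gt0// => x; exact: ltW.
have -> : frac G p q P.1 `^ q = V `^ (q / p) / V.
  rewrite /frac -powRrM -/V.
  have -> : (p^-1 - q^-1) * q = q / p - 1 by field; rewrite !gt_eqF.
  by rewrite powRB ?powRr1 ?(ltW V0)// (gt_eqF V0) implybT.
rewrite uV vV powRM ?(ltW V0) ?(ltW vP0)//.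
have -> : avg v P `^ (q / r) = (avg v P `^ (r^-1 - p^-1)) `^ q * avg v P `^ (q / p).
  rewrite -powRrM -powRD; last by rewrite (gt_eqF vP0) implybT.
  by congr (_ `^ _); field; rewrite !gt_eqF.
have {1}-> : avg u P = (avg u P `^ q^-1) `^ q.
  by rewrite -powRrM mulVf ?gt_eqF// powRr1// ltW.
have := Auv P P0; set x := avg u P `^ q^-1; set y := avg v P `^ (r^-1 - p^-1) => xy.
have {}xy : x `^ q * y `^ q <= A `^ q.
  rewrite -powRM ?powR_ge0// ge0_ler_powR ?nnegrE ?mulr_ge0 ?powR_ge0 ?(ltW q0) ?(ltW A0)//.
set z := avg v P `^ (q / p); set W := V `^ (q / p).
have cancel (c1 c2 c3 c4 c5 : R) : c2 != 0 ->
    c1 / c2 * (c3 * c4) * (c5 * c2) = c5 * c3 * (c4 * c1).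
  by move=> ?; field.
rewrite cancel ?gt_eqF//.
by apply: ler_wpM2r => //; rewrite mulr_ge0 ?powR_ge0.
Qed.

Variables (w : T -> R) (p q beta A : R).
Hypotheses (mw : measurable_fun setT w) (w0 : forall x, 0 < w x).
Hypotheses (beta0 : 0 < beta) (betap : beta < p) (pq : p < q).

Let b := beta^-1 - p^-1.
Let u x := w x `^ q.
Let v x := w x `^ (- b^-1).

Hypothesis lu : forall P : int * J, (\int[mu]_(x in cube P) (u x)%:E < +oo)%E.
Hypothesis lv : forall P : int * J, (\int[mu]_(x in cube P) (v x)%:E < +oo)%E.
Hypothesis Auv : forall P : int * J, cube P !=set0 ->
  avg u P `^ q^-1 * avg v P `^ b <= A.

Let p0 : 0 < p. Proof. exact: lt_trans betap. Qed.
Let q0 : 0 < q. Proof. exact: lt_trans pq. Qed.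
Let b0 : 0 < b. Proof. by rewrite subr_gt0 ltf_pV2. Qed.
Let du : density G u.
Proof.
by split => // [|x]; [exact: measurable_fun_powR|exact: powR_gt0].
Qed.
Let dv : density G v.
Proof.
by split => // [|x]; [exact: measurable_fun_powR|exact: powR_gt0].
Qed.

Let A' := Num.max A 1.
Let A'1 : 1 <= A'. Proof. by rewrite le_max lexx orbT. Qed.

Let uv : muckenhoupt G A' q^-1 b u v.
Proof.
split => [x|P P0]; last by rewrite le_max Auv.
rewrite /u /v -!powRrM divff ?gt_eqF// mulNr mulVf ?gt_eqF//.
by rewrite powRN !powRr1 ?ltW// divff// gt_eqF.
Qed.

(** The reverse Hölder inequality for the negative power of the weight improves
the exponent [beta] to some [r0 > beta].  Every [r] below [r0] is allowed, so that
several grids can share the same [r]. *)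
Theorem dyadic_weighted : exists r0, [/\ beta < r0, r0 < p &
  forall r, beta < r <= r0 -> exists2 C : R, 0 < C &
  forall f : T -> R, measurable_fun setT f ->
  (\int[mu]_x (`|f x| `^ p * w x `^ p)%:E < +oo)%E ->
  (forall P : int * J, (\int[mu]_(x in cube P) (`|f x| `^ r)%:E < +oo)%E) /\
  (\int[mu]_x ((\esum_(k in [set: int])
      (frac G p q k * avg (fun x => `|f x| `^ r) (cube_at k x) `^ r^-1)%:E) `^ q *
      (w x `^ q)%:E) <=
   C%:E * (\int[mu]_x (`|f x| `^ p * w x `^ p)%:E) `^ (q / p))%E].
Proof.
have qi0 : 0 < q^-1 by rewrite invr_gt0.
have [kv [kv01 hv]] := muckenhoupt_half_decay b0 qi0 A'1 dv du (muckenhoupt_sym uv).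
pose e0 := layer_exponent G kv.
have e00 : 0 < e0 by exact: layer_exponent_gt0.
have e01 : 0 < 1 + e0 by rewrite addr_gt0.
have be0 : 0 < b / (1 + e0) by rewrite divr_gt0.
have pi0 : 0 < p^-1 by rewrite invr_gt0.
(* The dual exponent of [v] may grow by the factor [1 + e0]. *)
pose r0 := (p^-1 + b / (1 + e0))^-1.
have r00 : 0 < r0 by rewrite invr_gt0 addr_gt0.
have br0 : beta < r0.
  rewrite -ltf_pV2 ?posrE// invrK -ltrBrDl ltr_pdivrMr// ltr_pMr//.
  by rewrite ltrDl.
exists r0; split => //; first by rewrite -ltf_pV2 ?posrE// invrK ltrDl.
move=> r /andP[br rr0]; have r_gt0 : 0 < r by exact: lt_trans br.
have rp : r < p.
  by apply: le_lt_trans rr0 _; rewrite -ltf_pV2 ?posrE// invrK ltrDl.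
pose b' := r^-1 - p^-1; have b'0 : 0 < b' by rewrite subr_gt0 ltf_pV2.
have b'b : b' < b by rewrite ltrD2r ltf_pV2.
pose e := b / b' - 1.
have e_gt0 : 0 < e by rewrite subr_gt0 ltr_pdivlMr// mul1r.
have ee0 : e <= e0.
  rewrite lerBlDl ler_pdivrMr// -ler_pdivrMl// mulrC.
  rewrite -[leLHS](addKr p^-1) addrC lerD2r.
  by rewrite -[leLHS]invrK lef_pV2 ?posrE// invr_gt0 addr_gt0.
have e1 : 1 + e = b / b' by rewrite /e addrC subrK.
pose v' x := v x `^ (1 + e).
pose K := 2 + kv^-1 / (1 - kv).
have /andP[kv0 kv1] := kv01.
have K0 : 0 < K by rewrite ltr_pwDl// divr_ge0 ?invr_ge0 ?subr_ge0 ?(ltW kv0) ?(ltW kv1).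
have rh (P : int * J) : cube P !=set0 -> (\int[mu]_(x in cube P) (v' x)%:E <=
    (K * avg v P `^ e * mass v P)%:E)%E.
  by move=> P0; apply: reverse_hoelder_cube => //; rewrite e_gt0.
have dv' : density G v'.
  split => [|x|P]; first by do 2 apply: measurable_fun_powR.
    by rewrite !powR_gt0.
  have [->|/set0P P0] := eqVneq (cube P) set0; first by rewrite integral_set0 ltry.
  by apply: (le_lt_trans (rh P P0)); rewrite ltry.
have v0 x : 0 < v x by exact: powR_gt0.
have uv' : muckenhoupt G (Num.max (A' * K `^ b') 1) q^-1 b' u v'.
  split => [x|P P0].
    rewrite /v' -powRrM e1 divfK ?gt_eqF//; exact: uv.1.
  have vP0 : 0 < avg v P.
    apply: divr_gt0; last exact: volume_gt0.
    by apply: mass_gt0 => //; [exact: measurable_fun_powR|move=> x; exact: ltW].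
  have [mv' v'0 lv'] := dv'.
  have vV : avg v' P <= K * avg v P `^ (1 + e).
    have avE : avg v P `^ (1 + e) = avg v P `^ e * avg v P.
      rewrite powRD; last by rewrite (gt_eqF vP0) implybT.
      by rewrite powRr1 ?(ltW vP0)// mulrC.
    have mE : mass v P = avg v P * D ^ P.1 by rewrite /avg divfK// gt_eqF// volume_gt0.
    rewrite avE {1}/avg ler_pdivrMr ?volume_gt0//.
    rewrite -lee_fin -massE//; last by move=> x; exact: ltW.
    by apply: (le_trans (rh P P0)); rewrite lee_fin mE [leLHS]mulrA [in leRHS]mulrA.
  rewrite le_max; apply/orP; left.
  apply: (@le_trans _ _ (avg u P `^ q^-1 * (K * avg v P `^ (1 + e)) `^ b')).
    apply: ler_wpM2l; first exact: powR_ge0.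
    rewrite ge0_ler_powR ?nnegrE ?(ltW b'0)//.
      by rewrite avg_ge0// => x; exact: ltW.
    by rewrite mulr_ge0 ?powR_ge0// ltW.
  rewrite (powRM _ (ltW K0) (powR_ge0 _ _)) -powRrM e1 divfK ?gt_eqF// mulrCA mulrC.
  by apply: ler_wpM2r; [exact: powR_ge0|exact: uv.2].
have A''1 : 1 <= Num.max (A' * K `^ b') 1 by rewrite le_max lexx orbT.
have [k1 [k101 hu1]] := muckenhoupt_half_decay qi0 b'0 A''1 du dv' uv'.
have [k2 [k201 hv2]] := muckenhoupt_half_decay b'0 qi0 A''1 dv' du (muckenhoupt_sym uv').
pose k := Num.max k1 k2.
have k01 : 0 < k < 1.
  by case/andP: k101 => k10 k11; case/andP: k201 => k20 k21; rewrite lt_max k10/= gt_max k11.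
have [_ u_gt0 _] := du; have [_ v'_gt0 _] := dv'.
have hu : half_decay G k u.
  by apply: half_decay_le hu1 => //; rewrite le_max lexx ltW//; case/andP: k101.
have hv' : half_decay G k v'.
  by apply: half_decay_le hv2 => //; rewrite le_max lexx orbT ltW//; case/andP: k201.
have A''0 : 0 < Num.max (A' * K `^ b') 1 by exact: lt_le_trans A''1.
have bal := muckenhoupt_balanced r_gt0 rp pq A''0 du dv' uv'.
have [C C0 HC] := dyadic_strong_type r_gt0 rp pq k01 du dv' hu hv' bal (powR_gt0 _ A''0).
exists C => // f mf ffin.
have dpE x : dual_power v' (p / r) (fun x => `|f x| `^ r) x = `|f x| `^ p * w x `^ p.
  rewrite /dual_power -powRrM mulrC [r * _]mulrC divfK ?gt_eqF// mulrC; congr (_ * _).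
  rewrite /v' /v -!powRrM e1; congr (_ `^ _).
  rewrite /b'; field; rewrite mulN1r subr_eq0 (gt_eqF r_gt0) (gt_eqF p0).
  by rewrite (gt_eqF b0) (gt_eqF rp).
have intE : (\int[mu]_x (`|f x| `^ p * w x `^ p)%:E =
    \int[mu]_x (dual_power v' (p / r) (fun x => `|f x| `^ r) x)%:E)%E.
  by apply: eq_integral => x _; rewrite dpE.
rewrite intE; apply: HC => //.
  by apply: measurable_fun_powR; exact: measurableT_comp.
by rewrite -intE.
Qed.

End dyadic_weighted.

(** * Lebesgue measure on R^n *)

Section lebesgue_measure_row.
Context (R : realType).
Local Notation "''mu_' n" := (lebesgue_rV R n) (at level 0, n at level 0).

Lemma rV_cons0 n (p : measurableTypeR R * 'rV[R]_n) : rV_cons p ord0 ord0 = p.1.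
Proof.
rewrite /rV_cons (_ : ord0 = lshift n ord0 :> 'I_(1 + n)); last exact/val_inj.
by rewrite (@row_mxEl _ 1 1 n) mxE eqxx mulr1n.
Qed.

Lemma rV_consS n (p : measurableTypeR R * 'rV[R]_n) i :
  rV_cons p ord0 (lift ord0 i) = p.2 ord0 i.
Proof.
rewrite /rV_cons (_ : lift ord0 i = rshift 1 i :> 'I_(1 + n)); last exact/val_inj.
by rewrite (@row_mxEr _ 1 1 n).
Qed.

Definition box n (a b : 'I_n -> R) : set 'rV[R]_n :=
  [set x | forall i, a i <= x ord0 i < b i].

Lemma measurable_box n (a b : 'I_n -> R) : measurable (box a b).
Proof.
rewrite (_ : box a b = \bigcap_(i in [set: 'I_n])
   ((fun x : 'rV[R]_n => x ord0 i : measurableTypeR R) @^-1` `[a i, b i[)).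
  apply: fin_bigcap_measurable; first exact: finite_finset.
  by move=> i _; rewrite -[X in measurable X]setTI; apply: measurable_coord.
apply/seteqP; split => [x H i _ /=|x H i]; first by rewrite in_itv/=; exact: H.
by have := H i Logic.I; rewrite /= in_itv.
Qed.

Lemma lebesgue_box n (a b : 'I_n -> R) : (forall i, a i <= b i) ->
  'mu_n (box a b) = (\prod_i (b i - a i))%:E.
Proof.
elim: n a b => [|n IH] a b ab.
  rewrite big_ord0 (_ : box a b = setT).
    by rewrite /= diracT.
  by apply/seteqP; split => // x _ [].
transitivity ((@lebesgue_measure R \x 'mu_n)%E
    (`[a ord0, b ord0[%classic `*` box (fun i => a (lift ord0 i)) (fun i => b (lift ord0 i)))).
  rewrite -[LHS]/((@lebesgue_measure R \x 'mu_n)%E (@rV_cons R n @^-1` box a b)).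
  congr ((@lebesgue_measure R \x 'mu_n)%E _).
  apply/seteqP; split => [p H|p [p1 p2] i].
    split; first by have := H ord0; rewrite rV_cons0 /= in_itv.
    by move=> i; have := H (lift ord0 i); rewrite rV_consS.
  have [j ->|->] := unliftP ord0 i; first by rewrite rV_consS; exact: p2.
  by rewrite rV_cons0; move: p1; rewrite /= in_itv.
rewrite product_measure1E//; last exact: measurable_box.
rewrite IH; last by move=> i; exact: ab.
rewrite big_ord_recl EFinM; congr (_ * _)%E.
apply: etrans (lebesgue_measure_itv `[a ord0, b ord0[) _.
rewrite /= lte_fin; case: ltP => // ba.
by rewrite (_ : b ord0 - a ord0 = 0)//; apply/eqP; rewrite subr_eq0 eq_le ba ab.
Qed.

(** Both sides are integrals against measures that agree on intervals. *)
Lemma lebesgue_reflect1 (c : R) (f : R -> \bar R) : measurable_fun setT f ->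
  (forall x, (0 <= f x)%E) ->
  (\int[@lebesgue_measure R]_t f (c - t)%R = \int[@lebesgue_measure R]_t f t)%E.
Proof.
move=> mf f0; pose phi (t : measurableTypeR R) : measurableTypeR R := c - t.
have mphi : measurable_fun setT phi by exact: measurable_funB.
have := ge0_integral_pushforward mphi (@lebesgue_measure R) measurableT mf.
rewrite preimage_setT => <-//.
apply: eq_measure_integral => A mA _; apply/esym.
pose nu := pushforward (@lebesgue_measure R) phi.
apply: (lebesgue_measure_unique (mu := nu)) => // _ [[x y]] _ <-.
have E : phi @^-1` `]x, y]%classic = `[c - y, c - x[%classic.
  by apply/seteqP; split => t /=; rewrite !in_itv/= /phi => /andP[? ?];
    apply/andP; split; lra.
apply: etrans (lebesgue_measure_itv `]x, y]) _; apply: esym.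
apply: etrans (congr1 (@lebesgue_measure R) E) _.
apply: etrans (lebesgue_measure_itv `[(c - y), (c - x)[) _.
rewrite /= !lte_fin ltrD2l ltrN2; case: ifP => // _.
by rewrite -!EFinB; congr EFin; lra.
Qed.

Lemma measurable_reflect n (x : 'rV[R]_n) :
  measurable_fun setT (fun y : 'rV[R]_n => x - y).
Proof.
apply/measurable_fun_rVP => i.
rewrite (_ : (fun _ => _) = (fun y : 'rV[R]_n => x ord0 i - y ord0 i)).
  by apply: measurable_funB => //; exact: measurable_coord.
by apply/funext => y; rewrite !mxE.
Qed.

(** One coordinate at a time, by Tonelli. *)
Lemma lebesgue_reflect n (x : 'rV[R]_n) (f : 'rV[R]_n -> \bar R) :
  measurable_fun setT f -> (forall y, (0 <= f y)%E) ->
  (\int['mu_n]_y f (x - y)%R = \int['mu_n]_y f y)%E.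
Proof.
elim: n x f => [|n IH] x f mf f0.
  by apply: eq_integral => y _; congr f; apply/rowP => -[].
have step (h : 'rV[R]_n.+1 -> \bar R) : measurable_fun setT h ->
    (forall y, (0 <= h y)%E) -> (\int['mu_(n.+1)]_y h y =
    \int[@lebesgue_measure R]_t \int['mu_n]_y h (rV_cons (t, y)))%E.
  move=> mh h0; have mc := @measurable_rV_cons R n.
  have := ge0_integral_pushforward mc (@lebesgue_measure R \x 'mu_n)%E
    measurableT mh (fun _ _ => h0 _).
  rewrite preimage_setT => /= E; rewrite [LHS]E fubini_tonelli1//.
  exact: measurableT_comp.
have mfx : measurable_fun setT (fun y : 'rV[R]_n.+1 => f (x - y)).
  by apply: (measurableT_comp mf); exact: measurable_reflect.
rewrite step// step//.
pose x' : 'rV[R]_n := \row_i x ord0 (lift ord0 i).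
pose H t := (\int['mu_n]_y f (rV_cons (t, y)))%E.
have mfc : measurable_fun setT (f \o @rV_cons R n).
  by apply: (measurableT_comp mf); exact: measurable_rV_cons.
transitivity (\int[@lebesgue_measure R]_t H (x ord0 ord0 - t)%R)%E.
  apply: eq_integral => t _.
  pose h (y : 'rV[R]_n) := f (rV_cons (x ord0 ord0 - t, y)).
  have mh : measurable_fun setT h.
    exact: (measurableT_comp mfc (pair1_measurable _)).
  have subE m (y z : 'rV[R]_m) i : (y - z) ord0 i = y ord0 i - z ord0 i.
    by rewrite !mxE.
  have h0 y : (0 <= h y)%E by exact: f0.
  rewrite /H -[RHS](IH x' h mh h0).
  apply: eq_integral => y _; congr f; apply/rowP => i; rewrite -[0]/(ord0 : 'I_1).
  have [j ->|->] := unliftP ord0 i; first by rewrite subE !rV_consS/= subE mxE.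
  by rewrite subE !rV_cons0.
apply: (@lebesgue_reflect1 (x ord0 ord0) H); last by move=> t; apply: integral_ge0 => y _; exact: f0.
exact: (@measurable_fun_fubini_tonelli_F _ _ _ _ _ 'mu_n _ mfc (fun _ => f0 _)).
Qed.

Lemma lebesgue_reflect_null n (x : 'rV[R]_n) (P : 'rV[R]_n -> Prop) :
  {ae 'mu_n, forall y, P y} -> {ae 'mu_n, forall y, P (x - y)}.
Proof.
move=> [N [mN N0 PN]].
have mN' : measurable [set y | N (x - y)].
  have := measurable_reflect x measurableT mN; rewrite setTI; exact.
exists [set y | N (x - y)]; split => //; last first.
  by move=> y /= nPy; exact: PN.
have mI : measurable_fun setT (fun y => (\1_N y)%:E : \bar R).
  by apply/measurable_EFinP; exact: measurable_indic.
have I0 y : (0 <= (\1_N y)%:E :> \bar R)%E by rewrite lee_fin.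
rewrite -N0 -[N in RHS]setIT -[X in _ X = _]setIT.
by rewrite -!integral_indic// -(lebesgue_reflect x mI I0).
Qed.

End lebesgue_measure_row.

(** * Euclidean balls and shifted dyadic grids *)

Section euclidean.
Context (R : realType) (n : nat).
Local Notation mu := (lebesgue_rV R n).
Implicit Types x y : 'rV[R]_n.

Lemma enorm_ge0 x : 0 <= enorm x. Proof. exact: sqrtr_ge0. Qed.

Lemma sqr_enorm x : enorm x ^+ 2 = \sum_i x ord0 i ^+ 2.
Proof. by rewrite sqr_sqrtr// sumr_ge0// => i _; exact: sqr_ge0. Qed.

Lemma coord_le_enorm x i : `|x ord0 i| <= enorm x.
Proof.
rewrite -(@ler_pXn2r _ 2)// ?nnegrE ?enorm_ge0// sqr_enorm real_normK ?num_real//.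
by rewrite (bigD1 i)//= lerDl sumr_ge0// => j _; exact: sqr_ge0.
Qed.

Lemma enorm_le_coord x h : 0 <= h -> (forall i, `|x ord0 i| <= h) ->
  enorm x <= n%:R * h.
Proof.
move=> h0 xh; have nh0 : 0 <= n%:R * h by rewrite mulr_ge0.
rewrite -(@ler_pXn2r _ 2)// ?nnegrE ?enorm_ge0// sqr_enorm.
apply: (@le_trans _ _ (\sum_(i < n) h ^+ 2)).
  apply: ler_sum => i _; rewrite -[leLHS]real_normK ?num_real//.
  by rewrite lerXn2r ?nnegrE.
rewrite sumr_const card_ord -[leLHS]mulr_natl exprMn; apply: ler_wpM2r.
  exact: sqr_ge0.
by rewrite -natrX ler_nat; case: n => // k; rewrite leq_pmulr.
Qed.

(** This serves as triangle inequality: all the distances below are compared with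
room to spare. *)
Lemma sqr_enormB_le x y :
  enorm (x - y) ^+ 2 <= 2 * enorm x ^+ 2 + 2 * enorm y ^+ 2.
Proof.
rewrite !sqr_enorm !mulr_sumr -big_split/=; apply: ler_sum => i _.
rewrite !mxE -subr_ge0 (_ : _ - _ = (x ord0 i + y ord0 i) ^+ 2); last by ring.
exact: sqr_ge0.
Qed.

Lemma enormN x : enorm (- x) = enorm x.
Proof.
by rewrite /enorm; congr Num.sqrt; apply: eq_bigr => i _; rewrite mxE sqrrN.
Qed.

Lemma sqr_enorm_le x y :
  enorm x ^+ 2 <= 2 * enorm (x - y) ^+ 2 + 2 * enorm y ^+ 2.
Proof.
have := sqr_enormB_le (x - y) (- y); rewrite opprK subrK.
by rewrite enormN.
Qed.

Lemma measurable_enorm : measurable_fun setT (@enorm R n).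
Proof.
apply: (@measurableT_comp _ _ _ _ _ _ (@Num.sqrt R)).
  exact: continuous_measurable_fun (@sqrt_continuous R).
by apply: measurable_sum => i; apply: measurable_funX; exact: measurable_coord.
Qed.

Lemma measurable_enorm_set (P : set R) : measurable P ->
  measurable [set x : 'rV[R]_n | P (enorm x)].
Proof. by move=> mP; have := measurable_enorm measurableT mP; rewrite setTI. Qed.

Lemma measurable_eball x r : measurable (eball x r).
Proof.
have := measurable_reflect x measurableT
  (measurable_enorm_set (measurable_itv `]-oo, r[)).
by rewrite setTI.
Qed.

Lemma measurable_annulus s : measurable (@annulus R n s).
Proof.
exact: (measurable_enorm_set (measurable_itv `]s, 2 * s])).
Qed.

Lemma eball_sub_box x r :
  eball x r `<=` box (fun i => x ord0 i - r) (fun i => x ord0 i + r).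
Proof.
move=> y xy i; have := le_lt_trans (coord_le_enorm (x - y) i) xy.
by rewrite !mxE ltr_norml => /andP[? ?]; apply/andP; split; lra.
Qed.

Lemma lebesgue_eball_le x r : 0 < r -> (mu (eball x r) <= ((2 * r) ^+ n)%:E)%E.
Proof.
move=> r0.
have -> : (2 * r) ^+ n = \prod_(i < n) ((x ord0 i + r) - (x ord0 i - r)).
  by rewrite -[LHS]iter_mulr_1 -big_const_ord; apply: eq_bigr => i _; ring.
rewrite -lebesgue_box; last by move=> i; lra.
apply: le_measure; rewrite ?inE; first exact: measurable_eball.
  exact: measurable_box.
exact: eball_sub_box.
Qed.

Lemma lebesgue_eball_ge x r : 0 < r ->
  (((2 * (r / n.+1%:R)) ^+ n)%:E <= mu (eball x r))%E.
Proof.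
move=> r0; set h := r / n.+1%:R; have h0 : 0 < h by rewrite divr_gt0.
have -> : (2 * h) ^+ n = \prod_(i < n) ((x ord0 i + h) - (x ord0 i - h)).
  by rewrite -[LHS]iter_mulr_1 -big_const_ord; apply: eq_bigr => i _; ring.
rewrite -lebesgue_box; last by move=> i; lra.
apply: le_measure; rewrite ?inE; [exact: measurable_box|exact: measurable_eball|].
move=> y xy; rewrite /eball/=.
apply: (@le_lt_trans _ _ (n%:R * h)).
  apply: enorm_le_coord => [|i]; first exact: ltW.
  by have /andP[? ?] := xy i; rewrite !mxE ler_norml; apply/andP; split; lra.
rewrite /h mulrCA gtr_pMr// ltr_pdivrMr// mul1r ltr_nat//.
Qed.

End euclidean.

Section floor.
Context (R : realType).

Lemma floor_half_eq (u u' : R) (e : int) : Num.floor u = Num.floor u' ->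
  Num.floor ((u + e%:~R) / 2) = Num.floor ((u' + e%:~R) / 2).
Proof.
move=> uu'.
have H (z z' : R) : Num.floor z = Num.floor z' ->
    Num.floor ((z + e%:~R) / 2) <= Num.floor ((z' + e%:~R) / 2).
  move=> zz'; set m := Num.floor ((z + e%:~R) / 2).
  have mz : m%:~R <= (z + e%:~R) / 2 by exact: floor_le.
  rewrite floor_ge_int.
  have : (2 * m - e <= Num.floor z)%R.
    by rewrite floor_ge_int intrB intrM; move: mz; lra.
  rewrite zz' floor_ge_int intrB intrM; lra.
by apply/eqP; rewrite eq_le !H.
Qed.

(** At a point too close to the endpoints of the unshifted unit intervals, the
intervals shifted by a third contain a neighbourhood of fixed size. *)
Lemma floor_shift_third (v s : R) : s = 1 \/ s = -1 -> exists b : bool,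
  forall v', `|v - v'| < 6^-1 ->
    Num.floor (v' - s * b%:R / 3) = Num.floor (v - s * b%:R / 3).
Proof.
move=> s1; set m := Num.floor v.
have /andP[mv vm] : m%:~R <= v < (m + 1)%:~R by exact: floor_itv.
have m1 : (m + 1)%:~R = m%:~R + 1 :> R by rewrite intrD.
have key (z : R) (j : int) : j%:~R + 6^-1 <= z <= j%:~R + 1 - 6^-1 ->
    forall z', `|z - z'| < 6^-1 -> Num.floor z' = Num.floor z.
  move=> /andP[jz zj] z'; rewrite ltr_norml => /andP[z1 z2].
  have fz : Num.floor z = j.
    by apply: floor_def; rewrite intrD; apply/andP; split; lra.
  by rewrite fz; apply: floor_def; rewrite intrD; apply/andP; split; lra.
have key' (b : bool) (j : int) :
    j%:~R + 6^-1 <= v - s * b%:R / 3 <= j%:~R + 1 - 6^-1 ->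
    forall v', `|v - v'| < 6^-1 ->
      Num.floor (v' - s * b%:R / 3) = Num.floor (v - s * b%:R / 3).
  move=> jv v' vv'; apply: (key _ _ jv).
  suff -> : v - s * b%:R / 3 - (v' - s * b%:R / 3) = v - v' by [].
  by ring.
have b1 : true%:R = 1 :> R by [].
have [lo|lo] := ltP v (m%:~R + 6^-1).
  exists true; case: s1 => sE.
    by apply: (key' _ (m - 1)); rewrite sE b1 intrB; apply/andP; split; lra.
  by apply: (key' _ m); rewrite sE b1; apply/andP; split; lra.
have [hi|hi] := leP v (m%:~R + 1 - 6^-1).
  by exists false; apply: (key' _ m); rewrite mulr0 mul0r subr0 lo hi.
exists true; case: s1 => sE.
  by apply: (key' _ m); rewrite sE b1; apply/andP; split; lra.
by apply: (key' _ (m + 1)); rewrite sE b1 intrD; apply/andP; split; lra.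
Qed.

Lemma exprN1z (k : int) : (-1 : R) ^ k = 1 \/ (-1 : R) ^ k = -1.
Proof.
case: k => k.
  by rewrite -exprnP -signr_odd; case: odd; [right; rewrite expr1|left].
rewrite NegzE -exprnN -signr_odd; case: odd; [right|left].
  by rewrite expr1 invrN1.
by rewrite expr0 invr1.
Qed.

End floor.

Section grid.
Context (R : realType) (n : nat) (n0 : (0 < n)%N).
Local Notation mu := (lebesgue_rV R n).
Variable t : {set 'I_n}.

(** The sign alternates with the generation: a third of the side of a cube is
congruent, modulo the side of its children, to minus a third of that side. *)
Definition offset (k : int) (i : 'I_n) : R := (-1) ^ k * (i \in t)%:R / 3.

Definition grid_idx (k : int) (x : 'rV[R]_n) : 'rV[int]_n :=
  \row_i Num.floor (x ord0 i / 2 ^ k - offset k i).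

Let pow2_gt0 (k : int) : 0 < (2 : R) ^ k. Proof. exact: exprz_gt0. Qed.

Lemma grid_cubeE (k : int) (j : 'rV[int]_n) : [set x | grid_idx k x = j] =
  box (fun i => 2 ^ k * ((j ord0 i)%:~R + offset k i))
      (fun i => 2 ^ k * ((j ord0 i)%:~R + 1 + offset k i)).
Proof.
apply/seteqP; split => [x /= <- i|x xj]; last first.
  apply/rowP => i; rewrite mxE; apply: floor_def.
  have /andP[] := xj i; rewrite -ler_pdivlMl// -ltr_pdivrMl// intrD mulrC.
  by move=> ? ?; apply/andP; split; lra.
rewrite -ler_pdivlMl// -ltr_pdivrMl// (mulrC _ (x _ _)) mxE.
have /andP[] := floor_itv (x ord0 i / 2 ^ k - offset k i); rewrite intrD.
by move=> ? ?; apply/andP; split; lra.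
Qed.

Lemma measurable_grid_cube k j : measurable [set x | grid_idx k x = j].
Proof. by rewrite grid_cubeE; exact: measurable_box. Qed.

Lemma grid_nested (k : int) x y : grid_idx k x = grid_idx k y ->
  grid_idx (k + 1) x = grid_idx (k + 1) y.
Proof.
move=> kxy; apply/rowP => i; rewrite !mxE.
have : Num.floor (x ord0 i / 2 ^ k - offset k i) =
       Num.floor (y ord0 i / 2 ^ k - offset k i).
  by have := congr1 (fun z : 'rV[int]_n => z ord0 i) kxy; rewrite !mxE.
have [e eE] : exists e : int, e%:~R = (-1 : R) ^ k * (i \in t)%:R.
  case: (exprN1z R k) => ->.
    by exists (i \in t)%:R%:Z; rewrite mul1r; case: (i \in t).
  by exists (- (i \in t)%:R%:Z); rewrite mulN1r intrN; case: (i \in t).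
have step (z : R) : z / 2 ^ (k + 1) - offset (k + 1) i =
    ((z / 2 ^ k - offset k i) + e%:~R) / 2.
  rewrite /offset !expfzDr ?oppr_eq0 ?oner_eq0 ?pnatr_eq0// !expr1z eE.
  by field; rewrite gt_eqF.
by rewrite !step; exact: floor_half_eq.
Qed.

Lemma grid_measure k x :
  mu [set y | grid_idx k y = grid_idx k x] = ((2 ^+ n) ^ k)%:E.
Proof.
rewrite grid_cubeE lebesgue_box; last first.
  by move=> i; rewrite ler_wpM2l ?(ltW (pow2_gt0 k))//; lra.
congr EFin; transitivity (\prod_(i < n) (2 : R) ^ k).
  by apply: eq_bigr => i _; ring.
by rewrite prodr_const card_ord !exprnP !exprz_exp mulrC.
Qed.

Lemma grid_coord_le k x y i : grid_idx k x = grid_idx k y ->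
  `|x ord0 i - y ord0 i| < 2 ^ k.
Proof.
move=> kxy; have xj : [set z | grid_idx k z = grid_idx k y] x by exact: kxy.
have yj : [set z | grid_idx k z = grid_idx k y] y by [].
move: xj yj; rewrite grid_cubeE => /(_ i)/andP[x1 x2] /(_ i)/andP[y1 y2].
rewrite ltr_norml; apply/andP; split; lra.
Qed.

Lemma grid_generate : @measurable _ 'rV[R]_n `<=`
  <<s [set A | exists k j, A = [set x | grid_idx k x = j]] >>.
Proof.
set C := [set A | _].
pose T' := g_sigma_algebraType C.
have mcoord i : measurable_fun (setT : set T')
    (fun x : T' => (x : 'rV[R]_n) ord0 i : measurableTypeR R).
  apply: (measurability _ (RGenInftyO.measurableE R)).
  move=> _ [_ [c ->] <-]; rewrite setTI.
  rewrite (_ : _ @^-1` _ = \bigcup_(P in [set P : int * 'rV[int]_n |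
      [set x : 'rV[R]_n | grid_idx P.1 x = P.2] `<=` [set x | x ord0 i < c]])
      [set x : 'rV[R]_n | grid_idx P.1 x = P.2]).
    rewrite bigcup_mkcond; apply: countable_bigcupT_measurable => // P.
    case: ifPn => _; last exact: measurable0.
    by apply: sub_sigma_algebra; exists P.1, P.2.
  apply/seteqP; split => [x|x [P H Px]]; last by rewrite /= in_itv/=; exact: H.
  rewrite /= in_itv/= => xc.
  have [K HK] := @exprz_unbounded R 2 (c - x ord0 i)^-1 (ltr1n _ 2).
  exists (- K, grid_idx (- K) x) => //= y yx /=.
  have := grid_coord_le i yx; rewrite ltr_norml => /andP[_ yxi].
  have : 2 ^ (- K) <= c - x ord0 i.
    rewrite -invr_expz -[leRHS]invrK lef_pV2 ?posrE ?invr_gt0 ?subr_gt0//.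
    exact: HK.
  lra.
apply: smallest_sub; first exact: smallest_sigma_algebra.
rewrite -bigcup_seq => A [i _ [B mB <-]].
by have := mcoord i measurableT B mB.
Qed.

Lemma pow2n_gt1 : 1 < (2 : R) ^+ n.
Proof. by rewrite exprn_egt1// ?ltr1n// -lt0n. Qed.

Definition shifted_grid : dyadic_grid mu :=
  @DyadicGrid _ _ R mu 'rV[int]_n grid_idx (2 ^+ n) pow2n_gt1
    measurable_grid_cube grid_nested grid_measure grid_generate.

End grid.

(** The one-third trick, in each coordinate separately: [t] collects the
coordinates in which the shift is needed. *)
Lemma shifted_grid_cover (R : realType) (n : nat) (k : int) (x : 'rV[R]_n) :
  exists t : {set 'I_n}, forall y : 'rV[R]_n,
    (forall i, `|x ord0 i - y ord0 i| < 2 ^ k / 6) ->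
    grid_idx t k y = grid_idx t k x.
Proof.
have p2 : 0 < (2 : R) ^ k by exact: exprz_gt0.
have H (i : 'I_n) := floor_shift_third (x ord0 i / 2 ^ k) (exprN1z R k).
have [b Hb] := choice H.
exists [set i | b i]%SET => y xy; apply/rowP => i; rewrite !mxE /offset inE.
apply: Hb; rewrite -mulrBl normrM (gtr0_norm (_ : 0 < (2 ^ k)^-1)) ?invr_gt0//.
by rewrite ltr_pdivrMr// mulrC.
Qed.

(** * Young functions *)

Section young_functions.
Context (R : realType).

Lemma young_mono (Phi : R -> R) s t : young Phi -> 0 <= s -> s <= t -> Phi s <= Phi t.
Proof.
case=> _ mono _ _ s0 st; apply: mono => //; rewrite in_itv/= andbT//.
exact: le_trans st.
Qed.

Lemma young_ge0 (Phi : R -> R) s : young Phi -> 0 <= s -> 0 <= Phi s.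
Proof. by move=> hPhi s0; have [<- _ _ _] := hPhi; exact: young_mono. Qed.

Lemma measurable_young d (T : measurableType d) (Phi : R -> R) (f : T -> R) A :
  young Phi -> (forall x, 0 <= f x) -> measurable_fun A f ->
  measurable_fun A (fun x => Phi (f x)).
Proof.
move=> hPhi f0 mf; have mP : measurable_fun setT (fun s : R => Phi (Num.max s 0)).
  apply: nondecreasing_measurable => // s t st; apply: young_mono => //.
    by rewrite le_max lexx orbT.
  by rewrite ge_max !le_max st lexx orbT.
rewrite (_ : (fun x => _) = (fun s : R => Phi (Num.max s 0)) \o f).
  exact: measurableT_comp.
by apply/funext => x /=; rewrite max_l.
Qed.

Variables (Phi Psi : R -> R).
Hypotheses (hPhi : young Phi) (yPsi : young Psi).

Lemma young_inequality s t :
  (forall t, 0 <= t -> young_complement Phi t = (Psi t)%:E) ->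
  0 <= s -> 0 <= t -> s * t <= Phi s + Psi t.
Proof.
move=> hPsi s0 t0; have := s0; rewrite le_eqVlt => /predU1P[<-|sp].
  by rewrite mul0r addr_ge0// young_ge0.
rewrite -lerBlDl -lee_fin -hPsi//; apply: ereal_sup_ubound.
by exists s.
Qed.

(** By monotonicity the integral of the condition over the interval from [s] to
[2 * s] bounds [Psi s]; with [rho] as here, the exponents combine to [r]. *)
Lemma class_B_growth (sigma r k : R) : 0 < k -> 0 < r -> 0 < 1 - r * sigma / k ->
  class_B (r / (1 - r * sigma / k))
    (fun t => Psi t `^ (1 + r / (1 - r * sigma / k) * sigma / k)) ->
  exists2 C, 0 <= C & forall t, 0 <= t -> Psi t <= C * (1 + t `^ r).
Proof.
move=> k0 r0 den; set rho := r / (1 - r * sigma / k).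
have rho0 : 0 < rho by rewrite divr_gt0.
have -> : 1 + rho * sigma / k = rho / r.
  have rs : r * sigma / k = 1 - (1 - r * sigma / k) by ring.
  have -> : rho * sigma / k = r * sigma / k / (1 - r * sigma / k) by rewrite /rho; ring.
  rewrite {1}rs /rho; move: (1 - r * sigma / k) den => e e0.
  by field; rewrite (gt_eqF e0) (gt_eqF r0).
have rr0 : 0 < rho / r by rewrite divr_gt0.
move=> [c [c0 Iy]]; set I := (\int[_]_(t in _) _)%E in Iy.
have term0 (t : R) : 0 < t -> 0 <= Psi t `^ (rho / r) / t `^ rho / t.
  by move=> t0; rewrite !divr_ge0 ?powR_ge0// ltW.
have I0 : (0 <= I)%E.
  apply: integral_ge0 => t; rewrite /= in_itv/= andbT => ct; rewrite lee_fin term0//.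
  exact: lt_le_trans ct.
pose J := fine I; have IE : I = J%:E by rewrite fineK// ge0_fin_numE.
have J0 : 0 <= J by rewrite fine_ge0.
have large s : c <= s -> Psi s `^ (rho / r) <= J * (2 * (2 * s) `^ rho).
  move=> cs; have s0 : 0 < s by exact: lt_le_trans cs.
  have P0 : 0 <= Psi s by apply: young_ge0 => //; exact: ltW.
  pose a := Psi s `^ (rho / r) / (2 * s) `^ rho / (2 * s).
  have s20 : 0 < 2 * s by rewrite mulr_gt0.
  have a0 : 0 <= a by rewrite !divr_ge0 ?powR_ge0// ltW.
  have : (a%:E * s%:E <= J%:E)%E.
    rewrite -IE; have cst_le : (a%:E * s%:E <=
        \int[@lebesgue_measure R]_(t in `[s, (2 * s)%R]) a%:E)%E.
      rewrite integral_cst//= lebesgue_measure_itv/= lte_fin ifT; last by lra.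
      by rewrite -EFinB -!EFinM lee_fin; apply: ler_wpM2l => //; lra.
    apply: (le_trans cst_le).
    rewrite integral_mkcond [leRHS]integral_mkcond; apply: lower_integral_le => //.
      by move=> t _; apply: erestrict_ge0.
    move=> t _; rewrite !patchE; case: ifPn => [/set_mem/=|_].
      rewrite in_itv/= => /andP[st t2s]; rewrite mem_set/=; last first.
        by rewrite /= in_itv/= andbT (le_trans cs).
      have t0 : 0 < t by exact: lt_le_trans st.
      rewrite lee_fin /a; apply: ler_pM => //.
      + by rewrite divr_ge0 ?powR_ge0.
      + by rewrite invr_ge0 ltW.
      + apply: ler_pM; rewrite ?invr_ge0 ?powR_ge0//.
          apply: ge0_ler_powR; rewrite ?nnegrE ?(ltW rr0)//.
            by apply: young_ge0 => //; exact: ltW.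
          by apply: young_mono => //; exact: ltW.
        rewrite lef_pV2 ?posrE ?powR_gt0//.
        by rewrite ge0_ler_powR ?nnegrE ?(ltW rho0) ?(ltW t0) ?(ltW s20).
      + by rewrite lef_pV2.
    case: ifPn => // /set_mem/=; rewrite in_itv/= andbT => ct.
    by rewrite lee_fin term0// (lt_le_trans c0).
  rewrite -EFinM lee_fin /a => H.
  have K0 : 0 < 2 * (2 * s) `^ rho by rewrite mulr_gt0 ?powR_gt0.
  rewrite -ler_pdivrMr//; apply: le_trans H.
  rewrite le_eqVlt; apply/orP; left; apply/eqP; field.
  by rewrite (gt_eqF s0) (gt_eqF (powR_gt0 _ s20)).
pose C1 := (2 * J) `^ (r / rho) * 2 `^ r.
have C10 : 0 <= C1 by rewrite mulr_ge0 ?powR_ge0.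
have Pc0 : 0 <= Psi c by apply: young_ge0 => //; exact: ltW.
exists (C1 + Psi c) => [|s s0]; first exact: addr_ge0.
have [cs|sc] := leP c s; last first.
  have Psc : Psi s <= Psi c by apply: young_mono => //; exact: ltW.
  apply: (le_trans Psc); rewrite -[leLHS]mulr1; apply: ler_pM => //.
    by rewrite lerDr.
  by rewrite lerDl powR_ge0.
have P0 : 0 <= Psi s by exact: young_ge0.
have {large} := large s cs.
have s20 : 0 <= 2 * s by rewrite mulr_ge0.
have -> : J * (2 * (2 * s) `^ rho) = 2 * J * (2 * s) `^ rho by ring.
move=> H; have rq0 : 0 <= r / rho by rewrite divr_ge0 ?ltW.
have {H} := ge0_ler_powR rq0 _ _ H.
rewrite !nnegrE powR_ge0 !mulr_ge0 ?powR_ge0// => /(_ isT isT).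
rewrite -powRrM powRM ?mulr_ge0 ?powR_ge0// -powRrM.
have -> : rho / r * (r / rho) = 1 by field; rewrite (gt_eqF r0) (gt_eqF rho0).
have -> : rho * (r / rho) = r by field; rewrite (gt_eqF rho0).
rewrite powRr1// (powRM _ _ s0)// mulrA -/C1 => H; apply: (le_trans H).
apply: ler_pM => //; first exact: powR_ge0.
  by rewrite lerDl.
by rewrite lerDr.
Qed.

End young_functions.

(** * The kernel on dyadic rings *)

Section kernel_ring.
Context (R : realType) (n : nat).
Local Notation mu := (lebesgue_rV R n).
Local Notation ring s := [set z : 'rV[R]_n | s < enorm z < 2 * s].
Variables (alpha r CP : R) (K Kt : 'rV[R]_n -> R) (Phi Psi : R -> R).
Hypotheses (mKt : measurable_fun setT Kt) (KE : {ae mu, forall x, K x = Kt x}).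
Hypotheses (hPhi : young Phi) (yPsi : young Psi).
Hypothesis hPsi : forall t, 0 <= t -> young_complement Phi t = (Psi t)%:E.
Hypotheses (r1 : 1 <= r) (CP0 : 0 <= CP).
Hypothesis growth : forall t, 0 <= t -> Psi t <= CP * (1 + t `^ r).

Lemma ae_translate (v : 'rV[R]_n) (P : 'rV[R]_n -> Prop) :
  {ae mu, forall x, P x} -> {ae mu, forall x, P (x - v)}.
Proof.
move=> aP; have H0 := lebesgue_reflect_null 0 aP.
have H1 := lebesgue_reflect_null v (P := fun y => P (0 - y)) H0.
by apply: filterS H1 => y; rewrite sub0r opprB.
Qed.

Lemma measurable_ring s : measurable (ring s).
Proof.
have -> : ring s = [set z | `]s, (2 * s)[%classic (enorm z)].
  by apply/seteqP; split => z /=; rewrite in_itv.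
exact: (measurable_enorm_set (measurable_itv `]s, 2 * s[)).
Qed.

Lemma measurable_translate (v : 'rV[R]_n) :
  measurable_fun setT (fun z : 'rV[R]_n => z - v).
Proof.
apply/measurable_fun_rVP => i.
rewrite (_ : (fun y : 'rV[R]_n => _) = (fun y : 'rV[R]_n => y ord0 i - v ord0 i)).
  by apply: measurable_funB => //; exact: measurable_coord.
by apply/funext => y; rewrite !mxE.
Qed.

Lemma ring_sub_eball s : ring s `<=` eball 0 (2 * s).
Proof. by move=> z /= /andP[_ z2]; rewrite /eball/= sub0r enormN. Qed.

Lemma ring_sub_annulus s : ring s `<=` annulus s.
Proof. by move=> z /= /andP[z1 z2]; rewrite /annulus/= z1 ltW. Qed.

Lemma annulus_integral_kernel s C :
  (\int[mu]_(x in annulus s) `|K x|%:E <= C)%E ->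
  (\int[mu]_(x in annulus s) `|Kt x|%:E <= C)%E.
Proof.
apply: le_trans; apply: ae_lower_integral_le; first exact: measurable_annulus.
- by move=> x _; rewrite lee_fin.
- by move=> x _; rewrite lee_fin.
- by apply: filterS KE => x -> _.
Qed.

(** For such [v] the point [z - v] stays in three consecutive annuli. *)
Lemma ring_translate_integral : cond_S alpha K -> 0 <= alpha ->
  exists2 A, 0 < A & forall s rho z, 0 < s -> rho <= s / 4 -> ring s z ->
    (\int[mu]_(v in eball (0 : 'rV[R]_n) rho) `|Kt (z - v)%R|%:E <= (A * s `^ alpha)%:E)%E.
Proof.
move=> [C [C0 HC]] a0; exists (3 * (C * 2 `^ alpha)).
  by rewrite !mulr_gt0// powR_gt0.
move=> s rho z s0 rhos /= /andP[sz zs].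
have mann : measurable (annulus (s / 2) `|` annulus s `|` @annulus R n (2 * s)).
  by apply: measurableU; [apply: measurableU|]; exact: measurable_annulus.
have mf : measurable_fun setT (fun x : 'rV[R]_n => `|Kt x|%:E).
  by apply/measurable_EFinP; exact: measurableT_comp.
apply: (@le_trans _ _ (\int[mu]_(u in annulus (s / 2) `|` annulus s `|` annulus (2 * s)) `|Kt u|%:E)%E).
  rewrite integral_mkcond [leRHS]integral_mkcond.
  rewrite -[leRHS](lebesgue_reflect z); last first.
  - by move=> y; apply: erestrict_ge0 => x _; rewrite lee_fin.
  - apply/(measurable_restrictT _ _).1 => //; exact: measurable_funTS.
  apply: lower_integral_le => //.
    by move=> v _; apply: erestrict_ge0 => x _; rewrite lee_fin.
  move=> v _; rewrite !patchE; case: ifPn => [/set_mem|_]; last first.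
    by case: ifPn => // _; rewrite lee_fin.
  rewrite /eball/= sub0r enormN => vr.
  rewrite mem_set// /annulus /=.
  have v0 := enorm_ge0 v; have e0 := enorm_ge0 (z - v).
  have h1 := sqr_enorm_le z v; have h2 := sqr_enormB_le z v.
  have vs : enorm v ^+ 2 <= (s / 4) ^+ 2.
    by rewrite lerXn2r ?nnegrE//; lra.
  have z0 : s ^+ 2 < enorm z ^+ 2 by rewrite ltrXn2r ?nnegrE//; lra.
  have z2 : enorm z ^+ 2 < (2 * s) ^+ 2 by rewrite ltrXn2r ?nnegrE//; lra.
  have ss : 0 < s ^+ 2 by rewrite exprn_gt0.
  have lo : s / 2 < enorm (z - v).
    rewrite -(@ltr_pXn2r _ 2)// ?nnegrE//; last by lra.
    move: vs z0 h1; rewrite !expr_div_n; lra.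
  have hi : enorm (z - v) <= 4 * s.
    rewrite -(@ler_pXn2r _ 2)// ?nnegrE//; last by lra.
    move: vs z2 h2; rewrite !expr_div_n !exprMn; lra.
  have [c1|c1] := leP (enorm (z - v)) s.
    by left; left; apply/andP; split => //; lra.
  have [c2|c2] := leP (enorm (z - v)) (2 * s).
    by left; right; apply/andP; split.
  by right; apply/andP; split => //; lra.
have pw t : 0 < t -> t <= 2 * s -> (\int[mu]_(x in annulus t) `|Kt x|%:E
     <= (C * 2 `^ alpha * s `^ alpha)%:E)%E.
  move=> t0 ts; apply: annulus_integral_kernel; apply: (le_trans (HC _ t0)).
  rewrite lee_fin -mulrA ler_pM2l// -powRM ?(ltW s0)//.
  by rewrite ge0_ler_powR ?nnegrE ?mulr_ge0 ?(ltW s0) ?(ltW t0).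
have cup (A B : set 'rV[R]_n) : measurable A -> measurable B ->
    (\int[mu]_(x in A `|` B) `|Kt x|%:E <=
     \int[mu]_(x in A) `|Kt x|%:E + \int[mu]_(x in B) `|Kt x|%:E)%E.
  move=> mA mB; rewrite integral_mkcond [X in (_ <= X + _)%E]integral_mkcond.
  rewrite [X in (_ <= _ + X)%E]integral_mkcond -ge0_integralD//.
  - apply: lower_integral_le => //.
      by move=> x _; apply: erestrict_ge0 => y _; rewrite lee_fin.
    move=> x _; rewrite !patchE in_setU; case: (x \in A) => /=.
      by rewrite leeDl//; case: ifPn.
    by rewrite add0e.
  - by move=> x _; apply: erestrict_ge0 => y _; rewrite lee_fin.
  - apply/(measurable_restrictT _ _).1 => //; exact: measurable_funTS.
  - by move=> x _; apply: erestrict_ge0 => y _; rewrite lee_fin.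
  - apply/(measurable_restrictT _ _).1 => //; exact: measurable_funTS.
apply: (le_trans (cup _ _ _ _)).
- by apply: measurableU; exact: measurable_annulus.
- exact: measurable_annulus.
rewrite (_ : 3 * _ * _ = C * 2 `^ alpha * s `^ alpha + C * 2 `^ alpha * s `^ alpha
  + C * 2 `^ alpha * s `^ alpha); last by ring.
rewrite !EFinD; apply: leeD; last by apply: pw => //; lra.
apply: (le_trans (cup _ _ _ _)); try exact: measurable_annulus.
by apply: leeD; apply: pw; lra.
Qed.

(** Already the first term of the series in the kernel condition controls the
oscillation on the ring, in Luxemburg norm; Young's inequality pairs it with
[h], since [Psi] grows at most like the power [r]. *)
Lemma ring_oscillation : cond_H alpha Phi K ->
  exists c A, [/\ 1 <= c, 0 < A & forall s v (h : 'rV[R]_n -> R),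
    0 < s -> c * enorm v < s / 2 -> measurable_fun setT h -> (forall x, 0 <= h x) ->
    (\int[mu]_(x in eball (0 : 'rV[R]_n) (2 * s)) (h x `^ r)%:E <= (s ^+ n)%:E)%E ->
    (\int[mu]_(z in ring s) (`|Kt (z - v)%R - Kt z| * h z)%:E <= (A * s `^ alpha)%:E)%E].
Proof.
move=> [c [CH [c1 CH0 HH]]].
exists c, (2 * CH * (4 ^+ n + CP * (4 ^+ n + 1))); split => //.
  by rewrite mulr_gt0 ?mulr_gt0// ltr_pwDl ?exprn_gt0// mulr_ge0// addr_ge0 ?exprn_ge0.
move=> s v h s0 vs mh h0 hint; set B := eball 0 (2 * s) in hint.
have mB : measurable B by exact: measurable_eball.
have muB : (mu B <= ((4 * s) ^+ n)%:E)%E.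
  have -> : 4 * s = 2 * (2 * s) by ring.
  by apply: lebesgue_eball_le; rewrite mulr_gt0.
have muB0 : (0 < mu B)%E.
  have s20 : 0 < 2 * s by rewrite mulr_gt0.
  apply: lt_le_trans (lebesgue_eball_ge 0 s20).
  by rewrite lte_fin exprn_gt0// mulr_gt0// divr_gt0.
pose V := fine (mu B); have VE : mu B = V%:E.
  by rewrite fineK// ge0_fin_numE ?measure_ge0// (le_lt_trans muB) ?ltry.
have V0 : 0 < V by rewrite -lte_fin -VE.
have V4 : V <= (4 * s) ^+ n by rewrite -lee_fin -VE.
pose g := fun x => (K (x - v) - K x) * \1_(@annulus R n s) x.
pose gt := fun x => (Kt (x - v) - Kt x) * \1_(@annulus R n s) x.
(* The infimum in the Luxemburg norm need not be attained: the factor 2 leaves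
   room for an admissible [l]. *)
have [l [l0 lL lint]] : exists l, [/\ 0 < l, l < 2 * CH * s `^ (alpha - n%:R) &
    (\int[mu]_(x in B) (Phi (`|g x| / l))%:E <= V%:E)%E].
  have lux0 j B' f : (0 <= ((2 ^+ j * (s / 2)) `^ (n%:R - alpha))%:E * @luxemburg R n Phi B' f)%E.
    apply: mule_ge0; first by rewrite lee_fin powR_ge0.
    by apply: le_ereal_inf_tmp => _ [l [l0 _] <-]; rewrite lee_fin ltW.
  have := HH v (s / 2) vs.
  move=> /(le_trans (nneseries_lim_ge 2 _)) H.
  have {H} := H (fun k _ _ => lux0 _ _ _).
  rewrite big_nat1 expr1 mulrCA mulfV// mulr1.
  rewrite (_ : 2 ^+ 2 * (s / 2) = 2 * s); last by field.
  rewrite -/B -/g; set lx := luxemburg _ _ _ => H.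
  have sa : 0 < s `^ (n%:R - alpha) by rewrite powR_gt0.
  have : (lx < (2 * CH * s `^ (alpha - n%:R))%:E)%E.
    rewrite -(opprB n%:R alpha) powRN (mulrC (2 * CH)) EFinM lte_pdivlMl//.
    by apply: (le_lt_trans H); rewrite lte_fin; lra.
  move=> /ereal_inf_lt[_ [l [l0 Hl] <-]]; rewrite lte_fin => lL.
  exists l; split => //; move: Hl; rewrite /mean -/B VE inver gt_eqF// lee_pdivrMl//.
  by rewrite mule1.
have intt : (\int[mu]_(x in B) (Phi (`|gt x| / l))%:E <= V%:E)%E.
  apply: le_trans lint; apply: ae_lower_integral_le => //.
  - by move=> x _; rewrite lee_fin young_ge0// divr_ge0// ltW.
  - by move=> x _; rewrite lee_fin young_ge0// divr_ge0// ltW.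
  by apply: filterS2 KE (ae_translate v KE) => x e1 e2 _; rewrite /g e1 e2.
have mgt : measurable_fun setT (fun x => `|gt x| / l).
  apply: measurable_funM => //; apply: measurableT_comp => //.
  apply: measurable_funM; last exact: measurable_indic (measurable_annulus s).
  apply: measurable_funB => //.
  exact: measurableT_comp mKt (measurable_translate v).
have mPhi : measurable_fun B (fun x => (Phi (`|gt x| / l))%:E).
  apply/measurable_EFinP; apply: measurable_funTS; apply: measurable_young => //.
  by move=> x; rewrite divr_ge0// ltW.
apply: (@le_trans _ _ (\int[mu]_(z in B) (l * (Phi (`|gt z| / l) + CP * (1 + h z `^ r)))%:E)%E).
  rewrite integral_mkcond [leRHS]integral_mkcond; apply: lower_integral_le => //.
    by move=> z _; apply: erestrict_ge0 => x _; rewrite lee_fin mulr_ge0.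
  move=> z _; rewrite !patchE; case: ifPn => [/set_mem zs|_]; last first.
    case: ifPn => // _; rewrite lee_fin.
    apply: mulr_ge0; first exact: ltW.
    apply: addr_ge0; first by rewrite young_ge0// divr_ge0// ltW.
    by apply: mulr_ge0 => //; rewrite addr_ge0// powR_ge0.
  rewrite mem_set; last exact: ring_sub_eball.
  rewrite lee_fin -ler_pdivrMl// mulrA (mulrC l^-1).
  have -> : `|Kt (z - v) - Kt z| = `|gt z|.
    by rewrite /gt indicE mem_set ?mulr1//; exact: ring_sub_annulus.
  apply: le_trans (young_inequality hPhi yPsi hPsi _ (h0 z)) _.
    by rewrite divr_ge0// ltW.
  by rewrite lerD2l growth.
under eq_integral do rewrite EFinM EFinD EFinM EFinD.
have hr0 z : (0 <= (h z `^ r)%:E)%E by rewrite lee_fin powR_ge0.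
have P0 z : (0 <= (Phi (`|gt z| / l))%:E)%E.
  by rewrite lee_fin young_ge0// divr_ge0// ltW.
have mhr : measurable_fun B (fun z => (h z `^ r)%:E).
  by apply/measurable_EFinP; apply: measurable_fun_powR; exact: measurable_funTS.
have m1h : measurable_fun B (fun z => (1%:E + (h z `^ r)%:E)%E).
  exact: emeasurable_funD.
have mCP : measurable_fun B (fun z => (CP%:E * (1%:E + (h z `^ r)%:E))%E).
  exact: emeasurable_funM.
rewrite ge0_integralZl//; last first.
- by rewrite lee_fin ltW.
- by move=> z _; rewrite adde_ge0// mule_ge0// adde_ge0.
- exact: emeasurable_funD.
rewrite ge0_integralD//; last by move=> z _; rewrite mule_ge0// adde_ge0.
rewrite ge0_integralZl//; last by move=> z _; rewrite adde_ge0.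
rewrite ge0_integralD//.
have -> : (\int[mu]_(z in B) 1 = V%:E)%E by rewrite integral_cst// mul1e.
have sn : s `^ (alpha - n%:R) * s ^+ n = s `^ alpha.
  by rewrite -powR_mulrn ?ltW// -powRD ?subrK// (gt_eqF s0) implybT.
apply: (@le_trans _ _ (l%:E * (((4 * s) ^+ n)%:E + CP%:E * (((4 * s) ^+ n)%:E + (s ^+ n)%:E)))%E).
  apply: lee_wpmul2l; first by rewrite lee_fin ltW.
  apply: leeD; first by apply: (le_trans intt); rewrite lee_fin.
  by apply: lee_wpmul2l => //; apply: leeD.
rewrite -!(EFinD, EFinM) lee_fin exprMn.
rewrite (_ : 4 ^+ n * s ^+ n + _ = (4 ^+ n + CP * (4 ^+ n + 1)) * s ^+ n); last by ring.
rewrite -sn.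
rewrite (_ : 2 * CH * _ * _ = 2 * CH * s `^ (alpha - n%:R) * ((4 ^+ n + CP * (4 ^+ n + 1)) * s ^+ n)); last by ring.
rewrite ler_wpM2r ?(ltW lL)// mulr_ge0 ?exprn_ge0 ?(ltW s0)// addr_ge0 ?exprn_ge0//.
by rewrite mulr_ge0// addr_ge0 ?exprn_ge0.
Qed.

(** Averaging over small translations [v]: the kernel at [z] differs from its
value at [z - v] by an oscillation, and [K (z - v)] is integrable in [v]
uniformly in [z]. *)
Lemma ring_bound_normalized : cond_S alpha K -> cond_H alpha Phi K -> 0 <= alpha ->
  exists2 A, 0 < A & forall s (h : 'rV[R]_n -> R),
    0 < s -> measurable_fun setT h -> (forall x, 0 <= h x) ->
    (\int[mu]_(x in eball (0 : 'rV[R]_n) (2 * s)) (h x `^ r)%:E <= (s ^+ n)%:E)%E ->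
    (\int[mu]_(z in ring s) (`|Kt z| * h z)%:E <= (A * s `^ alpha)%:E)%E.
Proof.
move=> hS hH alpha0.
have [c [A1 [c1 A10 osc]]] := ring_oscillation hH.
have [A2 A20 tra] := ring_translate_integral hS alpha0.
have c0 : 0 < c by exact: lt_le_trans c1.
pose e := (2 * ((4 * c)^-1 / n.+1%:R)) ^+ n.
have e0 : 0 < e by rewrite exprn_gt0// mulr_gt0// divr_gt0// invr_gt0 mulr_gt0.
exists (A1 + A2 * (4 ^+ n + 1) / e).
  by rewrite addr_gt0// divr_gt0// mulr_gt0// ltr_pwDr// exprn_ge0.
move=> s h s0 mh h0 hint; pose rho := s / (4 * c).
have rho0 : 0 < rho by rewrite divr_gt0// mulr_gt0.
have rhos : rho <= s / 4.
  by rewrite /rho invfM mulrA ler_piMr ?divr_ge0 ?(ltW s0)// invf_le1.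
pose B := eball (0 : 'rV[R]_n) rho; have mB : measurable B by exact: measurable_eball.
have mU := measurable_ring s.
have muBge : ((e * s ^+ n)%:E <= mu B)%E.
  apply: le_trans (lebesgue_eball_ge 0 rho0); rewrite lee_fin /e -exprMn.
  rewrite (_ : 2 * ((4 * c)^-1 / n.+1%:R) * s = 2 * (rho / n.+1%:R))//.
  by rewrite /rho; ring.
have muBlt : (mu B < +oo)%E by apply: le_lt_trans (lebesgue_eball_le 0 rho0) (ltry _).
pose V := fine (mu B).
have VE : mu B = V%:E by rewrite fineK// ge0_fin_numE ?measure_ge0.
have Vge : e * s ^+ n <= V by rewrite -lee_fin -VE.
have V0 : 0 < V by apply: lt_le_trans Vge; rewrite mulr_gt0// exprn_gt0.
set X := (\int[mu]_(z in ring s) _)%E.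
pose F (vz : 'rV[R]_n * 'rV[R]_n) : \bar R :=
  (\1_B vz.1 * \1_(ring s) vz.2 * (`|Kt (vz.2 - vz.1)| * h vz.2))%:E.
have F0 vz : (0 <= F vz)%E by rewrite lee_fin !mulr_ge0.
have mF : measurable_fun setT F.
  apply/measurable_EFinP; apply: measurable_funM.
    apply: measurable_funM.
      exact: measurableT_comp (measurable_indic mB) measurable_fst.
    exact: measurableT_comp (measurable_indic mU) measurable_snd.
  apply: measurable_funM; last exact: measurableT_comp mh measurable_snd.
  apply: measurableT_comp => //; apply: measurableT_comp mKt _.
  apply/measurable_fun_rVP => i.
  rewrite (_ : (fun t => _) = (fun t : 'rV[R]_n * 'rV[R]_n => t.2 ord0 i - t.1 ord0 i)).
    apply: measurable_funB.
      exact: measurableT_comp (measurable_coord i) measurable_snd.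
    exact: measurableT_comp (measurable_coord i) measurable_fst.
  by apply/funext => y; rewrite !mxE.
pose G v := (\int[mu]_z F (v, z))%E.
have mG : measurable_fun setT G.
  exact: (@measurable_fun_fubini_tonelli_F _ _ _ _ _ mu F mF F0).
have G0 v : (0 <= G v)%E by exact: integral_ge0.
(* [K z = (K z - K (z - v)) + K (z - v)]. *)
have XG v : B v -> (X <= (A1 * s `^ alpha)%:E + G v)%E.
  move=> Bv; have vr : enorm v < rho by move: Bv; rewrite /B /eball/= sub0r enormN.
  have cv : c * enorm v < s / 2.
    apply: (@lt_le_trans _ _ (c * rho)); first by rewrite ltr_pM2l.
    have -> : c * rho = s / 4 by rewrite /rho; field; rewrite gt_eqF.
    lra.
  have mKv : measurable_fun setT (fun z : 'rV[R]_n => Kt (z - v)).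
    exact: measurableT_comp mKt (measurable_translate v).
  apply: le_trans (leeD (osc s v h s0 cv mh h0 hint) (lexx _)).
  have -> : G v = integral mu (ring s) (fun z : 'rV[R]_n => (`|Kt (z - v)| * h z)%:E).
    rewrite -[X in integral _ X _]setTI -ge0_integral_indic//.
    by apply: eq_integral => z _; rewrite /F/= [\1_B v]indicE mem_set// mul1r EFinM.
  rewrite -ge0_integralD//; first last.
  - apply/measurable_EFinP; apply: measurable_funTS.
    by apply: measurable_funM => //; exact: measurableT_comp.
  - by move=> z _; rewrite lee_fin mulr_ge0.
  - apply/measurable_EFinP; apply: measurable_funTS.
    by apply: measurable_funM => //; apply: measurableT_comp => //; exact: measurable_funB.
  - by move=> z _; rewrite lee_fin mulr_ge0.
  apply: lower_integral_le => // z _; first by rewrite lee_fin mulr_ge0.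
  rewrite -EFinD lee_fin -mulrDl; apply: ler_wpM2r => //.
  by rewrite distrC -[leLHS](_ : `|Kt z - Kt (z - v) + Kt (z - v)| = _) ?ler_normD// subrK.
have GT : (\int[mu]_(v in B) G v <= (A2 * s `^ alpha * ((4 ^+ n + 1) * s ^+ n))%:E)%E.
  have -> : (\int[mu]_(v in B) G v = \int[mu]_v G v)%E.
    rewrite integral_mkcond; apply: eq_integral => v _; rewrite patchE.
    case: ifPn => // vB; rewrite /G integral0_eq// => z _.
    by rewrite /F/= indicE (negbTE vB) !mul0r.
  rewrite /G (fubini_tonelli _ mF F0).
  have inner z : (\int[mu]_v F (v, z) <=
      (\1_(ring s) z)%:E * ((A2 * s `^ alpha)%:E * (h z)%:E))%E.
    rewrite indicE; case: (boolP (z \in ring s)) => [/set_mem zs|zs]; last first.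
      rewrite integral0_eq ?mul0e// => v _.
      by rewrite /F/= !indicE (negbTE zs) mulr0 mul0r.
    rewrite mul1e.
    apply: (@le_trans _ _ ((h z)%:E * \int[mu]_(v in B) `|Kt (z - v)%R|%:E)%E).
      rewrite -ge0_integralZl//; last first.
      + by rewrite lee_fin.
      + apply/measurable_EFinP; apply: measurable_funTS; apply: measurableT_comp => //.
        exact: measurableT_comp mKt (measurable_reflect z).
      rewrite -[X in (_ <= integral _ X _)%E]setTI -ge0_integral_indic//.
      rewrite le_eqVlt; apply/orP; left; apply/eqP; apply: eq_integral => v _.
      by rewrite /F/= [\1_(ring s) z]indicE mem_set// mulr1 -!EFinM; congr EFin; ring.
    rewrite muleC; apply: lee_wpmul2r; first by rewrite lee_fin.
    exact: tra.
  apply: (@le_trans _ _ (\int[mu]_(z in ring s) ((A2 * s `^ alpha)%:E * (h z)%:E))%E).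
    rewrite -[X in (_ <= integral _ X _)%E]setTI -ge0_integral_indic//.
    apply: lower_integral_le => // z _; exact: integral_ge0.
  rewrite ge0_integralZl//; first last.
  - by rewrite lee_fin mulr_ge0 ?powR_ge0// ltW.
  - by move=> z _; rewrite lee_fin.
  - by apply/measurable_EFinP; exact: measurable_funTS.
  rewrite [X in (_ <= X)%E]EFinM; apply: lee_wpmul2l.
    by rewrite lee_fin mulr_ge0 ?powR_ge0// ltW.
  pose B2 := eball (0 : 'rV[R]_n) (2 * s).
  have mB2 : measurable B2 by exact: measurable_eball.
  have mhr : measurable_fun B2 (fun z => (h z `^ r)%:E).
    by apply/measurable_EFinP; apply: measurable_fun_powR; exact: measurable_funTS.
  apply: (@le_trans _ _ (\int[mu]_(z in B2) (1 + (h z `^ r)%:E))%E).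
    rewrite integral_mkcond [leRHS]integral_mkcond; apply: lower_integral_le => //.
      by move=> z _; apply: erestrict_ge0 => x _; rewrite lee_fin.
    move=> z _; rewrite !patchE; case: ifPn => [/set_mem zs|_]; last first.
      by case: ifPn => // _; rewrite adde_ge0// lee_fin powR_ge0.
    rewrite mem_set; last exact: ring_sub_eball.
    have [h1|h1] := leP (h z) 1.
      apply: (@le_trans _ _ 1%E); first by rewrite lee_fin.
      by rewrite leeDl// lee_fin powR_ge0.
    apply: (@le_trans _ _ (h z `^ r)%:E); last by rewrite leeDr// lee_fin.
    by rewrite lee_fin -[leLHS]powRr1// ler_powR// ltW.
  rewrite ge0_integralD//; last by move=> z _; rewrite lee_fin powR_ge0.
  rewrite mulrDl mul1r EFinD; apply: leeD => //.
  rewrite integral_cst// mul1e -exprMn.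
  have -> : 4 * s = 2 * (2 * s) by ring.
  by apply: lebesgue_eball_le; rewrite mulr_gt0.
have XV : (X * V%:E <= (A1 * s `^ alpha * V)%:E + (A2 * s `^ alpha * ((4 ^+ n + 1) * s ^+ n))%:E)%E.
  have X0 : (0 <= X)%E by apply: integral_ge0 => z _; rewrite lee_fin mulr_ge0.
  have := lower_integral_le mu mB (fun v _ => X0) XG.
  have IB (y : \bar R) : (\int[mu]_(v in B) y = y * V%:E)%E.
    by rewrite integral_cst//; congr (_ * _)%E.
  rewrite IB ge0_integralD//; last first.
  - exact: measurable_funTS.
  - by move=> v _; rewrite lee_fin mulr_ge0 ?powR_ge0// ltW.
  rewrite IB -EFinM => H; apply: (le_trans H).
  exact: leeD.
rewrite -lee_pdivlMr// in XV; apply: (le_trans XV).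
rewrite -EFinD -EFinM lee_fin [leLHS]mulrDl mulfK ?gt_eqF// [leRHS]mulrDl lerD2l.
rewrite ler_pdivrMr//.
apply: (@le_trans _ _ (A2 * (4 ^+ n + 1) / e * s `^ alpha * (e * s ^+ n))).
  by rewrite le_eqVlt; apply/orP; left; apply/eqP; field; rewrite gt_eqF.
apply: ler_wpM2l => //; rewrite mulr_ge0 ?powR_ge0// divr_ge0 ?(ltW e0)//.
by rewrite mulr_ge0 ?(ltW A20)// addr_ge0 ?exprn_ge0.
Qed.

(** The normalised estimate, rescaled; no normalisation is possible when the
average of [h ^ r] is 0 or infinite. *)
Lemma kernel_ring_estimate : cond_S alpha K -> cond_H alpha Phi K -> 0 <= alpha ->
  exists2 A, 0 < A & forall s (h : 'rV[R]_n -> R),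
    0 < s -> measurable_fun setT h -> (forall x, 0 <= h x) ->
    (\int[mu]_(z in ring s) (`|Kt z| * h z)%:E <= (A * s `^ alpha)%:E *
      ((s ^- n)%:E * \int[mu]_(x in eball (0 : 'rV[R]_n) (2 * s)) (h x `^ r)%:E) `^ r^-1)%E.
Proof.
move=> hS hH alpha0; have [A A0 HA] := ring_bound_normalized hS hH alpha0.
exists A => // s h s0 mh h0; set N := (\int[mu]_(x in eball _ _) _)%E.
have r0 : 0 < r by exact: lt_le_trans r1.
have sn0 : 0 < s ^+ n by rewrite exprn_gt0.
have As0 : 0 < A * s `^ alpha by rewrite mulr_gt0// powR_gt0.
have N0 : (0 <= N)%E by apply: integral_ge0 => x _; rewrite lee_fin powR_ge0.
have mU := measurable_ring s.
have mB : measurable (eball (0 : 'rV[R]_n) (2 * s)) by exact: measurable_eball.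
have scaled l : 0 < l -> (N <= (s ^+ n * l `^ r)%:E)%E ->
    (\int[mu]_(z in ring s) (`|Kt z| * h z)%:E <= (A * s `^ alpha * l)%:E)%E.
  move=> l0 Nl; have l'0 : 0 <= l^-1 by rewrite invr_ge0 ltW.
  have := HA s (fun x => l^-1 * h x) s0 (measurable_funM (measurable_cst _) mh)
    (fun x => mulr_ge0 l'0 (h0 x)).
  have -> : (\int[mu]_(x in eball (0 : 'rV[R]_n) (2 * s)) ((l^-1 * h x) `^ r)%:E =
      (l^-1 `^ r)%:E * N)%E.
    rewrite -ge0_integralZl//; last first.
    - by rewrite lee_fin powR_ge0.
    - by move=> x _; rewrite lee_fin powR_ge0.
    - by apply/measurable_EFinP; apply: measurable_fun_powR; exact: measurable_funTS.
    by apply: eq_integral => x _; rewrite powRM// EFinM.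
  have lr : 0 < l `^ r by rewrite powR_gt0.
  have -> : l^-1 `^ r = (l `^ r)^-1.
    by rewrite -[l^-1]powR_inv1 ?(ltW l0)// -powRrM mulN1r powRN.
  rewrite lee_pdivrMl// -EFinM mulrC => /(_ Nl).
  have -> : (\int[mu]_(z in ring s) (`|Kt z| * (l^-1 * h z))%:E =
      l^-1%:E * \int[mu]_(z in ring s) (`|Kt z| * h z)%:E)%E.
    rewrite -ge0_integralZl//; last first.
    - by move=> z _; rewrite lee_fin mulr_ge0.
    - apply/measurable_EFinP; apply: measurable_funTS; apply: measurable_funM => //.
      exact: measurableT_comp.
    by apply: eq_integral => z _; rewrite -EFinM mulrCA.
  by rewrite lee_pdivrMl// -EFinM (mulrC l).
have [Noo|] := eqVneq N +oo%E.
  rewrite Noo gt0_muley ?lte_fin ?invr_gt0// poweRyr ?invr_eq0 ?(gt_eqF r0)//.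
  by rewrite gt0_muley ?lte_fin// leey.
rewrite -ltey => Nfin.
pose x := fine N; have NE : N = x%:E by rewrite fineK// ge0_fin_numE.
have x0 : 0 <= x by rewrite fine_ge0.
rewrite NE -(EFinM (s ^- n) x) poweR_EFin -EFinM.
move: x0; rewrite le_eqVlt => /predU1P[x0|x0]; last first.
  apply: scaled; first by rewrite powR_gt0// mulr_gt0// invr_gt0.
  rewrite -powRrM mulVf ?gt_eqF// powRr1 ?mulr_ge0 ?invr_ge0 ?(ltW sn0) ?(ltW x0)//.
  by rewrite mulrA mulfV ?gt_eqF// mul1r NE.
rewrite -x0 mulr0 powR0 ?invr_eq0 ?gt_eqF// mulr0.
apply/lee_addgt0Pr => e e0; rewrite add0e.
have := scaled (e / (A * s `^ alpha)); rewrite divr_gt0// NE -x0 => /(_ isT).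
rewrite lee_fin mulr_ge0 ?powR_ge0 ?(ltW sn0)// => /(_ isT).
by rewrite (mulrCA (A * s `^ alpha)) mulfV ?gt_eqF// mulr1.
Qed.

End kernel_ring.

(** * Domination by dyadic fractional averages *)

Lemma lebesgue_origin (R : realType) (n : nat) : (0 < n)%N ->
  measurable [set 0 : 'rV[R]_n] /\ lebesgue_rV R n [set 0] = 0%E.
Proof.
move=> n0; have mS : measurable [set 0 : 'rV[R]_n].
  rewrite (_ : [set 0] = [set z : 'rV[R]_n | `]-oo, 0]%classic (enorm z)]).
    exact: (measurable_enorm_set (measurable_itv `]-oo, 0])).
  apply/seteqP; split => z /=; rewrite in_itv/=.
    move=> ->; have := enorm_le_coord (x := 0 : 'rV[R]_n) (lexx 0).
    by rewrite mulr0; apply => i; rewrite mxE normr0.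
  move=> z0; apply/rowP => i; rewrite mxE; apply/eqP; rewrite -normr_le0.
  exact: le_trans (coord_le_enorm z i) z0.
split => //; apply/eqP; rewrite eq_le measure_ge0 andbT.
apply/lee_addgt0Pr => e e0; rewrite add0e.
pose h := Num.min e 1; have h0 : 0 < h by rewrite lt_min e0 ltr01.
have h1 : h <= 1 by rewrite ge_min lexx orbT.
have r0 : 0 < h / 2 by rewrite divr_gt0.
apply: le_trans (le_trans _ (lebesgue_eball_le (0 : 'rV[R]_n) r0)) _.
  apply: le_measure; rewrite ?inE//; first exact: measurable_eball.
  move=> _ ->; rewrite /eball/= subrr.
  apply: le_lt_trans (enorm_le_coord (x := 0 : 'rV[R]_n) (lexx 0) _) _.
    by move=> i; rewrite mxE normr0.
  by rewrite mulr0.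
rewrite lee_fin mulrC divfK// -(prednK n0) exprS.
apply: (@le_trans _ _ h); last by rewrite ge_min lexx.
by rewrite ler_piMr ?(ltW h0)// exprn_ile1// ltW.
Qed.

Section annular_majorant.
Context (R : realType) (n : nat) (n0 : (0 < n)%N).
Local Notation mu := (lebesgue_rV R n).
Local Notation ring s := [set z : 'rV[R]_n | s < enorm z < 2 * s].
Local Notation G t := (shifted_grid R n0 t).
Variables (alpha e r A p q : R) (Kt : 'rV[R]_n -> R).
Hypotheses (mKt : measurable_fun setT Kt) (alpha0 : 0 <= alpha) (e0 : 0 <= e).
Hypotheses (r1 : 1 <= r) (A0 : 0 < A) (gain : n%:R * (p^-1 - q^-1) = e + alpha).
Hypothesis ring_le : forall s (h : 'rV[R]_n -> R),
  0 < s -> measurable_fun setT h -> (forall x, 0 <= h x) ->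
  (\int[mu]_(z in ring s) (`|Kt z| * h z)%:E <= (A * s `^ alpha)%:E *
    ((s ^- n)%:E * \int[mu]_(x in eball (0 : 'rV[R]_n) (2 * s)) (h x `^ r)%:E) `^ r^-1)%E.

Local Notation dyadic_term f x t k :=
  (frac (G t) p q k * avg (fun y => `|f y| `^ r) (cube_at (G t) k x) `^ r^-1)%:E.

Lemma frac_shifted t (k : int) : frac (G t) p q k = (2 ^ k) `^ (e + alpha).
Proof.
have -> : frac (G t) p q k = ((2 ^+ n) ^ k) `^ (p^-1 - q^-1) by [].
rewrite exprnP exprz_exp mulrC -exprz_exp -gain powRrM; congr (_ `^ _).
by rewrite powR_mulrn// exprz_ge0.
Qed.

Variable f : 'rV[R]_n -> R.
Hypothesis mf : measurable_fun setT f.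
Hypothesis lf : forall t P,
  (\int[mu]_(y in cube (G := G t) P) (`|f y| `^ r)%:E < +oo)%E.

Let r0 : 0 < r. Proof. exact: lt_le_trans r1. Qed.

(** [4 < 2 ^ 5 / 6], the margin of the one-third trick. *)
Lemma eball_le_cube x (k : int) : exists t,
  eball x (4 * 2 ^ k) `<=` cube (G := G t) (cube_at (G t) (k + 5) x).
Proof.
have [t Ht] := shifted_grid_cover (k + 5) x; exists t => y xy.
rewrite /cube/=; apply: Ht => i; have -> : x ord0 i - y ord0 i = (x - y) ord0 i by rewrite !mxE.
apply: le_lt_trans (coord_le_enorm _ _) _; apply: (lt_trans xy).
rewrite expfzDr ?pnatr_eq0//; have : 0 < (2 : R) ^ k by exact: exprz_gt0.
rewrite -[2 ^ 5]/((2 : R) ^+ 5); lra.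
Qed.

Lemma dyadic_term_ge0 x t k : (0 <= dyadic_term f x t k)%E.
Proof. by rewrite lee_fin mulr_ge0// powR_ge0. Qed.

Lemma le_term_sum (F : {set 'I_n} -> \bar R) t : (forall i, (0 <= F i)%E) ->
  (F t <= \sum_i F i)%E.
Proof. by move=> F0; rewrite (bigD1 t)//= leeDl// sume_ge0. Qed.

Lemma ring_majorant x (k : int) s : 2 ^ k <= s <= 2 * 2 ^ k ->
  (\int[mu]_(z in ring s) (enorm z `^ e * `|Kt z| * `|f (x - z)%R|)%:E <=
   (A * (2 ^+ n ^+ 5) `^ r^-1)%:E *
     \sum_(t : {set 'I_n}) dyadic_term f x t (k + 5))%E.
Proof.
move=> /andP[ks sk]; have k0 : 0 < (2 : R) ^ k by exact: exprz_gt0.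
have s0 : 0 < s by exact: lt_le_trans ks.
have mU := @measurable_ring R n s.
have mfx : measurable_fun setT (fun z : 'rV[R]_n => f (x - z)).
  exact: measurableT_comp mf (measurable_reflect x).
have [t Ht] := eball_le_cube x k.
set P := cube_at _ _ _ in Ht; pose a := avg (fun y => `|f y| `^ r) P.
have a0 : 0 <= a by exact: avg_ge0.
have s2 : 0 <= 2 * s by rewrite mulr_ge0// ltW.
apply: (@le_trans _ _ (((2 * s) `^ e)%:E *
    \int[mu]_(z in ring s) (`|Kt z| * `|f (x - z)%R|)%:E)%E).
  have mKf : measurable_fun (ring s) (fun z => (`|Kt z| * `|f (x - z)|)%:E).
    apply/measurable_EFinP; apply: measurable_funTS.
    by apply: measurable_funM; exact: measurableT_comp.
  rewrite -ge0_integralZl// ?lee_fin ?powR_ge0//.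
  apply: lower_integral_le => //.
    by move=> z _; rewrite lee_fin !mulr_ge0// powR_ge0.
  move=> z /= /andP[sz zs]; rewrite -EFinM lee_fin -mulrA ler_wpM2r ?mulr_ge0//.
  by rewrite ge0_ler_powR ?nnegrE ?enorm_ge0// ltW.
have ball_le : (\int[mu]_(z in eball (0 : 'rV[R]_n) (2 * s)) (`|f (x - z)%R| `^ r)%:E
    <= (a * (2 ^+ n) ^ (k + 5))%:E)%E.
  rewrite /a /avg divfK; last by rewrite gt_eqF// exprz_gt0// exprn_gt0.
  rewrite -massE//.
  have mB : measurable (eball (0 : 'rV[R]_n) (2 * s)) by exact: measurable_eball.
  rewrite [leLHS]integral_mkcond [leRHS]integral_mkcond.
  rewrite -[leLHS](lebesgue_reflect x); last first.
  - by move=> y; apply: erestrict_ge0 => z _; rewrite lee_fin powR_ge0.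
  - apply/(measurable_restrictT _ _).1 => //; apply: measurable_funTS.
    apply/measurable_EFinP; apply: measurable_fun_powR.
    by apply: measurableT_comp.
  apply: lower_integral_le => //.
    by move=> y _; apply: erestrict_ge0 => z _; rewrite lee_fin powR_ge0.
  move=> y _; rewrite !patchE; case: ifPn => [/set_mem yb|_]; last first.
    by case: ifPn => // _; rewrite lee_fin powR_ge0.
  rewrite mem_set ?subKr//; apply: Ht; move: yb.
  rewrite /eball/= sub0r enormN => /lt_le_trans; apply; lra.
have H := ring_le s0 (measurableT_comp (@normr_measurable _ setT) mfx)
  (fun z => normr_ge0 _).
apply: (le_trans (lee_wpmul2l _ H)); first by rewrite lee_fin powR_ge0.
have int0 : (0 <= \int[mu]_(z in eball (0 : 'rV[R]_n) (2 * s)) (`|f (x - z)%R| `^ r)%:E)%E.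
  by apply: integral_ge0 => z _; rewrite lee_fin powR_ge0.
have V : (((s ^- n)%:E * \int[mu]_(z in eball (0 : 'rV[R]_n) (2 * s))
    (`|f (x - z)%R| `^ r)%:E) `^ r^-1 <= ((2 ^+ n ^+ 5) `^ r^-1 * a `^ r^-1)%:E)%E.
  rewrite -powRM// ?exprn_ge0 ?exprn_ge0// -poweR_EFin.
  apply: gt0_ler_poweR; rewrite ?invr_ge0 ?(ltW r0)// ?in_itv/= ?andbT ?leey.
  - by rewrite mule_ge0// lee_fin invr_ge0 exprn_ge0// ltW.
  - by rewrite lee_fin mulr_ge0// exprn_ge0// exprn_ge0.
  apply: (le_trans (lee_wpmul2l _ ball_le)).
    by rewrite lee_fin invr_ge0 exprn_ge0// ltW.
  rewrite -EFinM lee_fin ler_pdivrMl ?exprn_gt0//.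
  have W0 : 0 < (2 : R) ^+ n by rewrite exprn_gt0.
  apply: (@le_trans _ _ ((2 ^+ n) ^ k * ((2 ^+ n) ^+ 5 * a))).
    rewrite expfzDr ?gt_eqF// -[(2 ^+ n) ^ 5]/((2 ^+ n) ^+ 5 : R).
    by rewrite mulrC -mulrA.
  apply: ler_wpM2r; first by rewrite mulr_ge0// exprn_ge0// ltW.
  rewrite exprnP exprz_exp mulrC -exprz_exp.
  by rewrite lerXn2r ?nnegrE ?(ltW k0) ?(ltW s0).
apply: (le_trans (lee_wpmul2l _ (lee_wpmul2l _ V))).
- by rewrite lee_fin powR_ge0.
- by rewrite lee_fin mulr_ge0 ?powR_ge0// ltW.
apply: (@le_trans _ _ ((A * (2 ^+ n ^+ 5) `^ r^-1)%:E * dyadic_term f x t (k + 5))%E); last first.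
  apply: lee_wpmul2l; first by rewrite lee_fin mulr_ge0 ?powR_ge0// ltW.
  exact: (@le_term_sum (fun u => dyadic_term f x u (k + 5)) t (fun u => dyadic_term_ge0 x u (k + 5))).
rewrite -!EFinM lee_fin frac_shifted -/P -/a.
have pe : (2 * s) `^ e * s `^ alpha <= (2 ^ (k + 5)) `^ (e + alpha).
  have K : 2 * s <= 2 ^ (k + 5).
    rewrite expfzDr ?pnatr_eq0// -[2 ^ 5]/((2 : R) ^+ 5); lra.
  have k5 : 0 < (2 : R) ^ (k + 5) by exact: exprz_gt0.
  rewrite powRD; last by rewrite (gt_eqF k5) implybT.
  apply: ler_pM; rewrite ?powR_ge0//; apply: ge0_ler_powR; rewrite ?nnegrE ?exprz_ge0 ?(ltW s0)//.
  by apply: le_trans K; rewrite ler_peMl ?(ltW s0)// ler1n.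
set c := _ `^ r^-1; set ar := a `^ _.
have arr (x1 x2 x3 x4 x5 : R) : x1 * (x2 * x3 * (x4 * x5)) = x2 * x4 * x5 * (x1 * x3) by ring.
have arr' (x2 x3 x4 x5 : R) : x2 * x4 * (x3 * x5) = x2 * x4 * x5 * x3 by ring.
rewrite arr [leRHS]arr'; apply: ler_wpM2l => //.
by rewrite !mulr_ge0 ?powR_ge0// ltW.
Qed.

(** The open rings of radii [2 ^ k] and [3 / 2 * 2 ^ k] cover everything but the
origin, including the spheres of radius [2 ^ k]. *)
Lemma annular_majorant x :
  (\int[mu]_y (enorm (x - y)%R `^ e * `|Kt (x - y)%R| * `|f y|)%:E <=
   (2 * (A * (2 ^+ n ^+ 5) `^ r^-1))%:E *
     \sum_(t : {set 'I_n}) \esum_(k in [set: int]) dyadic_term f x t k)%E.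
Proof.
set C := A * _; have C0 : 0 <= C by rewrite mulr_ge0 ?powR_ge0// ltW.
pose H z := (enorm z `^ e * `|Kt z| * `|f (x - z)|)%:E.
have H0 z : (0 <= H z)%E by rewrite lee_fin !mulr_ge0// powR_ge0.
have mH : measurable_fun setT H.
  apply/measurable_EFinP; apply: measurable_funM.
    apply: measurable_funM; last exact: measurableT_comp.
    exact: measurable_fun_powR (@measurable_enorm R n).
  by apply: measurableT_comp => //; exact: measurableT_comp mf (measurable_reflect x).
have -> : (\int[mu]_y (enorm (x - y)%R `^ e * `|Kt (x - y)%R| * `|f y|)%:E =
           \int[mu]_z H z)%E.
  rewrite -[RHS](lebesgue_reflect x)//; apply: eq_integral => y _.
  by rewrite /H subKr.
pose S1 (k : int) := ring (2 ^ k : R); pose S2 (k : int) := ring (3 / 2 * 2 ^ k : R).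
have mS1 k : measurable (S1 k) by exact: measurable_ring.
have mS2 k : measurable (S2 k) by exact: measurable_ring.
pose W k z := ((\1_(S1 k) z)%:E * H z + (\1_(S2 k) z)%:E * H z)%E.
have W10 k z : (0 <= (\1_(S1 k) z)%:E * H z)%E by rewrite mule_ge0// lee_fin.
have W20 k z : (0 <= (\1_(S2 k) z)%:E * H z)%E by rewrite mule_ge0// lee_fin.
have mW1 k : measurable_fun setT (fun z => (\1_(S1 k) z)%:E * H z)%E.
  apply: emeasurable_funM => //; apply/measurable_EFinP; exact: measurable_indic.
have mW2 k : measurable_fun setT (fun z => (\1_(S2 k) z)%:E * H z)%E.
  apply: emeasurable_funM => //; apply/measurable_EFinP; exact: measurable_indic.
have W0 k z : (0 <= W k z)%E by exact: adde_ge0.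
apply: (@le_trans _ _ (\int[mu]_z \esum_(k in [set: int]) W k z)%E).
  apply: ae_lower_integral_le => //.
    by move=> z _; apply: esum_ge0.
  have [m0 null0] := @lebesgue_origin R n n0.
  exists [set 0]; split => //.
  move=> z; apply: contra_notP => /= z0 _.
  have zp : 0 < enorm z.
    rewrite lt_neqAle enorm_ge0 andbT eq_sym; apply/eqP => ez; apply: z0.
    apply/rowP => i; rewrite mxE; apply/eqP; rewrite -normr_le0 -ez.
    exact: coord_le_enorm.
  have [k /andP[k1 k2]] := exists_exprz_bracket (ltr1n R 2) zp.
  apply: le_trans (le_esum_single (i := k) _ (W0 k z)) => //.
  rewrite expfzDr ?pnatr_eq0// expr1z in k2.
  have [k3|k3] := ltP (enorm z) (2 * 2 ^ k).
    rewrite /W indicE mem_set ?mul1e ?leeDl//; last by rewrite /S1/= k1.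
  rewrite /W [\1_(S2 k) z]indicE mem_set ?mul1e ?leeDr//.
  by apply/andP; split; lra.
rewrite integral_esum//; last by move=> k _; exact: emeasurable_funD.
apply: (@le_trans _ _ (\esum_(k in [set: int])
    ((2 * C)%:E * \sum_(t : {set 'I_n}) dyadic_term f x t (k + 5)))%E).
  apply: le_esum => k _; rewrite ge0_integralD// !ge0_integral_indic// !setTI.
  have k0 : 0 < (2 : R) ^ k by exact: exprz_gt0.
  rewrite EFinM -muleA mule_natl mule2n; apply: leeD.
    by apply: ring_majorant; apply/andP; split; lra.
  by apply: ring_majorant; apply/andP; split; lra.
have C20 : 0 <= 2 * C by rewrite mulr_ge0.
have sum0 (k : int) : (0 <= \sum_(t : {set 'I_n}) dyadic_term f x t (k + 5))%E.
  by apply: sume_ge0 => t _; exact: dyadic_term_ge0.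
rewrite (esumZl C20 (fun k _ => sum0 k)).
apply: lee_wpmul2l => //.
rewrite esum_sum; last by move=> k t _ _; exact: dyadic_term_ge0.
apply: lee_sum => t _.
rewrite [leRHS](reindex_esum [set: int] [set: int] (fun k => k + 5))//.
split => //; first by move=> i j _ _ /addIr.
by move=> j _; exists (j - 5) => //; rewrite subrK.
Qed.

End annular_majorant.

(** * Weights on balls and on cubes *)

Section ball_weights.
Context (R : realType) (n : nat).
Local Notation mu := (lebesgue_rV R n).
Variables (q b A : R).
Hypotheses (q0 : 0 < q) (b0 : 0 < b).

(** For [b = 1/beta - 1/p] this is the condition on [w ^ beta] with exponents
[p / beta] and [q / beta].  The inverse is extended-real valued, so that a weight
vanishing on a set of positive measure has an infinite second mean. *)
Definition ball_muckenhoupt (g : 'rV[R]_n -> R) := forall x r, 0 < r ->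
  (mean (eball x r) (fun y => (g y `^ q)%:E) `^ q^-1 *
   mean (eball x r) (fun y => ((g y `^ b^-1)%:E)^-1) `^ b <= A%:E)%E.

Lemma measure_eball x (r : R) : 0 < r ->
  exists2 V, 0 < V & mu (eball x r) = V%:E.
Proof.
move=> r0; have ge := lebesgue_eball_ge x r0; have le := lebesgue_eball_le x r0.
exists (fine (mu (eball x r))); last first.
  by rewrite fineK// ge0_fin_numE ?measure_ge0// (le_lt_trans le) ?ltry.
rewrite -lte_fin fineK; last by rewrite ge0_fin_numE ?measure_ge0// (le_lt_trans le) ?ltry.
by apply: lt_le_trans ge; rewrite lte_fin exprn_gt0// mulr_gt0// divr_gt0.
Qed.

Lemma inve_powR_ge0 (s t : R) : (0 <= ((s `^ t)%:E)^-1)%E.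
Proof. by rewrite inve_ge0 lee_fin powR_ge0. Qed.

Lemma mean_ge0 B (f : 'rV[R]_n -> \bar R) : (forall y, 0 <= f y)%E ->
  (0 <= mean B f)%E.
Proof. by move=> f0; rewrite mule_ge0 ?inve_ge0// integral_ge0. Qed.

Lemma ball_muckenhoupt_ae g h : ball_muckenhoupt g ->
  {ae mu, forall x, g x = h x} -> ball_muckenhoupt h.
Proof.
move=> Hg gh x r r0; have := Hg x r r0; rewrite /mean.
have mB := @measurable_eball R n x r.
have E1 : (\int[mu]_(y in eball x r) (g y `^ q)%:E =
           \int[mu]_(y in eball x r) (h y `^ q)%:E)%E.
  apply: ae_lower_integral_eq => //; [| |by apply: filterS gh => y -> _].
  - by move=> y _; rewrite lee_fin powR_ge0.
  - by move=> y _; rewrite lee_fin powR_ge0.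
have E2 : (\int[mu]_(y in eball x r) ((g y `^ b^-1)%:E)^-1 =
           \int[mu]_(y in eball x r) ((h y `^ b^-1)%:E)^-1)%E.
  apply: ae_lower_integral_eq => //; [| |by apply: filterS gh => y -> _].
  - by move=> y _; exact: inve_powR_ge0.
  - by move=> y _; exact: inve_powR_ge0.
by rewrite E1 E2.
Qed.

Lemma mean_lty x r f : 0 < r -> (forall y, 0 <= f y)%E ->
  (mean (eball x r) f < +oo)%E -> (\int[mu]_(y in eball x r) f y < +oo)%E.
Proof.
move=> r0 f0; have [V V0 VE] := measure_eball x r0.
rewrite /mean VE inver gt_eqF// !ltey; apply: contra_neq => ->.
by rewrite gt0_muley// lte_fin invr_gt0.
Qed.

Lemma mean_gt0 x r f : 0 < r ->
  (0 < \int[mu]_(y in eball x r) f y -> 0 < mean (eball x r) f)%E.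
Proof.
move=> r0; have [V V0 VE] := measure_eball x r0.
by rewrite /mean VE inver gt_eqF// => I0; rewrite mule_gt0// lte_fin invr_gt0.
Qed.

Lemma mule_lty_factor (x y : \bar R) : (0 < x -> 0 <= y -> x * y <= A%:E -> y < +oo)%E.
Proof.
by move=> x0 y0 xy; rewrite ltey; apply/eqP => yE; move: xy; rewrite yE gt0_muley.
Qed.

Lemma poweR_fin (x : \bar R) t : 0 < t -> (x `^ t < +oo -> x < +oo)%E.
Proof.
by move=> t0; rewrite !ltey; apply: contra_neq => ->; rewrite poweRyr// gt_eqF.
Qed.

Lemma origin_balls_cover x : exists k, eball (0 : 'rV[R]_n) k.+1%:R x.
Proof.
exists (Num.truncn (enorm x)); rewrite /eball/= sub0r enormN.
exact: truncnS_gt.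
Qed.

(** If [g] does not vanish almost everywhere, the first mean is positive on all
large balls around the origin, hence the second one is finite there and [g]
vanishes on a null set only. *)
Lemma weight_dichotomy (g : 'rV[R]_n -> R) : measurable_fun setT g -> (forall x, 0 <= g x) ->
  ball_muckenhoupt g -> {ae mu, forall x, g x = 0} \/ {ae mu, forall x, 0 < g x}.
Proof.
move=> mg g0 Hg; pose B k := eball (0 : 'rV[R]_n) k.+1%:R.
have mB k : measurable (B k) by exact: measurable_eball.
have B0 k : 0 < k.+1%:R :> R by [].
have ae_of (P : set 'rV[R]_n) :
    (forall k, measurable (B k `&` ~` P) /\ mu (B k `&` ~` P) = 0%E) -> {ae mu, forall x, P x}.
  move=> HP; have : mu.-negligible (\bigcup_k (B k `&` ~` P)).
    apply: negligible_bigcup => k; have [mE E0] := HP k.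
    by exists (B k `&` ~` P); split.
  apply: negligibleS => x nPx; have [k Bx] := origin_balls_cover x.
  by exists k.
have mgq : measurable_fun setT (fun y => (g y `^ q)%:E).
  by apply/measurable_EFinP; exact: measurable_fun_powR.
have [allz|] := pselect (forall k, (\int[mu]_(y in B k) (g y `^ q)%:E = 0)%E).
  left; apply: ae_of => k.
  have mE : measurable (B k `&` ~` [set x | g x = 0]).
    apply: measurableI => //; apply: measurableC.
    by rewrite -[X in measurable X]setTI; exact: (mg measurableT [set 0]).
  split=> //; apply: (null_of_integral_eq0 (h := fun y => g y `^ q)) => //.
  - by apply: measurable_funTS; exact: measurable_fun_powR.
  - by move=> x [_ /= gx]; rewrite powR_gt0// lt_neqAle g0 andbT eq_sym; apply/eqP.
  apply/eqP; rewrite eq_le; apply/andP; split; last first.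
    by apply: integral_ge0 => x _; rewrite lee_fin powR_ge0.
  rewrite -(allz k); apply: ge0_subset_integral => //.
    exact: measurable_funTS.
  by move=> x _; rewrite lee_fin powR_ge0.
move=> /existsNP[N]; move=> /eqP HN; right.
pose Z := [set x | ~ (0 < g x)].
have mZ : measurable Z.
  rewrite (_ : Z = g @^-1` `]-oo, 0]).
    by rewrite -[X in measurable X]setTI; exact: mg.
  by apply/seteqP; split => x /=; rewrite in_itv/= leNgt => /negP.
have big k : (N <= k)%N -> mu (B k `&` Z) = 0%E.
  move=> Nk; have BNk : B N `<=` B k.
    by move=> x /lt_le_trans; apply; rewrite ler_nat.
  have Ik : (0 < \int[mu]_(y in B k) (g y `^ q)%:E)%E.
    apply: (@lt_le_trans _ _ (\int[mu]_(y in B N) (g y `^ q)%:E)%E).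
      rewrite lt_neqAle eq_sym HN/=; apply: integral_ge0 => x _.
      by rewrite lee_fin powR_ge0.
    apply: ge0_subset_integral => //; first exact: measurable_funTS.
    by move=> x _; rewrite lee_fin powR_ge0.
  have M1 : (0 < mean (B k) (fun y => (g y `^ q)%:E) `^ q^-1)%E.
    by apply: poweR_gt0; exact: mean_gt0.
  have := mule_lty_factor M1 (poweR_ge0 _ _) (Hg 0 _ (B0 k)).
  move=> /(poweR_fin b0)/(mean_lty (B0 k) (fun y => inve_powR_ge0 _ _)) fin.
  apply/eqP; rewrite eq_le measure_ge0 andbT leNgt; apply/negP => pos.
  move: fin; rewrite ltNge => /negP; apply.
  have <- : (\int[mu]_(y in B k `&` Z) (cst +oo y) = +oo)%E.
    rewrite integral_cst; first by rewrite gt0_mulye.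
    exact: measurableI.
  rewrite integral_mkcond [leRHS]integral_mkcond; apply: lower_integral_le => //.
    by move=> x _; apply: erestrict_ge0 => y _; exact: leey.
  move=> x _; rewrite !patchE; case: ifPn => [/set_mem[Bx Zx]|_]; last first.
    by case: ifPn => // _; exact: inve_powR_ge0.
  rewrite mem_set//; have -> : g x = 0.
    by apply/eqP; rewrite eq_le g0 andbT leNgt; apply/negP.
  by rewrite powR0 ?invr_eq0 ?gt_eqF// inve0.
apply: ae_of => k.
have mE : measurable (B k `&` Z) by exact: measurableI.
split=> //; apply: (subset_measure0 mE (measurableI _ _ (mB (maxn N k)) mZ) _ (big _ (leq_maxl _ _))).
move=> x [Bx Zx]; split => //; apply: lt_le_trans Bx _.
by rewrite ler_nat ltnS leq_maxr.
Qed.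

Section positive_weight.
Variable g : 'rV[R]_n -> R.
Hypotheses (mg : measurable_fun setT g) (g0 : forall x, 0 < g x).
Hypothesis Hg : ball_muckenhoupt g.

Lemma integral_powR_gt0 x (r : R) t : 0 < r ->
  (0 < \int[mu]_(y in eball x r) (g y `^ t)%:E)%E.
Proof.
move=> r0; have mB := @measurable_eball R n x r.
have [V V0 VE] := measure_eball x r0.
rewrite lt_neqAle integral_ge0 ?andbT; last by move=> y _; rewrite lee_fin powR_ge0.
rewrite eq_sym; apply/eqP => I0.
have := null_of_integral_eq0 mB (measurable_funTS (measurable_fun_powR t mg))
   (fun y _ => powR_gt0 t (g0 y)) I0.
by move=> /(etrans (esym VE))[] /eqP; rewrite gt_eqF.
Qed.

Lemma inve_powR_pos y : (((g y `^ b^-1)%:E)^-1 = (g y `^ (- b^-1))%:E)%E.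
Proof. by rewrite inver gt_eqF ?powR_gt0// powRN. Qed.

Lemma ball_integral_lty x r : 0 < r ->
  (\int[mu]_(y in eball x r) (g y `^ q)%:E < +oo)%E /\
  (\int[mu]_(y in eball x r) (g y `^ (- b^-1))%:E < +oo)%E.
Proof.
move=> r0; have := Hg x r0; rewrite (funext inve_powR_pos) => H.
have M1 : (0 < mean (eball x r) (fun y => (g y `^ q)%:E) `^ q^-1)%E.
  by apply: poweR_gt0; apply: mean_gt0 => //; exact: integral_powR_gt0.
have M2 : (0 < mean (eball x r) (fun y => (g y `^ (- b^-1))%:E) `^ b)%E.
  by apply: poweR_gt0; apply: mean_gt0 => //; exact: integral_powR_gt0.
split.
  apply: mean_lty => //; first by move=> y; rewrite lee_fin powR_ge0.
  apply: (poweR_fin (t := q^-1)); first by rewrite invr_gt0.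
  by apply: (mule_lty_factor M2 (poweR_ge0 _ _)); rewrite muleC.
apply: mean_lty => //; first by move=> y; rewrite lee_fin powR_ge0.
exact: poweR_fin b0 (mule_lty_factor M1 (poweR_ge0 _ _) H).
Qed.

End positive_weight.

End ball_weights.

Section cube_weights.
Context (R : realType) (n : nat) (n0 : (0 < n)%N).
Local Notation mu := (lebesgue_rV R n).
Variables (q b A : R) (g : 'rV[R]_n -> R) (t : {set 'I_n}).
Local Notation G := (shifted_grid R n0 t).
Local Notation cube := (cube (G := G)).
Hypotheses (q0 : 0 < q) (b0 : 0 < b).
Hypotheses (mg : measurable_fun setT g) (g0 : forall x, 0 < g x).
Hypothesis Hg : ball_muckenhoupt q b A g.

Lemma cube_le_eball P x : cube P x -> cube P `<=` eball x (n.+1%:R * 2 ^ P.1).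
Proof.
move=> Px y Py; apply: (@le_lt_trans _ _ (n%:R * 2 ^ P.1)).
  apply: enorm_le_coord => [|i]; first by rewrite exprz_ge0.
  rewrite !mxE; apply/ltW/(@grid_coord_le _ _ t).
  by move: Px Py; rewrite /cube/= => -> ->.
by rewrite ltr_pM2r ?exprz_gt0// ltr_nat.
Qed.

Let radius0 (P : int * 'rV[int]_n) : 0 < n.+1%:R * (2 : R) ^ P.1.
Proof. by rewrite mulr_gt0// exprz_gt0. Qed.

Lemma cube_integral_le P x s : cube P x ->
  (\int[mu]_(y in cube P) (g y `^ s)%:E <=
   \int[mu]_(y in eball x (n.+1%:R * 2 ^ P.1)) (g y `^ s)%:E)%E.
Proof.
move=> Px; apply: ge0_subset_integral.
- exact: measurable_cube.
- exact: measurable_eball.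
- by apply/measurable_EFinP; apply: measurable_funTS; exact: measurable_fun_powR.
- by move=> y _; rewrite lee_fin powR_ge0.
- exact: cube_le_eball.
Qed.

Lemma cube_integral_lty P :
  (\int[mu]_(y in cube P) (g y `^ q)%:E < +oo)%E /\
  (\int[mu]_(y in cube P) (g y `^ (- b^-1))%:E < +oo)%E.
Proof.
have [->|/set0P[x Px]] := eqVneq (cube P) set0.
  by rewrite !integral_set0.
have [h1 h2] := ball_integral_lty q0 b0 mg g0 Hg x (radius0 P).
by split; [move: h1|move: h2]; apply: le_lt_trans; exact: cube_integral_le.
Qed.

Let c : R := (2 * n.+1%:R) ^+ n.

Lemma avg_le_mean P x s : cube P x ->
  (\int[mu]_(y in cube P) (g y `^ s)%:E < +oo)%E ->
  ((avg (fun y => g y `^ s) P)%:E <=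
   c%:E * mean (eball x (n.+1%:R * 2 ^ P.1)) (fun y => (g y `^ s)%:E))%E.
Proof.
move=> Px fin; have [V V0 VE] := measure_eball x (radius0 P).
have Vle : V <= c * (2 ^+ n) ^ P.1.
  rewrite -lee_fin -VE; apply: (le_trans (lebesgue_eball_le x (radius0 P))).
  rewrite lee_fin mulrA exprMn /c le_eqVlt; apply/orP; left; apply/eqP.
  by congr (_ * _); rewrite !exprnP !exprz_exp mulrC.
have D0 : 0 < ((2 : R) ^+ n) ^ P.1 by rewrite exprz_gt0// exprn_gt0.
have c0 : 0 < c by rewrite exprn_gt0// mulr_gt0.
rewrite /avg /mass EFinM fineK; last first.
  by rewrite ge0_fin_numE// integral_ge0// => y _; rewrite lee_fin powR_ge0.
rewrite /mean VE inver gt_eqF// muleA -EFinM muleC.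
apply: (@le_trans _ _ ((c / V)%:E * \int[mu]_(y in cube P) (g y `^ s)%:E)%E).
  apply: lee_wpmul2r; first by apply: integral_ge0 => y _; rewrite lee_fin powR_ge0.
  by rewrite lee_fin -[leLHS]mul1r ler_pdivrMr// mulrAC ler_pdivlMr// mul1r.
by apply: lee_wpmul2l; [rewrite lee_fin divr_ge0 ?ltW|exact: cube_integral_le].
Qed.

Lemma cube_muckenhoupt P : cube P !=set0 ->
  avg (fun y => g y `^ q) P `^ q^-1 * avg (fun y => g y `^ (- b^-1)) P `^ b <=
  c `^ (q^-1 + b) * A.
Proof.
move=> [x Px]; have [fin1 fin2] := cube_integral_lty P.
have h1 := avg_le_mean Px fin1; have h2 := avg_le_mean Px fin2.
have c0 : 0 < c by rewrite exprn_gt0// mulr_gt0.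
have avg0 s : 0 <= avg (fun y => g y `^ s) P.
  by rewrite divr_ge0 ?exprz_ge0 ?exprn_ge0// fine_ge0// integral_ge0// => y _; rewrite lee_fin powR_ge0.
have mono (y : \bar R) s z : 0 < z -> 0 <= s -> (0 <= y)%E -> (s%:E <= c%:E * y)%E ->
    ((s `^ z)%:E <= (c `^ z)%:E * y `^ z)%E.
  move=> z0 s0 y0 sy; rewrite -!poweR_EFin -poweRM ?lee_fin ?(ltW c0)//.
  apply: gt0_ler_poweR => //; rewrite ?(ltW z0)// in_itv/= ?leey ?lee_fin ?s0//.
  by rewrite mule_ge0// lee_fin ltW.
have m1 := mono _ _ q^-1 _ (avg0 q) _ h1.
have m2 := mono _ _ b _ (avg0 (- b^-1)) _ h2.
rewrite -lee_fin EFinM.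
have mean0 s : (0 <= mean (eball x (n.+1%:R * 2 ^ P.1)) (fun y => (g y `^ s)%:E))%E.
  by apply: mean_ge0 => y; rewrite lee_fin powR_ge0.
apply: (le_trans (lee_pmul _ _ (m1 _ _) (m2 _ _))); rewrite ?lee_fin ?powR_ge0 ?invr_gt0//.
rewrite muleACA -EFinM -powRD; last by rewrite (gt_eqF c0) implybT.
rewrite EFinM; apply: lee_wpmul2l; first by rewrite lee_fin powR_ge0.
have := Hg x (radius0 P).
by rewrite (funext (inve_powR_pos b g0)).
Qed.

End cube_weights.

(** * The commutator *)

Section commutator_bound.
Context (R : realType).

(** Such a function is constant on the countably many cubes of generation [k]. *)
Lemma measurable_cube_at d (T : measurableType d) (mu : {measure set T -> \bar R})
    (G : dyadic_grid mu) d' (U : measurableType d') (F : int * dg_index G -> U) k :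
  measurable_fun setT (fun x => F (cube_at G k x)).
Proof.
move=> _ B mB; rewrite setTI.
rewrite (_ : _ @^-1` B = \bigcup_(j in [set j | B (F (k, j))]) cube (G := G) (k, j)).
  rewrite bigcup_mkcond; apply: countable_bigcupT_measurable => // j.
  by case: ifPn => // _; exact: measurable_cube.
by apply/seteqP; split => [x Bx|x [j Bj xj]]; [exists (dg_idx G k x)|rewrite /= /cube_at xj].
Qed.

Lemma poweR_sum_le (I : finType) (i0 : I) (D : I -> \bar R) q : 0 < q ->
  (forall i, 0 <= D i)%E ->
  ((\sum_i D i) `^ q <= (#|I|%:R `^ q)%:E * \sum_i D i `^ q)%E.
Proof.
move=> q0 D0; case: (@arg_maxP _ _ _ i0 predT D isT) => j _ Dj.
have sum_le : (\sum_i D i <= #|I|%:R%:E * D j)%E.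
  apply: (@le_trans _ _ (\sum_(i : I) D j)%E); first by apply: lee_sum => i _; exact: Dj.
  rewrite big_const; elim: #|I| => [|k IH] /=; first by rewrite mul0e.
  apply: (le_trans (leeD (lexx (D j)) IH)).
  by rewrite -nat1r EFinD ge0_muleDl// mul1e.
apply: (@le_trans _ _ ((#|I|%:R%:E * D j) `^ q)%E).
  apply: gt0_ler_poweR; rewrite ?(ltW q0)// in_itv/= leey andbT.
    by apply: sume_ge0.
  by rewrite mule_ge0.
rewrite poweRM// poweR_EFin; apply: lee_wpmul2l; first by rewrite lee_fin powR_ge0.
by rewrite (bigD1 j)//= leeDl// sume_ge0// => i _; exact: poweR_ge0.
Qed.

Variables (n : nat) (delta : R) (b : 'rV[R]_n -> R).
Local Notation mu := (lebesgue_rV R n).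

Lemma lip_norm_ge0 : 0 <= lip_norm delta b.
Proof.
rewrite /lip_norm; have [->|/set0P ne] := eqVneq (lip_consts delta b) set0.
  by rewrite inf0.
by apply: lb_le_inf => // C [C0 _]; exact: ltW.
Qed.

Hypothesis hb : Lip delta b.

(** The inequalities are closed conditions on the constant, so that the infimum
still satisfies them. *)
Lemma lip_norm_le x y : `|b x - b y| <= lip_norm delta b * enorm (x - y) `^ delta.
Proof.
have [C [C0 HC]] := hb; have := powR_ge0 (enorm (x - y)) delta.
rewrite le_eqVlt => /predU1P[e0|e0].
  by have := HC x y; rewrite -e0 !mulr0.
rewrite -ler_pdivrMr//; apply: lb_le_inf; first by exists C.
by move=> D [_ HD]; rewrite ler_pdivrMr.
Qed.

Lemma commutator_le m (K Kt f ft : 'rV[R]_n -> R) x :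
  {ae mu, forall y, K y = Kt y} -> {ae mu, forall y, f y = ft y} ->
  measurable_fun setT Kt -> measurable_fun setT ft ->
  (`|commutator m b K f x| <= (2 * lip_norm delta b ^+ m)%:E *
    \int[mu]_y (enorm (x - y)%R `^ (m%:R * delta) * `|Kt (x - y)%R| * `|ft y|)%:E)%E.
Proof.
move=> KE fE mK mf; apply: (le_trans (abse_integral_le2 _ _ measurableT)).
rewrite EFinM -muleA; apply: lee_wpmul2l => //.
have lm0 : 0 <= lip_norm delta b ^+ m by rewrite exprn_ge0// lip_norm_ge0.
rewrite -ge0_integralZl//; last first.
- by move=> y _; rewrite lee_fin !mulr_ge0// powR_ge0.
- apply/measurable_EFinP; apply: measurable_funM; last exact: measurableT_comp.
  apply: measurable_funM.
    apply: measurable_fun_powR.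
    exact: measurableT_comp (@measurable_enorm R n) (measurable_reflect x).
  apply: measurableT_comp => //; exact: measurableT_comp mK (measurable_reflect x).
apply: ae_lower_integral_le => //.
- by move=> y _; rewrite -EFinM lee_fin !mulr_ge0// powR_ge0.
apply: filterS2 (lebesgue_reflect_null x KE) fE => y e1 e2 _ /=.
rewrite -EFinM lee_fin -e1 -e2 !normrM normrX !mulrA.
apply: ler_wpM2r => //; apply: ler_wpM2r => //.
rewrite (mulrC m%:R) powRrM powR_mulrn ?powR_ge0// -exprMn.
apply: lerXn2r; rewrite ?nnegrE//; last exact: lip_norm_le.
by rewrite mulr_ge0 ?lip_norm_ge0 ?powR_ge0.
Qed.

End commutator_bound.

(** * Weighted bounds for the commutator *)

Section borel_weight.
Context (R : realType) (n m : nat).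
Local Notation mu := (lebesgue_rV R n).
Variables (alpha delta p q beta Aw : R) (b K w : 'rV[R]_n -> R) (Phi Psi : R -> R).
Hypotheses (halpha : 0 < alpha < n%:R) (hdelta : 0 < delta < 1).
Hypothesis hp : 1 < p < n%:R / (m%:R * delta + alpha).
Hypothesis hq : q^-1 = p^-1 - (m%:R * delta + alpha) / n%:R.
Hypotheses (hb : Lip delta b) (hK : lebesgue_measurable K) (hKS : cond_S alpha K).
Hypotheses (hPhi : young Phi) (hKH : cond_H alpha Phi K).
Hypothesis hPsi : forall t, 0 <= t -> young_complement Phi t = (Psi t)%:E.
Hypotheses (hbeta : 1 <= beta < p).
Hypothesis hPsiB : class_Bsb n (m%:R * delta + alpha) beta Psi.
Hypotheses (mw : measurable_fun setT w) (w0 : forall x, 0 < w x).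
Hypothesis hwA : ball_muckenhoupt q (beta^-1 - p^-1) Aw w.

Let sigma := m%:R * delta + alpha.

Lemma exponents : [/\ 0 < sigma, 0 < n%:R :> R, 0 < p, p < q &
  n%:R * (p^-1 - q^-1) = m%:R * delta + alpha].
Proof.
have /andP[a0 an] := halpha; have /andP[d0 _] := hdelta; have /andP[p1 pn] := hp.
have n0 : 0 < n%:R :> R by exact: lt_trans an.
have s0 : 0 < sigma by rewrite ltr_wpDl// mulr_ge0// ltW.
have p0 : 0 < p by exact: lt_trans p1.
split => //; last first.
  by rewrite hq opprB addrC subrK mulrC divfK// gt_eqF.
have qi : 0 < q^-1.
  rewrite hq subr_gt0 -/sigma -[ltLHS]invf_div ltf_pV2// posrE divr_gt0//.
rewrite -ltf_pV2 ?posrE//; last by rewrite -invr_gt0.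
by rewrite hq ltrBlDr ltrDl divr_gt0.
Qed.

(** The class is used at the exponent [rho = n * r / (n - sigma * r)], which is
admissible exactly when [beta < r]. *)
Lemma psi_growth r : beta < r -> r < p ->
  exists2 C, 0 <= C & forall t, 0 <= t -> Psi t <= C * (1 + t `^ r).
Proof.
move=> br rp; have [s0 n0 p0 _ _] := exponents.
have /andP[b1 _] := hbeta; have /andP[_ pn] := hp.
have r0 : 0 < r by apply: lt_trans br; exact: lt_le_trans b1.
have [yPsi _ HB] := hPsiB.
have pn' : p * sigma < n%:R by rewrite -ltr_pdivlMr.
have rs : r * sigma < n%:R by apply: lt_trans pn'; rewrite ltr_pM2r.
have bs : beta * sigma < r * sigma by rewrite ltr_pM2r.
apply: (class_B_growth yPsi (sigma := sigma) n0 r0).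
  by rewrite subr_gt0 ltr_pdivrMr// mul1r.
apply: HB; rewrite -/sigma.
have -> : r / (1 - r * sigma / n%:R) = n%:R * r / (n%:R - r * sigma).
  by field; rewrite !gt_eqF// subr_gt0.
rewrite ltr_pdivrMr; last by rewrite subr_gt0 mulrC (lt_trans bs).
rewrite mulrAC ltr_pdivlMr ?subr_gt0//.
rewrite -!mulrA ltr_pM2l// (mulrC sigma) !mulrBr.
rewrite (_ : r * (beta * sigma) = beta * (r * sigma)); last by ring.
by rewrite ltrD2r ltr_pM2r.
Qed.

Lemma commutator_strong_type : exists2 C, 0 < C & forall f ft : 'rV[R]_n -> R,
  measurable_fun setT ft -> {ae mu, forall x, f x = ft x} ->
  (\int[mu]_x (`|ft x| `^ p * w x `^ p)%:E < +oo)%E ->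
  ((\int[mu]_x (`|commutator m b K f x| `^ q * (w x `^ q)%:E)) `^ q^-1 <=
   (C * lip_norm delta b ^+ m)%:E *
   (\int[mu]_x (`|ft x| `^ p * w x `^ p)%:E) `^ p^-1)%E.
Proof.
have [s0 nR0 p0 pq gain] := exponents.
have n0 : (0 < n)%N by rewrite -(ltr_nat R).
have q0 : 0 < q by exact: lt_trans pq.
have /andP[b1 bp] := hbeta; have beta0 : 0 < beta by exact: lt_le_trans b1.
have /andP[a0 _] := halpha; have /andP[d0 _] := hdelta.
have bb : 0 < beta^-1 - p^-1 by rewrite subr_gt0 ltf_pV2.
have HW t := dyadic_weighted (G := shifted_grid R n0 t) mw w0 beta0 bp pq
  (fun P => (cube_integral_lty q0 bb mw w0 hwA P).1)
  (fun P => (cube_integral_lty q0 bb mw w0 hwA P).2)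
  (fun P => cube_muckenhoupt (t := t) q0 bb mw w0 hwA (P := P)).
have [rt Hrt] := choice HW.
(* The same [r] serves in all the shifted grids. *)
case: (@arg_minP _ _ _ (finset.set0 : {set 'I_n}) predT rt isT) => t0 _ rmin.
pose r := rt t0; have [br rp _] := Hrt t0.
have r1 : 1 <= r by apply: (le_trans b1); exact: ltW.
have Ht t : exists C : R, 0 < C /\ forall f : 'rV[R]_n -> R,
    measurable_fun setT f -> (\int[mu]_x (`|f x| `^ p * w x `^ p)%:E < +oo)%E ->
    (forall P, (\int[mu]_(x in cube (G := shifted_grid R n0 t) P) (`|f x| `^ r)%:E < +oo)%E) /\
    (\int[mu]_x ((\esum_(k in [set: int]) (frac (shifted_grid R n0 t) p q k *
        avg (fun y => `|f y| `^ r) (cube_at (shifted_grid R n0 t) k x) `^ r^-1)%:E)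
        `^ q * (w x `^ q)%:E) <=
      C%:E * (\int[mu]_x (`|f x| `^ p * w x `^ p)%:E) `^ (q / p))%E.
  have [_ _ H] := Hrt t; have [|C C0 HC] := H r; first by rewrite br rmin.
  by exists C.
have {HW Hrt} [Ct HCt] := choice Ht.
have [CP CP0 growth] := psi_growth br rp.
have [Kt mK KE] := hK; have [yPsi _ _] := hPsiB.
have [A A0 HA] := kernel_ring_estimate mK KE hPhi yPsi hPsi r1 CP0 growth hKS hKH (ltW a0).
have e0 : 0 <= m%:R * delta by rewrite mulr_ge0// ltW.
pose N := #|{: {set 'I_n}}|%:R : R.
have N0 : 0 < N by rewrite ltr0n; apply/card_gt0P; exists finset.set0.
pose A' := 2 * (A * (2 ^+ n ^+ 5) `^ r^-1).
have A'0 : 0 < A' by rewrite !mulr_gt0// powR_gt0// !exprn_gt0.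
pose S := \sum_t Ct t.
have S0 : 0 < S.
  apply: (@lt_le_trans _ _ (Ct t0)); first by case: (HCt t0).
  by rewrite /S (bigD1 t0)//= lerDl sumr_ge0// => t _; have [/ltW] := HCt t.
exists (2 * A' * N * S `^ q^-1); first by rewrite !mulr_gt0// powR_gt0.
move=> f ft mft fE; set I := (\int[mu]_x _)%E => Ifin.
have I0 : (0 <= I)%E by apply: integral_ge0 => x _; rewrite lee_fin mulr_ge0// powR_ge0.
set L := lip_norm delta b ^+ m; have L0 : 0 <= L by rewrite exprn_ge0// lip_norm_ge0.
have lf t P := ((HCt t).2 ft mft Ifin).1 P.
pose D t x := (\esum_(k in [set: int]) (frac (shifted_grid R n0 t) p q k *
        avg (fun y => `|ft y| `^ r) (cube_at (shifted_grid R n0 t) k x) `^ r^-1)%:E)%E.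
have Dk0 t x k : (0 <= (frac (shifted_grid R n0 t) p q k *
        avg (fun y => `|ft y| `^ r) (cube_at (shifted_grid R n0 t) k x) `^ r^-1)%:E)%E.
  by rewrite lee_fin mulr_ge0// powR_ge0.
have D0 t x : (0 <= D t x)%E by apply: esum_ge0 => k _; exact: Dk0.
have mD t : measurable_fun setT (D t).
  apply: measurable_fun_esum => [k x _|k _]; first exact: Dk0.
  apply/measurable_EFinP; apply: measurable_funM => //; apply: measurable_fun_powR.
  exact: measurable_cube_at.
have comm_le x : (`|commutator m b K f x| <= (2 * L * A')%:E * \sum_t D t x)%E.
  apply: (le_trans (commutator_le hb m x KE fE mK mft)).
  rewrite [X in (_ <= X * _)%E]EFinM -muleA; apply: lee_wpmul2l.
    by rewrite lee_fin mulr_ge0.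
  exact: (annular_majorant mK (ltW a0) e0 r1 A0 gain HA mft lf x).
have M0 : 0 <= 2 * L * A' by rewrite !mulr_ge0// ltW.
have int_le : (\int[mu]_x (`|commutator m b K f x| `^ q * (w x `^ q)%:E) <=
    ((2 * L * A' * N) `^ q * S)%:E * I `^ (q / p))%E.
  apply: (@le_trans _ _ (\int[mu]_x (((2 * L * A' * N) `^ q)%:E *
      \sum_t (D t x `^ q * (w x `^ q)%:E)))%E).
    apply: lower_integral_le => // x _.
      by rewrite mule_ge0 ?poweR_ge0// lee_fin powR_ge0.
    have wq0 : (0 <= (w x `^ q)%:E)%E by rewrite lee_fin powR_ge0.
    rewrite -ge0_sume_distrl; last by move=> t _; exact: poweR_ge0.
    rewrite muleA; apply: lee_wpmul2r => //.
    apply: (@le_trans _ _ (((2 * L * A')%:E * \sum_t D t x) `^ q)%E).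
      apply: gt0_ler_poweR; rewrite ?(ltW q0)// in_itv/= leey andbT//.
      by rewrite mule_ge0// sume_ge0.
    rewrite poweRM// ?sume_ge0// poweR_EFin.
    rewrite (@powRM _ (2 * L * A') N) ?(ltW N0)// EFinM -muleA.
    apply: lee_wpmul2l; first by rewrite lee_fin powR_ge0.
    by apply: (poweR_sum_le finset.set0) => // t; exact: D0.
  have mDq t : measurable_fun setT (fun x => D t x `^ q * (w x `^ q)%:E)%E.
    apply: emeasurable_funM.
      exact: (measurableT_comp (measurable_poweR q) (mD t)).
    by apply/measurable_EFinP; exact: measurable_fun_powR.
  have Dq0 t x : (0 <= D t x `^ q * (w x `^ q)%:E)%E.
    by rewrite mule_ge0 ?poweR_ge0// lee_fin powR_ge0.
  rewrite ge0_integralZl//; last first.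
  - by rewrite lee_fin powR_ge0.
  - by move=> x _; apply: sume_ge0.
  - exact: emeasurable_sum.
  rewrite EFinM -muleA; apply: lee_wpmul2l; first by rewrite lee_fin powR_ge0.
  rewrite ge0_integral_sum//.
  rewrite /S -sumEFin ge0_sume_distrl; last by move=> t _; have [/ltW] := HCt t.
  by apply: lee_sum => t _; have [_ /(_ ft mft Ifin)[]] := HCt t.
have int0 : (0 <= \int[mu]_x (`|commutator m b K f x| `^ q * (w x `^ q)%:E))%E.
  by apply: integral_ge0 => x _; rewrite mule_ge0 ?poweR_ge0// lee_fin powR_ge0.
apply: (@le_trans _ _ ((((2 * L * A' * N) `^ q * S)%:E * I `^ (q / p)) `^ q^-1)%E).
  apply: gt0_ler_poweR; rewrite ?invr_ge0 ?(ltW q0)// in_itv/= leey andbT//.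
  by rewrite mule_ge0 ?poweR_ge0// lee_fin mulr_ge0 ?powR_ge0// ltW.
have SL0 : 0 <= (2 * L * A' * N) `^ q * S by rewrite mulr_ge0 ?powR_ge0// ltW.
rewrite poweRM ?poweR_ge0// -poweRrM poweR_EFin.
have -> : q / p * q^-1 = p^-1 by field; rewrite !gt_eqF.
rewrite powRM ?powR_ge0 ?(ltW S0)// -powRrM mulfV ?gt_eqF// powRr1; last first.
  by rewrite mulr_ge0// ltW.
apply: lee_wpmul2r; first exact: poweR_ge0.
by rewrite lee_fin le_eqVlt; apply/orP; left; apply/eqP; ring.
Qed.

End borel_weight.

(** The dual exponent of [p / beta] is [1 / (1 - beta / p)], so that the roots of
the two means become [1 / q] and [1/beta - 1/p] after taking the power
[1 / beta]. *)
Lemma Apq_ball_muckenhoupt (R : realType) (n : nat) (p q beta : R)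
    (w : 'rV[R]_n -> R) : 1 <= beta -> beta < p -> 0 < q ->
  Apq (p / beta) (q / beta) (fun x => w x `^ beta) ->
  exists A, ball_muckenhoupt q (beta^-1 - p^-1) A w.
Proof.
move=> b1 bp q0; rewrite /Apq /=; set S := [set _ | _ in _] => Sfin.
have beta0 : 0 < beta by exact: lt_le_trans b1.
have p0 : 0 < p by exact: lt_trans bp.
pose s := ereal_sup S.
have le_s B : S B -> (B <= s)%E by exact: ereal_sup_ubound.
have term0 (x y : \bar R) (u v : R) : (0 <= x `^ u * y `^ v)%E.
  by rewrite mule_ge0 ?poweR_ge0.
have s0 : (0 <= s)%E.
  have [B SB] : S !=set0 by eexists; exists (0, 1) => //=; exact: ltr01.
  by apply: le_trans (le_s _ SB); case: SB => B' _ <-.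
have sE : s = (fine s)%:E by rewrite fineK// ge0_fin_numE.
exists (fine s `^ beta^-1) => x r r0.
set X := mean _ _; set Y := mean _ _.
have pp : p / beta / (p / beta - 1) = beta^-1 / (beta^-1 - p^-1).
  have -> : p / beta - 1 = p * (beta^-1 - p^-1) by rewrite mulrBr mulfV ?gt_eqF.
  by rewrite invfM mulrACA mulfV ?gt_eqF// mul1r.
have bb : beta^-1 - p^-1 != 0 by rewrite gt_eqF// subr_gt0 ltf_pV2.
have EB : beta * (p / beta / (p / beta - 1)) = (beta^-1 - p^-1)^-1.
  by rewrite pp mulrA mulfV ?mul1r// gt_eqF.
have : (X `^ (q / beta)^-1 * Y `^ (p / beta / (p / beta - 1))^-1 <= s)%E.
  have EX : X = mean (eball x r) (fun y => ((w y `^ beta) `^ (q / beta))%:E).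
    congr mean; apply/funext => y; congr EFin.
    by rewrite -powRrM mulrC divfK// gt_eqF.
  have EY : Y = mean (eball x r)
      (fun y => (((w y `^ beta) `^ (p / beta / (p / beta - 1)))%:E)^-1)%E.
    have E y : (w y `^ beta) `^ (p / beta / (p / beta - 1)) = w y `^ (beta^-1 - p^-1)^-1.
      by rewrite -powRrM EB.
    by congr mean; apply/funext => y; rewrite E.
  by rewrite EX EY; apply: le_s; exists (x, r).
rewrite pp.
have -> : (q / beta)^-1 = q^-1 * beta by rewrite invf_div mulrC.
have -> : (beta^-1 / (beta^-1 - p^-1))^-1 = (beta^-1 - p^-1) * beta.
  by rewrite invf_div invrK.
rewrite !poweRrM -poweRM ?poweR_ge0// sE => H.
have := gt0_ler_poweR (r := beta^-1) _ _ _ H.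
rewrite invr_ge0 !in_itv/= !leey !andbT -poweRrM mulfV ?gt_eqF// poweRe1//.
apply; [exact: ltW|exact: poweR_ge0|by rewrite -sE].
Qed.

Theorem theorem2p11 (R : realType) (n m : nat) (alpha delta p q beta : R)
    (b K w : 'rV[R]_n -> R) (Phi Psi : R -> R)
    (halpha : 0 < alpha < n%:R)
    (hdelta : 0 < delta < 1)
    (* the convention (n - alpha) / 0 = +oo *)
    (hdelta_m : (0 < m)%N -> delta < (n%:R - alpha) / m%:R)
    (hp : 1 < p < n%:R / (m%:R * delta + alpha))
    (hq : q^-1 = p^-1 - (m%:R * delta + alpha) / n%:R)
    (hb : Lip delta b)
    (hK : lebesgue_measurable K)
    (hK0 : exists x, K x != 0)
    (hKS : cond_S alpha K)
    (hPhi : young Phi)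
    (hKH : cond_H alpha Phi K)
    (hPsi : forall t, 0 <= t -> young_complement Phi t = (Psi t)%:E)
    (hbeta : 1 <= beta < p)
    (hPsiB : class_Bsb n (m%:R * delta + alpha) beta Psi)
    (hw : weight w)
    (hwA : Apq (p / beta) (q / beta) (fun x => w x `^ beta)) :
  exists C : R, 0 < C /\
    forall f : 'rV[R]_n -> R, Lpw p w f ->
      ((\int[lebesgue_rV R n]_x
          (`|commutator m b K f x| `^ q * (w x `^ q)%:E)) `^ q^-1
       <= (C * lip_norm delta b ^+ m)%:E *
          (\int[lebesgue_rV R n]_x (`|f x| `^ p * w x `^ p)%:E) `^ p^-1)%E.
Proof.
have [s0 nR0 p0 pq _] := exponents halpha hdelta hp hq.
have q0 : 0 < q by exact: lt_trans pq.
have /andP[b1 bp] := hbeta.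
have bb : 0 < beta^-1 - p^-1.
  by rewrite subr_gt0 ltf_pV2// posrE (lt_le_trans _ b1).
have [A HA] := Apq_ball_muckenhoupt b1 bp q0 hwA.
have [w0 [g mg wg] _] := hw.
pose g1 x := Num.max (g x) 0.
have mg1 : measurable_fun setT g1 by exact: measurable_maxr.
have wg1 : {ae lebesgue_rV R n, forall x, w x = g1 x}.
  by apply: filterS wg => x wx; rewrite /g1 -wx max_l.
have g10 x : 0 <= g1 x by rewrite /g1 le_max lexx orbT.
(* The means over balls do not see null sets, so that [w] may be replaced by a
   Borel function; if it vanishes almost everywhere the left-hand side is 0. *)
have [z|pos] := weight_dichotomy bb mg1 g10 (ball_muckenhoupt_ae HA wg1).
  exists 1; split=> // f _.
  rewrite (_ : integral _ _ _ = 0%E); last first.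
    rewrite -[RHS](integral0 (lebesgue_rV R n) setT).
    apply: ae_lower_integral_eq => //.
      by move=> x _; rewrite mule_ge0 ?poweR_ge0// lee_fin powR_ge0.
    by apply: filterS2 wg1 z => x -> -> _; rewrite powR0 ?gt_eqF// mule0.
  rewrite poweR0r ?invr_eq0 ?gt_eqF//.
  by rewrite mule_ge0 ?poweR_ge0// lee_fin mul1r exprn_ge0// lip_norm_ge0.
pose v x := if 0 < g1 x then g1 x else 1.
have v0 x : 0 < v x by rewrite /v; case: ifP.
have mv : measurable_fun setT v.
  by apply: measurable_fun_ifT => //; exact: measurable_fun_ltr.
have wv : {ae lebesgue_rV R n, forall x, w x = v x}.
  by apply: filterS2 wg1 pos => x -> gx; rewrite /v gx.
have [C C0 HC] := commutator_strong_type halpha hdelta hp hq hb hK hKS hPhi hKH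
  hPsi hbeta hPsiB mv v0 (ball_muckenhoupt_ae HA wv).
exists C; split=> // f [[h mh fh] fint].
pose ft x := h x / v x.
have mft : measurable_fun setT ft.
  apply: measurable_funM => //.
  rewrite (_ : (fun x => _) = (fun x => v x `^ (-1))).
    exact: measurable_fun_powR.
  by apply/funext => x; rewrite powR_inv1// ltW.
have fft : {ae lebesgue_rV R n, forall x, f x = ft x}.
  apply: filterS2 fh wv => x fx wx.
  by rewrite /ft -fx -wx mulfK// wx gt_eqF.
have IE : (\int[lebesgue_rV R n]_x (`|f x| `^ p * w x `^ p)%:E =
    \int[lebesgue_rV R n]_x (`|ft x| `^ p * v x `^ p)%:E)%E.
  apply: ae_lower_integral_eq => //.
  - by move=> x _; rewrite lee_fin mulr_ge0// powR_ge0.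
  - by move=> x _; rewrite lee_fin mulr_ge0// powR_ge0.
  - by apply: filterS2 fft wv => x -> -> _.
rewrite IE; have -> : (\int[lebesgue_rV R n]_x (`|commutator m b K f x| `^ q * (w x `^ q)%:E) =
    \int[lebesgue_rV R n]_x (`|commutator m b K f x| `^ q * (v x `^ q)%:E))%E.
  apply: ae_lower_integral_eq => //.
  - by move=> x _; rewrite mule_ge0 ?poweR_ge0// lee_fin powR_ge0.
  - by move=> x _; rewrite mule_ge0 ?poweR_ge0// lee_fin powR_ge0.
  - by apply: filterS wv => x -> _.
apply: HC => //; rewrite -IE; apply: le_lt_trans fint.
rewrite le_eqVlt; apply/orP; left; apply/eqP; apply: eq_integral => x _.
by rewrite normrM (ger0_norm (w0 x)) powRM.
Qed.
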